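(* Let $f:X\to X$ be a continuous and locally injective endomorphism of the compact metric space $X$ and let $\mu$ be a Borel probability measure on $X$ which is $f$-invariant, ergodic and satisfies the zero boundary property. If the Jacobian $J_f(\mu)$ is bounded and $h_f(\mu)<\infty$, then $\mu$ has inverse metric entropy and inverse partition entropy, and $$h^-_{f,B}(\mu)=h_f(\mu)-F_f(\mu)=h^-_f(\mu).$$
   Context: $h_f(\mu)$ is the usual measure-theoretic entropy. Inverse limit: $\widehat X=\{\hat x=(x_0,x_{-1},x_{-2},\ldots): x_{-i}\in X,\ f(x_{-i})=x_{-i+1},\ i\ge1\}$, $\pi(\hat x)=x_0$, $\hat f(x_0,x_{-1},\ldots)=(f(x_0),x_0,x_{-1},\ldots)$; $\hat\mu$ is the unique $\hat f$-invariant ergodic probability measure on $\widehat X$ with $\pi_*\hat\mu=\mu$. Inverse metric entropy: $B_n^-(\hat x,\varepsilon)=\{y\in X:\exists\,\hat y\in\widehat X,\ y_0=y,\ d(x_{-i},y_{-i})<\varepsilon,\ 0\le i\le n\}$. Put $h^-_{f,inf,B}(\mu,\hat x)=\lim_{\varepsilon\to0}\liminf_{n}\frac{-\log\mu(B_n^-(\hat x,\varepsilon))}{n}$, $h^-_{f,sup,B}(\mu,\hat x)=\lim_{\varepsilon\to0}\limsup_{n}\frac{-\log\mu(B_n^-(\hat x,\varepsilon))}{n}$, and let $h^-_{f,inf,B}(\mu)$, $h^-_{f,sup,B}(\mu)$ be their integrals with respect to $\hat\mu$. If they are equal, $\mu$ has inverse metric entropy and $h^-_{f,B}(\mu)$ is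 the common value. Inverse partition entropy: for a measurable partition $\mathcal P$ with atoms $\mathcal P(x)\ni x$, let $\mathcal P_n^-(\hat x)=\{y\in X:\exists\,\hat y\in\widehat X,\ y_0=y,\ y_{-i}\in\mathcal P(x_{-i}),\ 0\le i\le n\}$. Let $h^-_{f,inf}(\mu,\mathcal P)$, $h^-_{f,sup}(\mu,\mathcal P)$ be the $\hat\mu$-integrals of $\liminf_n\frac{-\log\mu(\mathcal P_n^-(\hat x))}{n}$, respectively $\limsup_n\frac{-\log\mu(\mathcal P_n^-(\hat x))}{n}$, and let $h^-_{f,inf}(\mu)$, $h^-_{f,sup}(\mu)$ be their suprema over measurable partitions with $H_\mu(\mathcal P)<\infty$. If these are equal, $\mu$ has inverse partition entropy and $h^-_f(\mu)$ is the common value. Jacobian and folding entropy: $f$ is assumed positively non-singular with respect to $\mu$ ($\mu(A)=0$ implies $\mu(f(A))=0$). If $\{A_0,A_1,\ldots\}$ is a countable measurable partition with $f$ injective on each $A_i$, then $J_f(\mu)=\frac{d(\mu\circ f|_{A_i})}{d\mu}$ $\mu$-a.e. on $A_i$. The folding entropy is $F_f(\mu)=H_\mu(\epsilon\,|\,f^{-1}\epsilon)$, with $\epsilon$ the partition into points and $f^{-1}\epsilon$ the partition into fibers of $f$; equivalently $F_f(\mu)=\int\log J_f(\mu)\,d\mu$. Zero boundary property: for every $\varepsilon'>0$ there exists a finite measurable partition $\mathcal P$ of $X$ such that $\mu(\partial\mathcal P)=0$ (where $\partial\mathcal P$ is the union of the boundaries of the atoms) and such that for $\mu$-a.e. $x\in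 X$, $e^{-\varepsilon'}<\left|\frac{J_f(\mu)(x)}{J_f(\mu)(y)}\right|<e^{\varepsilon'}$ for $\mu$-a.e. $y\in\mathcal P(x)$. *)

(* Defs.v *)
From HB Require Import structures.
From mathcomp Require Import all_boot all_order all_algebra.
From mathcomp Require Import all_classical all_reals all_analysis.

Set Implicit Arguments.
Unset Strict Implicit.
Unset Printing Implicit Defensive.

Import Order.TTheory GRing.Theory Num.Theory.
Import numFieldNormedType.Exports.

Local Open Scope classical_set_scope.
Local Open Scope ring_scope.
Local Open Scope ereal_scope.

(* The library only puts sigma-algebras on pointed types. Pointedness costs
   nothing here: a space that carries a probability measure is nonempty. *)
#[short(type="pmetricType")]
HB.structure Definition PointedMetric (K : numDomainType) :=
  { M of Metric K M & Pointed M }.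

Definition borel (T : ptopologicalType) := g_sigma_algebraType (@open T).

(* Pasts (x_0, x_{-1}, x_{-2}, ...), with x_{-i} written x i and the product
   topology. *)
Definition pasts (T : ptopologicalType) := prod_topology (fun _ : nat => T).

HB.instance Definition _ (T : ptopologicalType) := Topological.on (pasts T).
HB.instance Definition _ (T : ptopologicalType) :=
  isPointed.Build (pasts T) (fun=> point).

Section dynamics.
Context {R : realType}.

Definition invariant_measure d (T : measurableType d) (g : T -> T)
    (m : probability T R) : Prop :=
  forall A : set T, measurable A -> m (g @^-1` A) = m A.

Definition ergodic_measure d (T : measurableType d) (g : T -> T)
    (m : probability T R) : Prop :=
  forall A : set T, measurable A -> g @^-1` A = A -> m A = 0 \/ m A = 1.

Definition locally_injective (T : topologicalType) (f : T -> T) : Prop :=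
  forall x : T, exists2 U : set T, nbhs x U & {in U &, injective f}.

End dynamics.

Section partitions.
Context {R : realType} d (T : measurableType d).
Implicit Types (m : probability T R) (P : T -> set T) (g : T -> T).

(* A partition is given by the map sending x to the atom P x containing x. *)
Definition is_partition P : Prop :=
  (forall x, P x x) /\ (forall x y, P x y -> P x = P y).

Definition finite_measurable_partition P : Prop :=
  [/\ is_partition P, forall x, measurable (P x) & finite_set (range P)].

(* Rokhlin's notion: the atoms are separated by countably many measurable
   unions of atoms. *)
Definition measurable_partition P : Prop :=
  exists2 B : nat -> set T, (forall k, measurable (B k)) &
    forall x, P x = [set y | forall k, B k x <-> B k y].

(* H_m(P), the integral of the information function. As lne 0 = -oo, it equals
   - \sum_C m(C) log m(C) when the atoms C of positive measure cover the space
   up to a null set, and +oo otherwise. *)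
Definition partition_entropy m P : \bar R := \int[m]_x (- lne (m (P x))).

(* P \/ g^-1 P \/ ... \/ g^-(n-1) P *)
Definition joined g P (n : nat) : T -> set T :=
  fun x => [set y | forall i, (i < n)%N -> P (iter i g x) (iter i g y)].

Definition entropy_along g m P : \bar R :=
  limn (fun n => (n%:R^-1)%:E * partition_entropy m (joined g P n)).

Definition measure_entropy g m : \bar R :=
  ereal_sup [set entropy_along g m P | P in finite_measurable_partition].

End partitions.

Section inverse_entropy.
Context {R : realType} {X : pmetricType R}.
Variables (f : X -> X) (mu : probability (borel X) R).

Definition inverse_limit : set (pasts X) :=
  [set x | forall i, f (x i.+1) = x i].

(* \hat f, extended to all sequences by the same formula; the preimage of
   inverse_limit under this extension is inverse_limit itself. *)
Definition lift_map (x : pasts X) : pasts X :=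
  fun i => if i is j.+1 then x j else f (x 0%N).

(* Measures on the inverse limit are represented by measures on the space of
   all sequences which give full mass to the (closed) inverse limit. *)
Definition inverse_limit_measure (muhat : probability (borel (pasts X)) R) :
    Prop :=
  [/\ muhat inverse_limit = 1,
      invariant_measure (lift_map : borel (pasts X) -> borel (pasts X)) muhat,
      ergodic_measure (lift_map : borel (pasts X) -> borel (pasts X)) muhat &
      forall A : set (borel X), measurable A ->
        muhat [set x : pasts X | A (x 0%N)] = mu A].

Definition inverse_ball (n : nat) (xhat : pasts X) (e : R) : set X :=
  [set y | exists yhat : pasts X, [/\ inverse_limit yhat, yhat 0%N = y &
    forall i, (i <= n)%N -> (mdist (xhat i) (yhat i) < e)%R]].

Definition inverse_atom (P : X -> set X) (n : nat) (xhat : pasts X) : set X :=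
  [set y | exists yhat : pasts X, [/\ inverse_limit yhat, yhat 0%N = y &
    forall i, (i <= n)%N -> P (xhat i) (yhat i)]].

Definition decay_rate (A : set X) (n : nat) : \bar R :=
  (n%:R^-1)%:E * - lne (mu A).

Definition local_inverse_entropy_inf (xhat : pasts X) : \bar R :=
  lim (limn_einf (fun n => decay_rate (inverse_ball n xhat e) n)
       @[e --> (0 : R)^'+]).

Definition local_inverse_entropy_sup (xhat : pasts X) : \bar R :=
  lim (limn_esup (fun n => decay_rate (inverse_ball n xhat e) n)
       @[e --> (0 : R)^'+]).

Variable muhat : probability (borel (pasts X)) R.

Definition inverse_metric_entropy_inf : \bar R :=
  \int[muhat]_(xhat in inverse_limit) local_inverse_entropy_inf xhat.

Definition inverse_metric_entropy_sup : \bar R :=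
  \int[muhat]_(xhat in inverse_limit) local_inverse_entropy_sup xhat.

Definition has_inverse_metric_entropy : Prop :=
  inverse_metric_entropy_inf = inverse_metric_entropy_sup.

(* Meaningful when has_inverse_metric_entropy holds. *)
Definition inverse_metric_entropy : \bar R := inverse_metric_entropy_inf.

Definition inverse_entropy_inf_along (P : X -> set X) : \bar R :=
  \int[muhat]_(xhat in inverse_limit)
    limn_einf (fun n => decay_rate (inverse_atom P n xhat) n).

Definition inverse_entropy_sup_along (P : X -> set X) : \bar R :=
  \int[muhat]_(xhat in inverse_limit)
    limn_esup (fun n => decay_rate (inverse_atom P n xhat) n).

Definition finite_entropy_partition (P : borel X -> set (borel X)) : Prop :=
  measurable_partition P /\ partition_entropy mu P < +oo.

Definition inverse_partition_entropy_inf : \bar R :=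
  ereal_sup [set inverse_entropy_inf_along P | P in finite_entropy_partition].

Definition inverse_partition_entropy_sup : \bar R :=
  ereal_sup [set inverse_entropy_sup_along P | P in finite_entropy_partition].

Definition has_inverse_partition_entropy : Prop :=
  inverse_partition_entropy_inf = inverse_partition_entropy_sup.

(* Meaningful when has_inverse_partition_entropy holds. *)
Definition inverse_partition_entropy : \bar R := inverse_partition_entropy_inf.

End inverse_entropy.

Section jacobian.
Context {R : realType} {X : pmetricType R}.
Variables (f : X -> X) (mu : probability (borel X) R).

(* Below, f @` A is evaluated by mu for Borel A only; it is then Borel when X
   is compact and f is continuous and locally injective. *)
Definition positively_nonsingular : Prop :=
  forall A : set (borel X), measurable A -> mu A = 0 -> mu (f @` A) = 0.

(* J is a version of the Jacobian: on each A_i it is the Radon-Nikodym density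
   of B |-> mu (f B) with respect to mu. Empty A_i are allowed. *)
Definition is_jacobian (J : borel X -> R) : Prop :=
  measurable_fun setT J /\
  exists A : nat -> set (borel X),
    [/\ forall i, measurable (A i), trivIset setT A, \bigcup_i A i = setT,
        forall i, {in A i &, injective f} &
        forall i (B : set (borel X)), measurable B -> B `<=` A i ->
          mu (f @` B) = \int[mu]_(x in B) (J x)%:E].

Definition jacobian_bounded (J : borel X -> R) : Prop :=
  exists M : R, \forall x \ae mu, (`|J x| <= M)%R.

(* A canonical (Rokhlin) system of conditional measures of mu for the partition
   f^-1 epsilon: k (f x) is the conditional measure on the fiber through x. *)
Definition fiber_disintegration (k : R.-pker (borel X) ~> (borel X)) : Prop :=
  (\forall x \ae mu, k (f x) (f @^-1` [set f x]) = 1) /\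
  (forall A : set (borel X), measurable A -> mu A = \int[mu]_x k (f x) A).

(* H_mu(epsilon | f^-1 epsilon): the average over the fibers of the entropy of
   the partition into points with respect to the conditional measures. *)
Definition folding_entropy (k : R.-pker (borel X) ~> (borel X)) : \bar R :=
  \int[mu]_x \int[k (f x)]_y (- lne (k (f x) [set y])).

Definition partition_boundary (P : X -> set X) : set X :=
  \bigcup_x (closure (P x) `\` interior (P x)).

Definition zero_boundary (J : borel X -> R) : Prop :=
  forall e : R, (0 < e)%R ->
    exists P : borel X -> set (borel X),
      [/\ finite_measurable_partition P,
          mu (partition_boundary P) = 0 &
          \forall x \ae mu, \forall y \ae mu, P x y ->
            (expR (- e) < `|J x / J y| < expR e)%R].

End jacobian.

(* Main.v *)
(* The inverse ball (or atom) of length n at (x_0, x_-1, ...) is the image under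
   f^n of the set of points that follow the orbit x_-n, ..., x_0 forward. By the
   Shannon-McMillan-Breiman theorem this set has measure about exp(- n h), for
   balls because a Bowen ball meets few cylinders. Each application of f
   multiplies measure by the Jacobian, so by Birkhoff's theorem f^n multiplies
   it by about exp(n F), where F is the integral of log J. For atoms, a lower
   bound suffices: refine the partition so that on its atoms f is injective and
   log J nearly constant. For balls, an upper bound suffices: by the zero
   boundary property J is nearly constant on small balls, except around points
   of a set of small measure, where it is bounded. As atoms of small diameter
   are contained in balls, both rates are h - F. *)

Require Import Defs.
From HB Require Import structures.
From mathcomp Require Import all_boot all_order all_algebra.
From mathcomp Require Import all_classical all_reals all_analysis.
From mathcomp Require Import measurable_realfun ring lra.

Set Implicit Arguments.
Unset Strict Implicit.
Unset Printing Implicit Defensive.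

Import Order.TTheory GRing.Theory Num.Theory.
Import numFieldNormedType.Exports.
Import HBNNSimple.

Local Open Scope classical_set_scope.
Local Open Scope ring_scope.

(** * Integrals and Birkhoff averages *)

Local Open Scope ereal_scope.

(** Almost all cylinder estimates come from one device, [ae_weight_le]: nonnegative weights on words
    whose sum over the words of each length is at most 1 are, along almost every orbit, eventually
    at most exp(e n) times the measure of the cylinder. Different weights give one half of the
    Shannon-McMillan-Breiman theorem, the comparisons between labels and the bound for Bowen balls;
    the other half puts weights into Gibbs' inequality. The obstacle is that the estimates are
    needed at x_-n, a base point that moves with n, whereas an almost sure statement under [f]
    concerns a fixed one. They are therefore proved on the space of pasts for [shift], the inverse
    of the lifted map, whose orbits visit x_0, x_-1, ... in turn and whose cylinders have the
    measures of the reversed cylinders of [f]. The local entropies are never shown to be measurable.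
    Their integrals are determined by values off a null set, which is legitimate because an integral
    is a supremum over simple functions. *)

Section nonmeasurable_integrands.
Context {R : realType} d (T : measurableType d) (m : {measure set T -> \bar R}).

(* The integral of a function that need not be measurable is the supremum of
   the integrals of the simple functions below it. *)
Lemma ge0_le_integral_off_null (N : set T) (F G : T -> \bar R) :
  measurable N -> m N = 0 -> (forall x, 0 <= F x) -> (forall x, 0 <= G x) ->
  (forall x, ~ N x -> F x <= G x) -> \int[m]_x F x <= \int[m]_x G x.
Proof.
move=> mN N0 F0 G0 FG; rewrite ge0_integralTE//.
(* Cutting a simple function [h] below [F] down to the complement of [N] keeps its integral and
   brings it below [G]. *)
apply: ge_ereal_sup => /= _ [h hF <-].
have mCN : measurable (~` N) by exact: measurableC.
rewrite -integralT_nnsfun (ge0_negligible_integral mN)//; last 2 first.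
- exact/measurable_EFinP/measurable_funP.
- by move=> x _; rewrite lee_fin.
rewrite setTD integral_mkcond.
rewrite [leLHS](_ : _ = \int[m]_x (proj_nnsfun h mCN x)%:E).
  rewrite integralT_nnsfun ge0_integralTE//; apply: ereal_sup_ubound.
  exists (proj_nnsfun h mCN) => // x; rewrite /proj_nnsfun/= mindicE.
  have [xN|xN] := boolP (x \in ~` N); last by rewrite mulr0.
  by rewrite mulr1 (le_trans (hF x))// FG//; rewrite inE in xN.
apply: eq_integral => x _; rewrite patchE /proj_nnsfun/= mindicE.
by case: ifPn => _; rewrite ?mulr1 ?mulr0.
Qed.

(** Positive and negative parts are compared both ways by the previous lemma, so nothing is asked of
    the measurability of [F], [G] and [D]. This is how the integrals of local entropies are
    evaluated. *)
Lemma integral_eq_off_null (N D : set T) (F G : T -> \bar R) :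
  measurable N -> m N = 0 -> (forall x, D x -> ~ N x -> F x = G x) ->
  \int[m]_(x in D) F x = \int[m]_(x in D) G x.
Proof.
move=> mN N0 FG.
have key (H K : T -> \bar R) : (forall x, 0 <= H x) -> (forall x, 0 <= K x) ->
    (forall x, ~ N x -> H x = K x) -> \int[m]_x H x = \int[m]_x K x.
  move=> H0 K0 HK; apply/eqP; rewrite eq_le; apply/andP; split;
    by apply: (ge0_le_integral_off_null mN N0) => // x /HK ->.
have FGD x : ~ N x -> (F \_ D) x = (G \_ D) x.
  by move=> Nx; rewrite !patchE; case: ifPn => //; rewrite inE => Dx; exact: FG.
rewrite integral_mkcond [RHS]integral_mkcond integralE [RHS]integralE.
by congr (_ - _); apply: key => // x /FGD FGx; rewrite ?funeposE ?funenegE FGx.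
Qed.

End nonmeasurable_integrands.

Lemma integral_cst_probability {R : realType} d (T : measurableType d)
    (m : probability T R) (c : R) : \int[m]_x (EFin \o cst c) x = c%:E.
Proof.
rewrite (_ : EFin \o cst c = cst c%:E)// integral_cst//.
have -> : (m : {measure set T -> \bar R}) setT = 1 by exact: probability_setT.
by rewrite mule1.
Qed.

Section ergodic_averages.
Context {R : realType} d (T : measurableType d) (m : probability T R).
Variable S : T -> T.
Hypotheses (mS : measurable_fun setT S) (Sm : invariant_measure S m).
Hypothesis eS : ergodic_measure S m.

Lemma measurable_preimage (A : set T) : measurable A -> measurable (S @^-1` A).
Proof. by move=> mA; rewrite -[S @^-1` A]setTI; exact: mS. Qed.

Lemma measurable_iter n : measurable_fun setT (iter n S).
Proof.
by elim: n => [|n IH]; [exact: measurable_id|exact: measurableT_comp].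
Qed.

Lemma measure_iter_preimage n (A : set T) : measurable A ->
  m (iter n S @^-1` A) = m A.
Proof.
elim: n A => [//|n IH] A mA.
rewrite -[RHS]Sm// -[RHS]IH//; exact: measurable_preimage.
Qed.

Lemma integral_invariant (F : T -> \bar R) :
  measurable_fun setT F -> m.-integrable setT (F \o S) ->
  \int[m]_x F (S x) = \int[m]_x F x.
Proof.
move=> mF iF; have := integral_pushforward mS mF iF measurableT.
rewrite preimage_setT => <-; apply: eq_measure_integral => A mA _.
exact: Sm.
Qed.

Lemma integrable_invariant (F : T -> \bar R) :
  m.-integrable setT F -> m.-integrable setT (F \o S).
Proof.
move=> /integrableP[mF iF]; apply/integrableP; split.
  exact: measurableT_comp.
have mF' : measurable_fun setT (fun x => `|F x|) by exact: measurableT_comp.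
have := @ge0_integral_pushforward _ _ _ _ R _ mS m setT _ measurableT mF'
  (fun y _ => abse_ge0 _).
rewrite preimage_setT /comp => <-.
rewrite (@eq_measure_integral _ _ _ setT m)// => A mA _; exact: Sm.
Qed.

(** The preimages of [A] under the iterates of [S] increase, all with measure [m A], to an exactly
    invariant set. *)
Lemma zero_one (A : set T) : measurable A -> A `<=` S @^-1` A ->
  m A = 0 \/ m A = 1.
Proof.
move=> mA AS; pose B := \bigcup_n (iter n S @^-1` A).
have mB : measurable B.
  apply: bigcup_measurable => n _.
  by rewrite -[X in measurable X]setTI; exact: measurable_iter.
have BE : S @^-1` B = B.
  apply/seteqP; split => [x [n _ /=]|x [n _ /= Anx]].
    by rewrite -iterSr; exists n.+1.
  by exists n => //=; rewrite -iterSr /=; exact: AS.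
have nd : {homo (fun n => iter n S @^-1` A) : n p / (n <= p)%N >-> (n <= p)%O}.
  apply/nondecreasing_seqP => n; rewrite subsetEset => x /= Ax; exact: AS.
have mn n : measurable (iter n S @^-1` A).
  by rewrite -[X in measurable X]setTI; exact: measurable_iter.
have cB : m (iter n S @^-1` A) @[n --> \oo] --> m B.
  exact: nondecreasing_cvg_mu mn mB nd.
have -> : m A = m B; last exact: eS.
have cA : m (iter n S @^-1` A) @[n --> \oo] --> m A.
  by apply: cvg_near_cst; apply: nearW => n; exact: measure_iter_preimage.
exact: cvg_unique cA cB.
Qed.

(** The maximum over 0 <= k <= n of the Birkhoff sums of length k, by recursion on the first step as
    in Garsia's proof of the maximal ergodic theorem. *)
Fixpoint maxsum (g : T -> R) n x : R :=
  (if n is n'.+1 then Num.max 0 (g x + maxsum g n' (S x)) else 0)%R.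

Lemma maxsum_ge0 g n x : (0 <= maxsum g n x)%R.
Proof. by case: n => [//|n] /=; rewrite le_max lexx. Qed.

Lemma le_maxsumS g n x : (maxsum g n x <= maxsum g n.+1 x)%R.
Proof.
elim: n x => [|n IH] x; first exact: maxsum_ge0.
rewrite [leLHS]/= [leRHS]/=; apply: le_max2 => //.
  by rewrite lerD2l; exact: IH.
Qed.

Lemma sum_le_maxsum g n x : (\sum_(i < n) g (iter i S x) <= maxsum g n x)%R.
Proof.
elim: n x => [|n IH] x; first by rewrite big_ord0.
rewrite big_ord_recl /= le_max lerD2l; apply/orP; right.
by rewrite (le_trans _ (IH (S x)))// ler_sum// => i _; rewrite -iterSr.
Qed.

Section maximal_sums.
Variable g : T -> R.
Hypothesis ig : m.-integrable setT (EFin \o g).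

Let mg : measurable_fun setT g.
Proof. exact/measurable_EFinP/(measurable_int m). Qed.

Let mM n : measurable_fun setT (maxsum g n).
Proof.
elim: n => [|n IH]; first exact: measurable_cst.
apply: measurable_maxr; first exact: measurable_cst.
by apply: measurable_funD => //; exact: measurableT_comp IH mS.
Qed.

Let iM n : m.-integrable setT (EFin \o maxsum g n).
Proof.
elim: n => [|n IH]; first exact: integrable0.
apply: (@le_integrable _ _ _ _ _ measurableT _
    ((EFin \o g) \+ ((EFin \o maxsum g n) \o S))).
- exact/measurable_EFinP.
- move=> x _; rewrite /= lee_fin.
  case: (leP 0%R (g x + maxsum g n (S x))%R) => _ //; by rewrite normr0.
- by apply: integrableD => //; exact: integrable_invariant.
Qed.

Let unbounded := [set x | forall c : nat, exists n, (c%:R < maxsum g n x)%R].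

Let munbounded : measurable unbounded.
Proof.
rewrite (_ : unbounded =
    \bigcap_c \bigcup_n (maxsum g n @^-1` `]c%:R, +oo[%classic)).
  apply: bigcapT_measurable => c; apply: bigcupT_measurable => n.
  by rewrite -[X in measurable X]setTI; apply: mM => //; exact: measurable_itv.
apply/seteqP; split => x /= h c; have := h c.
  by move=> [n cn] _; exists n => //=; rewrite in_itv/= cn.
by case=> // n _ /=; rewrite in_itv/= andbT => cn; exists n.
Qed.

Let unbounded_invariant : S @^-1` unbounded = unbounded.
Proof.
apply/seteqP; split => x /= h c.
  have [k ck] : exists k : nat, (c%:R - g x < k%:R)%R.
    exists (Num.bound `|c%:R - g x|%R).
    by rewrite (le_lt_trans (ler_norm _))// archi_boundP.
  have [n kn] := h k; exists n.+1 => /=; rewrite lt_max; apply/orP; right.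
  by rewrite -ltrBlDl (lt_trans ck).
have [k ck] : exists k : nat, (c%:R + g x < k%:R)%R.
  exists (Num.bound `|c%:R + g x|%R).
  by rewrite (le_lt_trans (ler_norm _))// archi_boundP.
have [[|n] kn] := h (maxn k 1).
  by move: kn => /=; rewrite ltNge ler0n.
exists n; move: kn => /=; rewrite lt_max => /orP[|].
  by rewrite ltNge ler0n.
move=> kn; have : (k%:R <= (maxn k 1)%:R :> R)%R by rewrite ler_nat leq_maxl.
by lra.
Qed.

(* The increments [maxsum n.+1 - maxsum n \o S] have nonnegative integrals and
   tend to [g] wherever the sums are unbounded. *)
Lemma ae_bounded_sums : \int[m]_x (g x)%:E < 0 ->
  \forall x \ae m, exists B : R, forall n,
    (\sum_(i < n) g (iter i S x) <= B)%R.
Proof.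
move=> g0; have [U0|U1] := eS munbounded unbounded_invariant.
  exists unbounded; split => // x /= nB; apply: contrapT.
  move=> /existsNP[c /forallNP cn]; apply: nB; exists c%:R => n.
  by rewrite (le_trans (sum_le_maxsum _ _ _))// leNgt; exact/negP.
exfalso; pose D n x := (maxsum g n.+1 x - maxsum g n (S x))%R.
have iMS n : m.-integrable setT (EFin \o (maxsum g n \o S)).
  by have := integrable_invariant (iM n).
have DE n x : D n x = Num.max (- maxsum g n (S x))%R (g x).
  by rewrite /D /= addr_maxl sub0r addrK.
have mD n : measurable_fun setT (EFin \o D n).
  apply/measurable_EFinP; apply: measurable_funB => //.
  exact: measurableT_comp (mM n) mS.
have D0 n : 0 <= \int[m]_x (D n x)%:E.
  rewrite (_ : \int[m]_x _ =
    \int[m]_x ((EFin \o maxsum g n.+1) \- (EFin \o (maxsum g n \o S))) x)//.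
  rewrite integralB// (@integral_invariant (EFin \o maxsum g n))//; last 2 first.
  - exact/measurable_EFinP.
  - exact: iMS.
  rewrite sube_ge0; last by rewrite integrable_fin_num.
  by apply: le_integral => // x _; rewrite lee_fin le_maxsumS.
have cvgD : {ae m, forall x, setT x ->
    (EFin \o D n) x @[n --> \oo] --> (EFin \o g) x}.
  exists (~` unbounded); split; first exact: measurableC.
    have := probability_setC m munbounded.
    by move: U1; move=> /= -> ->; rewrite subee.
  move=> x /= nx Ux; apply: nx => _.
  have : (S @^-1` unbounded) x by rewrite unbounded_invariant.
  (* Once [maxsum g n (S x)] exceeds - g x, the maximum that gives [D n x] is [g x]. *)
  move=> /(_ (Num.bound `|- g x|%R))[n0 hn0].
  apply: cvg_near_cst; exists n0 => // n /= n0n; congr EFin; rewrite DE.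
  apply/max_idPr; rewrite lerNl (@le_trans _ _ (maxsum g n0 (S x)))//.
    rewrite (le_trans _ (ltW hn0))// (le_trans (ler_norm _))//.
    by rewrite ltW// archi_boundP.
  exact: (homo_leq (@lexx _ _) (@le_trans _ _) (fun k => le_maxsumS g k (S x))).
(* [D n x] is the maximum of [g x] and a nonpositive number. *)
have dom : {ae m, forall x n, setT x ->
    `|(EFin \o D n) x| <= (abse \o (EFin \o g)) x}.
  apply: aeW => x n _; rewrite /= DE lee_fin.
  have := maxsum_ge0 g n (S x); set M := maxsum _ _ _ => M0.
  case: (leP (- M)%R (g x)) => // gM.
  by rewrite normrN ger0_norm// ltr0_norm; lra.
have [_ _ cvgI] := dominated_convergence measurableT mD
  (measurable_int _ ig) cvgD (integrable_abse ig) dom.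
have : 0 <= \int[m]_x (EFin \o g) x.
  by apply: cvge_ge cvgI; exact: nearW.
by rewrite leNgt g0.
Qed.

End maximal_sums.

(** The function g - c', with c' midway between the integral and [c], has negative integral, so its
    Birkhoff sums are bounded; the bound is eventually absorbed by (c - c') n. Lower bounds follow
    by passing to - g. *)
Lemma birkhoff_le (g : T -> R) (c : R) : m.-integrable setT (EFin \o g) ->
  \int[m]_x (g x)%:E < c%:E ->
  \forall x \ae m, \forall n \near \oo,
    (\sum_(i < n) g (iter i S x) <= c * n%:R)%R.
Proof.
move=> ig gc; have gfin := integrable_fin_num measurableT ig.
pose b := fine (\int[m]_x (g x)%:E); pose c' := ((b + c) / 2)%R.
have bc : (b < c)%R by rewrite -lte_fin fineK.
pose g' x := (g x - c')%R.
have ic : m.-integrable setT (EFin \o cst c').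
  exact: finite_measure_integrable_cst.
have ig' : m.-integrable setT (EFin \o g').
  have -> : EFin \o g' = (EFin \o g) \- (EFin \o cst c').
    by apply/funext => x; rewrite /= EFinB.
  exact: integrableB.
have g'0 : \int[m]_x (g' x)%:E < 0.
  rewrite (_ : \int[m]_x _ = \int[m]_x ((EFin \o g) \- (EFin \o cst c')) x)//.
  have Ic := integral_cst_probability m c'.
  rewrite integralB// Ic.
  by rewrite -(fineK gfin) -EFinB lte_fin -/b /c'; lra.
have := ae_bounded_sums ig' g'0; apply: filterS => x [B hB].
have c'c : (0 < c - c')%R by rewrite /c'; lra.
near=> n; have := hB n; rewrite sumrB sumr_const card_ord -mulr_natr.
have : (B / (c - c') <= n%:R)%R by near: n; exact: nbhs_infty_ger.
by rewrite ler_pdivrMr//; lra.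
Unshelve. all: by end_near. Qed.

End ergodic_averages.

Local Close Scope ereal_scope.

(** * Words of a labelled system *)

Section real_probability.
Context {R : realType} d (T : measurableType d) (m : probability T R).
Implicit Types A B : set T.

Definition prob A : R := fine (m A).

Lemma probE A : measurable A -> m A = (prob A)%:E.
Proof. by move=> mA; rewrite /prob fineK// fin_num_measure. Qed.

Lemma prob_ge0 A : 0 <= prob A.
Proof. by rewrite fine_ge0. Qed.

Lemma prob_le1 A : measurable A -> prob A <= 1.
Proof. by move=> mA; rewrite -lee_fin -probE// probability_le1. Qed.

Lemma prob_setT : prob setT = 1.
Proof. by rewrite /prob probability_setT. Qed.

Lemma prob_le A B : measurable A -> measurable B -> A `<=` B ->
  prob A <= prob B.
Proof.
by move=> mA mB AB; rewrite -lee_fin -!probE// le_measure// inE.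
Qed.

Lemma prob_splitI A B : measurable A -> measurable B ->
  prob A = prob (A `&` B) + prob (A `\` B).
Proof.
move=> mA mB; have mI : measurable (A `&` B) by exact: measurableI.
have mD : measurable (A `\` B) by exact: measurableD.
apply: EFin_inj; rewrite EFinD -!probE// -measureU//; first by rewrite setUIDK.
by rewrite -subset0 => x [[_ Bx] [_ /(_ Bx)]].
Qed.

Lemma prob_fibers_le (I : eqType) (l : T -> I) (s : seq I) A :
  measurable A -> (forall a, measurable (l @^-1` [set a])) -> uniq s ->
  \sum_(a <- s) prob (A `&` l @^-1` [set a]) <= prob A.
Proof.
move=> + ml; elim: s A => [|a s IH] A mA; first by rewrite big_nil prob_ge0.
move=> /= /andP[nas us]; rewrite big_cons (prob_splitI mA (ml a)) lerD2l.
have mD : measurable (A `\` l @^-1` [set a]) by exact: measurableD.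
rewrite (le_trans _ (IH _ mD us))// big_seq [leRHS]big_seq.
apply: ler_sum => b bs; apply: prob_le; [exact: measurableI..|].
move=> x /= [Ax lx]; split => //; split => // lxa.
by move: nas; rewrite -lxa lx bs.
Qed.

Lemma prob_fibers (I : eqType) (l : T -> I) (s : seq I) A :
  measurable A -> (forall a, measurable (l @^-1` [set a])) -> uniq s ->
  (forall x, A x -> l x \in s) ->
  \sum_(a <- s) prob (A `&` l @^-1` [set a]) = prob A.
Proof.
move=> + ml; elim: s A => [|a s IH] A mA.
  move=> _ As; rewrite big_nil (_ : A = set0) /prob ?measure0//.
  by rewrite -subset0 => x /As.
move=> /= /andP[nas us] As; rewrite big_cons (prob_splitI mA (ml a)).
congr (_ + _); have mD : measurable (A `\` l @^-1` [set a]) by exact: measurableD.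
rewrite -(IH _ mD us); last first.
  by move=> x [Ax /eqP]; have := As x Ax; rewrite inE => /orP[->|].
rewrite big_seq [RHS]big_seq.
apply: eq_bigr => b bs; congr prob; apply/seteqP; split.
- move=> x /= [Ax lx]; split => //; split => // lxa.
  by move: nas; rewrite -lxa lx bs.
- by move=> x /= [[]].
Qed.

(** The Borel-Cantelli lemma, with a geometric series as majorant. *)
Lemma ae_eventually_not (F : nat -> set T) (z : R) : 0 < z -> z < 1 ->
  (forall n, measurable (F n)) -> (forall n, prob (F n) <= z ^+ n) ->
  \forall x \ae m, \forall n \near \oo, ~ F n x.
Proof.
move=> z0 z1 mF Fz.
have h : m (lim_sup_set F) = 0%E.
  apply: lim_sup_set_cvg0 => //.
  apply: (@le_lt_trans _ _ (1 / (1 - z))%:E); last exact: ltry.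
  apply: lime_le; first exact: is_cvg_nneseries.
  apply: nearW => n; rewrite (eq_bigr (fun i => (prob (F i))%:E)); last first.
    by move=> i _; exact: probE.
  rewrite sumEFin lee_fin.
  have := @geometric_le_lim R n 1 z ler01 z0; rewrite (ger0_norm (ltW z0)).
  move=> /(_ z1) gl; apply: le_trans gl; rewrite /series/=.
  by apply: ler_sum => i _; rewrite /geometric/= mul1r.
exists (lim_sup_set F); split => //.
  apply: bigcapT_measurable => k; apply: bigcup_measurable => i _; exact: mF.
move=> x /= nx k _; apply: contrapT => nF; apply: nx; exists k => // n kn Fn.
by apply: nF; exists n.
Qed.

End real_probability.

(** * Words, cylinders, and weights on words *)

Section words.
Context {R : realType} d (T : measurableType d) (m : probability T R).
Variable S : T -> T.
Hypotheses (mS : measurable_fun setT S) (Sm : invariant_measure S m).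

Lemma prob_preimage (A : set T) : measurable A ->
  prob m (S @^-1` A) = prob m A.
Proof. by move=> mA; rewrite /prob Sm. Qed.

Section allwords.
Variable C : eqType.

Fixpoint allwords (s : seq C) n : seq (seq C) :=
  if n is n'.+1 then [seq a :: w | a <- s, w <- allwords s n'] else [:: [::]].

Lemma sum_allwordsS (s : seq C) n (F : seq C -> R) :
  \sum_(w <- allwords s n.+1) F w =
  \sum_(a <- s) \sum_(w <- allwords s n) F (a :: w).
Proof. by rewrite /= big_allpairs_dep. Qed.

Lemma sum_allwords0 (s : seq C) (F : seq C -> R) :
  \sum_(w <- allwords s 0) F w = F [::].
Proof. exact: big_seq1. Qed.

Lemma sum_allwordsD (s : seq C) n p (F : seq C -> R) :
  \sum_(w <- allwords s (n + p)) F w =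
  \sum_(u <- allwords s n) \sum_(v <- allwords s p) F (u ++ v).
Proof.
elim: n F => [|n IH] F; first by rewrite big_seq1.
rewrite addSn !sum_allwordsS; apply: eq_bigr => a _; exact: IH.
Qed.

Lemma mem_allwords (s : seq C) n w :
  (w \in allwords s n) = (size w == n) && all (mem s) w.
Proof.
elim: n w => [|n IH] [|a w] //=.
- by apply/allpairsP => -[[b v]] [].
- rewrite eqSS; apply/allpairsP/andP => [[[b v]] /= [bs] + [-> ->]|].
    by rewrite IH => /andP[-> ->]; rewrite bs.
  by move=> [wn /andP[as_ ws]]; exists (a, w); split => //=; rewrite IH wn.
Qed.

Lemma uniq_allwords (s : seq C) n : uniq s -> uniq (allwords s n).
Proof.
move=> us; elim: n => [//|n IH] /=.
by apply: allpairs_uniq => // -[a w] [b v] _ _ /= [-> ->].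
Qed.

Lemma ler_sum_sub (I : eqType) (r s : seq I) (F : I -> R) : uniq r -> uniq s ->
  {subset r <= s} -> (forall i, 0 <= F i) ->
  \sum_(i <- r) F i <= \sum_(i <- s) F i.
Proof.
move=> ur us rs F0; have pr : perm_eq r [seq i <- s | i \in r].
  apply: uniq_perm => //; first exact: filter_uniq.
  by move=> i; rewrite mem_filter; case: (boolP (i \in r)) => // /rs ->.
rewrite (perm_big _ pr) /= big_filter big_mkcond /=.
by apply: ler_sum => i _; case: ifP.
Qed.

End allwords.

Arguments allwords : simpl never.

(** [q] hands out at most unit mass among the letters above each [b]; hence, by induction on the
    length, its products hand out at most unit mass among the words above each [u]. *)
Lemma sum_allwords_map (C D : eqType) (tau : C -> D) (q : C -> R) (s : seq C)
    (r : seq D) n (G : seq D -> R) :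
  uniq r -> {in s, forall a, tau a \in r} -> (forall a, 0 <= q a) ->
  (forall u, 0 <= G u) ->
  (forall b, \sum_(a <- s | tau a == b) q a <= 1) ->
  \sum_(w <- allwords s n) G (map tau w) * \prod_(a <- w) q a <=
  \sum_(u <- allwords r n) G u.
Proof.
move=> ur sr q0 + q1; elim: n G => [|n IH] G G0.
  by rewrite !sum_allwords0 big_nil mulr1.
rewrite !sum_allwordsS.
apply: (@le_trans _ _ (\sum_(a <- s) q a *
    \sum_(u <- allwords r n) G (tau a :: u))).
  apply: ler_sum => a _; apply: le_trans (ler_wpM2l (q0 a) (IH _ _)) => //.
  rewrite big_distrr/=; apply: ler_sum => w _.
  by rewrite big_cons mulrCA.
pose H b := \sum_(u <- allwords r n) G (b :: u).
have H0 b : 0 <= H b by apply: sumr_ge0 => u _; exact: G0.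
apply: (@le_trans _ _ (\sum_(a <- s) \sum_(b <- r | tau a == b) q a * H b)).
  rewrite big_seq [leRHS]big_seq; apply: ler_sum => a /sr ar.
  rewrite [leRHS]big_mkcond (bigD1_seq (tau a) ar ur)/= eqxx lerDl.
  by apply: sumr_ge0 => b _; case: ifP => // _; rewrite mulr_ge0.
rewrite (exchange_big_dep xpredT)//=; apply: ler_sum => b _.
by rewrite -big_distrl/= ler_piMl.
Qed.

(** For words of equal length, [t] to the power of their Hamming distance. *)
Fixpoint agree (C : eqType) (t : R) (v w : seq C) : R :=
  if v is a :: v' then
    if w is b :: w' then (if a == b then 1 else t) * agree t v' w' else 1
  else 1.

Lemma agree_ge0 (C : eqType) (t : R) (v w : seq C) : 0 <= t -> 0 <= agree t v w.
Proof.
move=> t0; elim: v w => [|a v IH] [|b w] //=.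
by rewrite mulr_ge0//; case: ifP.
Qed.

(** The sum factors over positions: at each one the agreeing letter contributes at most 1 and the
    others at most [t] each. *)
Lemma sum_agree (C : eqType) (t : R) (s : seq C) (v : seq C) : 0 <= t -> uniq s ->
  \sum_(w <- allwords s (size v)) agree t v w <= (1 + (size s)%:R * t) ^+ size v.
Proof.
move=> t0 us; elim: v => [|a v IH]; first by rewrite sum_allwords0 expr0.
rewrite [size _]/= sum_allwordsS exprS.
under eq_bigr do rewrite /= -big_distrr/=.
rewrite -big_distrl/= ler_pM//.
- by apply: sumr_ge0 => b _; case: ifP.
- by apply: sumr_ge0 => w _; exact: agree_ge0.
apply: (@le_trans _ _ (\sum_(b <- s) ((b == a)%:R + t))).
  apply: ler_sum => b _; rewrite eq_sym.
  by case: eqP => _; rewrite ?lerDl// add0r.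
rewrite big_split/= lerD//; last first.
  by rewrite big_const_seq count_predT iter_addr_0 mulr_natl.
case: (boolP (a \in s)) => [as_|nas].
  rewrite (bigD1_seq a)//= eqxx big1 ?addr0// => b.
  by move=> /negbTE ->.
rewrite big_seq big1 ?ler01// => b bs.
by case: eqP => // ba; rewrite -ba bs in nas.
Qed.

Section coding.
Variables (C : countType) (l : T -> C).
Hypothesis ml : forall a, measurable (l @^-1` [set a]).

Fixpoint word n x : seq C :=
  if n is n'.+1 then l x :: word n' (S x) else [::].

Definition cyl (w : seq C) : set T := [set x | word (size w) x = w].

Definition pw (w : seq C) : R := prob m (cyl w).

Lemma size_word n x : size (word n x) = n.
Proof. by elim: n x => //= n IH x; rewrite IH. Qed.

Lemma cyl_word n x : cyl (word n x) = [set y | word n y = word n x].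
Proof. by rewrite /cyl size_word. Qed.

Lemma cyl_nil : cyl [::] = setT.
Proof. by apply/seteqP; split. Qed.

Lemma cyl_cons a w : cyl (a :: w) = l @^-1` [set a] `&` S @^-1` (cyl w).
Proof.
by apply/seteqP; split => x; rewrite /cyl /=; [case=> -> ->|case=> -> ->].
Qed.

Lemma measurable_cyl w : measurable (cyl w).
Proof.
elim: w => [|a w IH]; first by rewrite cyl_nil; exact: measurableT.
by rewrite cyl_cons; apply: measurableI => //; exact: measurable_preimage.
Qed.

Lemma pw_ge0 w : 0 <= pw w. Proof. exact: prob_ge0. Qed.

Lemma pw_le1 w : pw w <= 1. Proof. by apply: prob_le1; exact: measurable_cyl. Qed.

Lemma pw_nil : pw [::] = 1. Proof. by rewrite /pw cyl_nil prob_setT. Qed.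

Lemma pw_cons_le a w : pw (a :: w) <= pw w.
Proof.
rewrite /pw cyl_cons -(prob_preimage (measurable_cyl w)).
have mw := measurable_preimage mS (measurable_cyl w).
by apply: prob_le => //; exact: measurableI.
Qed.

Lemma word_nth n x x0 i : (i < n)%N -> nth x0 (word n x) i = l (iter i S x).
Proof.
by elim: n x i => [//|n IH] x [//|i] /= ni; rewrite IH// -iterSr.
Qed.

Lemma word_cat n p x : word (n + p) x = word n x ++ word p (iter n S x).
Proof.
by elim: n x => [//|n IH] x; rewrite addSn /= IH -iterSr.
Qed.

Lemma take_word n p x : (n <= p)%N -> take n (word p x) = word n x.
Proof.
by move=> np; rewrite -(subnKC np) word_cat take_size_cat ?size_word.
Qed.

Lemma drop_word n p x : (n <= p)%N -> drop n (word p x) = word (p - n) (iter n S x).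
Proof.
by move=> np; rewrite -[in LHS](subnKC np) word_cat drop_size_cat ?size_word.
Qed.

Lemma pw_word_le n p x : (n <= p)%N -> pw (word p x) <= pw (word n x).
Proof.
move=> np; apply: prob_le; [exact: measurable_cyl..|].
rewrite !cyl_word => y /= e.
by rewrite -(take_word y np) -(take_word x np) e.
Qed.

Lemma sum_pw_cons_le (s : seq C) w : uniq s ->
  \sum_(a <- s) pw (a :: w) <= pw w.
Proof.
move=> us; rewrite -[leRHS]prob_preimage//; last exact: measurable_cyl.
have mw := measurable_preimage mS (measurable_cyl w).
apply: le_trans (prob_fibers_le m mw ml us).
by apply: ler_sum => a _; rewrite /pw cyl_cons setIC.
Qed.

Lemma sum_pw_le1 (s : seq C) n : uniq s ->
  \sum_(w <- allwords s n) pw w <= 1.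
Proof.
move=> us; elim: n => [|n IH]; first by rewrite sum_allwords0 pw_nil.
rewrite sum_allwordsS exchange_big/= (le_trans _ IH)//.
by apply: ler_sum => w _; exact: sum_pw_cons_le.
Qed.

(* Markov's inequality for the ratio [v / pw], whose integral is at most the
   sum of [v] over words, followed by the Borel-Cantelli lemma. *)
Lemma ae_weight_le (v : seq C -> R) (e : R) : 0 < e ->
  (forall w, 0 <= v w) ->
  (forall s n, uniq s -> \sum_(w <- allwords s n) v w <= 1) ->
  \forall x \ae m, \forall n \near \oo,
    v (word n x) <= expR (e * n%:R) * pw (word n x).
Proof.
move=> e0 v0 v1; pose bad n w := (size w == n) &&
  (expR (e * n%:R) * pw w < v w).
(* Bad words are enumerated by their codes, as an infinite alphabet may give infinitely many of a
   given length. *)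
pose A n k := if pickle_inv k is Some w then
  if bad n w then cyl w else set0 else set0.
have mA n k : measurable (A n k).
  rewrite /A; case: pickle_inv => // w; case: ifP => // _; exact: measurable_cyl.
have mF n : measurable (\bigcup_k A n k) by exact: bigcupT_measurable.
have FE n x : expR (e * n%:R) * pw (word n x) < v (word n x) ->
    (\bigcup_k A n k) x.
  move=> h; exists (pickle (word n x)) => //.
  rewrite /A pickleK_inv /bad size_word eqxx h /= cyl_word.
  by [].
have z1 : expR (- e) < 1 by rewrite expR_lt1 oppr_lt0.
have := ae_eventually_not (m := m) (expR_gt0 (- e)) z1 mF.
have Fz n : prob m (\bigcup_k A n k) <= expR (- e) ^+ n.
  rewrite -lee_fin -probE//.
  apply: le_trans (generalized_Boole_inequality m (mA n) (mF n)) _.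
  apply: lime_le; first exact: is_cvg_nneseries.
  apply: nearW => K.
  rewrite (eq_bigr (fun k => (prob m (A n k))%:E)); last first.
    by move=> k _; exact: probE.
  rewrite sumEFin lee_fin big_mkord -expRM_natl mulrN expRN.
  pose W := [seq w <- pmap pickle_inv (iota 0 K) | bad n w].
  have uW : uniq W.
    apply: filter_uniq; apply: pmap_uniq; last exact: iota_uniq.
    exact: pickle_invK.
  have -> : \sum_(k < K) prob m (A n k) = \sum_(w <- W) pw w.
    rewrite -(big_mkord xpredT (fun k => prob m (A n k))) /W /index_iota subn0.
    elim: (iota 0 K) => [|k s IH]; first by rewrite !big_nil.
    rewrite big_cons IH /= /A /oapp; case: pickle_inv => [w|] /=.
      by case: ifP => _; rewrite ?big_cons// /prob measure0 add0r.
    by rewrite /prob measure0 add0r.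
  rewrite -[leRHS]mul1r ler_pdivlMr ?expR_gt0//.
  (* Finitely many bad words use finitely many letters, and these form the alphabet to which [v1] is
     applied. *)
  rewrite (le_trans _ (v1 (undup (flatten W)) n (undup_uniq _)))//.
  apply: (@le_trans _ _ (\sum_(w <- W) v w)).
    rewrite big_distrl/= big_seq [leRHS]big_seq; apply: ler_sum => w.
    by rewrite mem_filter => /andP[/andP[_ /ltW]]; rewrite mulrC [n%:R * e]mulrC.
  apply: ler_sum_sub => //; first by apply/uniq_allwords/undup_uniq.
  move=> w wW; rewrite mem_allwords; apply/andP; split.
    by move: wW; rewrite mem_filter => /andP[/andP[]].
  apply/allP => a aw /=; rewrite mem_undup; apply/flattenP; exists w => //.
move=> /(_ Fz); apply: filterS => x; apply: filterS => n nF.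
by rewrite leNgt; apply/negP => /FE.
Qed.

End coding.

End words.

Arguments allwords : simpl never.

(** * Entropy of finite labels *)

Lemma prob_exhaustion {R : realType} d (T : measurableType d)
    (m : probability T R) (F : nat -> set T) (e : R) : 0 < e ->
  (forall n, measurable (F n)) -> (forall n, F n `<=` F n.+1) ->
  prob m (\bigcup_n F n) = 1 -> exists n, prob m (~` F n) <= e.
Proof.
move=> e0 mF ndF U1; have mU : measurable (\bigcup_n F n).
  exact: bigcupT_measurable.
have nd : {homo F : n p / (n <= p)%N >-> (n <= p)%O}.
  by apply/nondecreasing_seqP => n; rewrite subsetEset; exact: ndF.
have cF : m (F n) @[n --> \oo] --> (1%:E : \bar R).
  rewrite -U1 -probE//; exact: nondecreasing_cvg_mu mF mU nd.
move/fine_cvgP : cF => [_ /cvgrPdist_lt /(_ e e0)] [n _ /(_ n (leqnn n))] /=.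
rewrite -/(prob m (F n)) => hn; exists n.
have := prob_splitI m measurableT (mF n); rewrite setTI setTD prob_setT.
by move: hn; rewrite /= ltr_norml => /andP[]; lra.
Qed.

Section positive_words.
Context {R : realType} d (T : measurableType d) (m : probability T R).
Variable S : T -> T.
Hypotheses (mS : measurable_fun setT S) (Sm : invariant_measure S m).
Variables (C : countType) (l : T -> C).
Hypothesis ml : forall a, measurable (l @^-1` [set a]).
Local Notation word := (word S l).
Local Notation pw := (pw m S l).
Local Notation cyl := (cyl S l).

(** There are countably many words, so the cylinders of measure zero have a null union. *)
Lemma ae_pw_gt0 : \forall x \ae m, forall n, 0 < pw (word n x).
Proof.
pose A k := if pickle_inv k is Some w then
  if pw w == 0 then cyl w else set0 else set0.
have nA k : m.-negligible (A k).
  rewrite /A; case: pickle_inv => [w|]; last exact: negligible_set0.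
  case: eqP => [w0|_]; last exact: negligible_set0.
  have mc := measurable_cyl mS ml w.
  by apply/negligibleP => //; rewrite -[LHS]/(m (cyl w)) probE//; congr EFin.
have := negligible_bigcup nA; apply: negligibleS => x /= /existsNP[n].
move/negP; rewrite lt_neqAle pw_ge0 andbT negbK eq_sym => wn.
by exists (pickle (word n x)) => //; rewrite /A pickleK_inv wn cyl_word.
Qed.

Lemma pw_word_iter n p x : pw (word (n + p) x) <= pw (word p (iter n S x)).
Proof.
elim: n x => [//|n IH] x; rewrite addSn iterSr (le_trans _ (IH _))//=.
exact: pw_cons_le.
Qed.

End positive_words.

Section finite_alphabet.
Context {R : realType} d (T : measurableType d) (m : probability T R).
Variable S : T -> T.
Hypotheses (mS : measurable_fun setT S) (Sm : invariant_measure S m).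
Hypothesis eS : ergodic_measure S m.
Variables (C : finType) (l : T -> C).
Hypothesis ml : forall a, measurable (l @^-1` [set a]).
Local Notation word := (word S l).
Local Notation pw := (pw m S l).
Local Notation cyl := (cyl S l).
Local Notation words := (allwords (enum C)).

Let uC : uniq (enum C). Proof. exact: enum_uniq. Qed.

Lemma mem_words n w : (w \in words n) = (size w == n).
Proof.
rewrite mem_allwords; case: eqP => //= _.
by apply/allP => a _ /=; rewrite mem_enum.
Qed.

Lemma word_in n x : word n x \in words n.
Proof. by rewrite mem_words size_word. Qed.

Lemma sum_pw_cons w : \sum_(a <- enum C) pw (a :: w) = pw w.
Proof.
have mw := measurable_preimage mS (measurable_cyl mS ml w).
rewrite -[RHS](prob_preimage Sm)//; last exact: measurable_cyl.
rewrite -[RHS](prob_fibers m mw ml uC); last by move=> x _; rewrite mem_enum.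
by apply: eq_bigr => a _; rewrite /pw cyl_cons setIC.
Qed.

Lemma sum_pw n : \sum_(w <- words n) pw w = 1.
Proof.
elim: n => [|n IH]; first by rewrite sum_allwords0 pw_nil.
by rewrite sum_allwordsS exchange_big/= -IH; apply: eq_bigr => w _;
  exact: sum_pw_cons.
Qed.

Lemma word_sumE (F : seq C -> R) n x :
  F (word n x) = \sum_(w <- words n) F w * \1_(cyl w) x.
Proof.
rewrite (bigD1_seq (word n x))/= ?word_in ?uniq_allwords//.
rewrite indicE mem_set ?mulr1; last by rewrite cyl_word.
rewrite big_seq_cond big1 ?addr0// => w /andP[].
rewrite mem_words => /eqP wn nw; rewrite indicE memNset ?mulr0//.
by move=> h; move: nw; rewrite -h wn eqxx.
Qed.

Lemma measurable_word (F : seq C -> R) n :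
  measurable_fun setT (fun x => F (word n x)).
Proof.
rewrite (_ : (fun x => _) = fun x => \sum_(w <- words n) F w * \1_(cyl w) x).
  apply: measurable_sum => w; apply: measurable_funM; first exact: measurable_cst.
  by apply: measurable_indic; exact: measurable_cyl.
by apply/funext => x; exact: word_sumE.
Qed.

Let iw (F : seq C -> R) w :
  m.-integrable setT (fun x => (F w)%:E * (\1_(cyl w) x)%:E)%E.
Proof.
by apply: integrableZl => //; apply: integrable_indic; exact: measurable_cyl.
Qed.

Lemma integrable_word (F : seq C -> R) n :
  m.-integrable setT (EFin \o (fun x => F (word n x))).
Proof.
rewrite (_ : EFin \o _ = fun x =>
    (\sum_(w <- words n) (F w)%:E * (\1_(cyl w) x)%:E)%E).
  by apply: integrable_sum => // w _; exact: iw.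
apply/funext => x /=; rewrite word_sumE -sumEFin; apply: eq_bigr => w _.
by rewrite EFinM.
Qed.

Lemma integral_word (F : seq C -> R) n :
  (\int[m]_x (F (word n x))%:E = (\sum_(w <- words n) F w * pw w)%:E)%E.
Proof.
transitivity (\int[m]_x
    (\sum_(w <- words n) (F w)%:E * (\1_(cyl w) x)%:E))%E.
  apply: eq_integral => x _; rewrite word_sumE -sumEFin.
  by apply: eq_bigr => w _; rewrite EFinM.
rewrite (@integral_sum _ _ _ _ _ measurableT _
  (fun w x => (F w)%:E * (\1_(cyl w) x)%:E)%E); last by move=> w; exact: iw.
rewrite -sumEFin; apply: eq_bigr => w _.
have mc := measurable_cyl mS ml w.
rewrite integralZl//; last exact: integrable_indic.
rewrite integral_indic// setIT EFinM; congr (_ * _)%E; exact: probE.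
Qed.

Definition block_entropy n : R := \sum_(w <- words n) - ln (pw w) * pw w.

Lemma block_entropy_ge0 n : 0 <= block_entropy n.
Proof.
apply: sumr_ge0 => w _; rewrite mulr_ge0 ?pw_ge0// oppr_ge0 ln_le0//.
exact: pw_le1.
Qed.

(** This is the conditional entropy of a letter given the [k] letters that follow it. Conditioning
    on later letters suits the recursion of [word], which puts the first letter in front. *)
Lemma block_entropyS_sub k : block_entropy k.+1 - block_entropy k =
  \sum_(w <- words k.+1) (ln (pw (behead w)) - ln (pw w)) * pw w.
Proof.
have -> : block_entropy k = - \sum_(w <- words k.+1) ln (pw (behead w)) * pw w.
  rewrite sum_allwordsS exchange_big/= -sumrN; apply: eq_bigr => w _.
  by rewrite -big_distrr/= sum_pw_cons mulNr.
rewrite opprK /block_entropy -big_split/=; apply: eq_bigr => w _.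
by rewrite mulrBl mulNr addrC.
Qed.

(* The probability of a word for the Markov chain of order [k] with the same
   statistics of words of length [k.+1], run backwards in time. *)
Fixpoint markov_weight k (w : seq C) : R :=
  if w is a :: w' then
    markov_weight k w' * (pw (a :: take k w') / pw (take k w'))
  else 1.

Lemma markov_weight_ge0 k w : 0 <= markov_weight k w.
Proof.
by elim: w => //= a w IH; rewrite mulr_ge0// divr_ge0 ?pw_ge0.
Qed.

Lemma sum_markov_weight_le1 k (s : seq C) n : uniq s ->
  \sum_(w <- allwords s n) markov_weight k w <= 1.
Proof.
move=> us; elim: n => [|n IH]; first by rewrite sum_allwords0.
rewrite sum_allwordsS exchange_big/= (le_trans _ IH)//.
apply: ler_sum => w _; rewrite -big_distrr/= ler_piMr ?markov_weight_ge0//.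
rewrite -big_distrl/=.
(* After a null context the weights vanish, because division by zero gives 0. *)
have [w0|w0] := eqVneq (pw (take k w)) 0; first by rewrite w0 invr0 mulr0.
by rewrite ler_pdivrMr ?mul1r ?sum_pw_cons_le// lt_neqAle eq_sym w0 pw_ge0.
Qed.

(** The information of the first letter given the next [k]; by [block_entropyS_sub] it integrates to
    a difference of block entropies. *)
Let psi k x := ln (pw (behead (word k.+1 x))) - ln (pw (word k.+1 x)).

(** Each transition probability is exp(- psi), except near the end of the word, where fewer than [k]
    letters of context remain. There are at most [k] such factors, and each is at least exp(- D),
    with [D] the sum of |ln pw| over the words of length [k.+1]. *)
Lemma markov_weight_ge k x : (forall n, 0 < pw (word n x)) ->
  forall n, expR (- (\sum_(i < n) psi k (iter i S x)) -
     (minn n k)%:R * \sum_(w <- words k.+1) `|ln (pw w)|)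
    <= markov_weight k (word n x).
Proof.
move=> + n; set D := (X in _ * X).
have D0 : 0 <= D by apply: sumr_ge0.
elim: n x => [|n IH] x px.
  by rewrite big_ord0 min0n mul0r oppr0 addr0 expR0.
have pSx j : 0 < pw (word j (S x)).
  by rewrite (lt_le_trans (px j.+1))//; exact: (pw_word_iter mS Sm ml 1).
have psi0 y : (forall n, 0 < pw (word n y)) -> 0 <= psi k y.
  move=> py; rewrite /psi subr_ge0 /= ler_ln ?posrE//; last 2 first.
  - exact: (py k.+1).
  - by rewrite (lt_le_trans (py k.+1))//; exact: (pw_word_iter mS Sm ml 1).
  exact: (pw_word_iter mS Sm ml 1).
rewrite [word _ _]/= [markov_weight _ _]/=.
have -> : take k (word n (S x)) = word (minn n k) (S x).
  rewrite /minn; case: ltnP => nk; last exact: take_word.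
  by rewrite take_oversize// size_word ltnW.
rewrite -[l x :: _]/(word (minn n k).+1 x).
have ratioE j : pw (word j.+1 x) / pw (word j (S x)) =
    expR (- (ln (pw (word j (S x))) - ln (pw (word j.+1 x)))).
  by rewrite opprB expRD expRN !lnK ?posrE.
rewrite ratioE.
have step : - psi k x - (minn n.+1 k)%:R * D <=
    - (ln (pw (word (minn n k) (S x))) - ln (pw (word (minn n k).+1 x)))
    - (minn n k)%:R * D.
  have [kn|nk] := leqP k n.
    by rewrite (minn_idPr (leqW kn)).
  rewrite (minn_idPl nk) -natr1 mulrDl mul1r.
  have h1 := psi0 _ px.
  have h2 : ln (pw (word n (S x))) <= 0 by rewrite ln_le0// pw_le1.
  have h3 : - ln (pw (word n.+1 x)) <= D.
    have lnk : ln (pw (word k.+1 x)) <= ln (pw (word n.+1 x)).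
      by rewrite ler_ln ?posrE//; apply: pw_word_le => //; exact: leqW.
    have lnk0 : ln (pw (word k.+1 x)) <= 0 by apply: ln_le0; exact: pw_le1.
    apply: (@le_trans _ _ `|ln (pw (word k.+1 x))|).
      by rewrite ler0_norm// lerN2.
    rewrite /D (bigD1_seq (word k.+1 x) (word_in k.+1 x) (uniq_allwords _ uC)).
    by rewrite lerDl sumr_ge0.
  lra.
rewrite (le_trans _ (ler_wpM2r (expR_ge0 _) (IH _ pSx)))// -expRD ler_expR.
rewrite big_ord_recl/=.
under eq_bigr => i _ do rewrite -[S (iter i S x)]/(iter i.+1 S x) iterSr.
move: step => /=; lra.
Qed.

(** The Markov weights are almost surely at most exp(e n) [pw], while Birkhoff's theorem for [psi]
    bounds them below by about exp(- a n), with [a] the conditional entropy. *)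
Lemma smb_upper k b : block_entropy k.+1 - block_entropy k < b ->
  \forall x \ae m, \forall n \near \oo, expR (- (b * n%:R)) <= pw (word n x).
Proof.
(* A quarter of the gap: one [e] each for Birkhoff's theorem, the comparison of weights and the
   constant k D. *)
set a := (X in X < b) => ab; pose e := (b - a) / 4.
have e0 : 0 < e by rewrite /e; lra.
have W := ae_weight_le m mS ml e0 (markov_weight_ge0 k)
  (fun s n us => @sum_markov_weight_le1 k s n us).
have I : (\int[m]_x (psi k x)%:E < (a + e)%:E)%E.
  rewrite (@integral_word (fun w => ln (pw (behead w)) - ln (pw w)) k.+1).
  by rewrite -block_entropyS_sub -/a lte_fin ltrDl.
have := birkhoff_le mS Sm eS
  (@integrable_word (fun w => ln (pw (behead w)) - ln (pw w)) k.+1) I.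
move=> B; have P := ae_pw_gt0 m mS ml.
apply: filterS3 B P W => x B P W.
set D := \sum_(w <- words k.+1) `|ln (pw w)|.
have D0 : 0 <= D by apply: sumr_ge0.
near=> n; have Bn : (\sum_(i < n) psi k (iter i S x) <= (a + e) * n%:R).
  by near: n.
have Wn : markov_weight k (word n x) <= expR (e * n%:R) * pw (word n x).
  by near: n.
have := le_trans (@markov_weight_ge k x P n) Wn.
rewrite -ler_pdivrMl ?expR_gt0// -expRN -expRD; apply: le_trans.
rewrite ler_expR -/D.
have kD : (minn n k)%:R * D <= k%:R * D by rewrite ler_wpM2r// ler_nat geq_minr.
have kn : k%:R * D / e <= n%:R by near: n; exact: nbhs_infty_ger.
move: kn; rewrite ler_pdivrMr// => kn.
have -> : b = a + 4 * e by rewrite /e; lra.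
set s := \sum_(i < n) _ in Bn *.
have n0 : 0 <= n%:R :> R by [].
nra.
Unshelve. all: by end_near. Qed.

(** * Encoding words by blocks of large measure *)

Section tilings.
Variables (al z : R).
Hypotheses (al0 : 0 < al) (z0 : 0 < z).
Hypothesis sum_half : forall n, \sum_(1 <= j < n.+1) al * z ^+ j <= 2^-1.

Let K2 : R := (#|C|.*2)%:R.

Let K20 : 0 < K2.
Proof. by rewrite ltr0n double_gt0; apply/card_gt0P; exists (l point). Qed.

(* A subprobability on words: read the word from the left, cutting off either
   a single letter, with probability [2^-1] and chosen uniformly, or a block of
   length [j], with probability [al * z ^+ j] and chosen according to [pw]. *)
Fixpoint tile_weight f (w : seq C) : R :=
  if f isn't f'.+1 then 1 else
  if w isn't a :: w' then 1 else
  K2^-1 * tile_weight f' w' +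
  \sum_(1 <= j < (size w).+1)
     al * z ^+ j * pw (take j w) * tile_weight f' (drop j w).

Lemma tile_weight_ge0 f w : 0 <= tile_weight f w.
Proof.
elim: f w => [//|f IH] [//|a w] /=.
apply: addr_ge0; first by rewrite mulr_ge0// invr_ge0 ltW.
apply: sumr_ge0 => j _.
by rewrite !mulr_ge0 ?pw_ge0 ?exprn_ge0// ltW.
Qed.

Lemma tile_weight_letter f a w : K2^-1 * tile_weight f w <= tile_weight f.+1 (a :: w).
Proof.
rewrite /= lerDl sumr_ge0// => j _.
by rewrite !mulr_ge0 ?pw_ge0 ?exprn_ge0 ?tile_weight_ge0// ltW.
Qed.

Lemma tile_weight_block f j w : (0 < j <= size w)%N ->
  al * z ^+ j * pw (take j w) * tile_weight f (drop j w) <= tile_weight f.+1 w.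
Proof.
case: w => [|a w]; first by case: j.
move=> jw; have uj : uniq (index_iota 1 (size (a :: w)).+1) by exact: iota_uniq.
have jin : j \in index_iota 1 (size (a :: w)).+1 by rewrite mem_index_iota ltnS.
rewrite [leRHS]/= -[(size w).+1]/(size (a :: w)) (bigD1_seq j jin uj).
rewrite addrCA lerDl addr_ge0 ?mulr_ge0 ?invr_ge0 ?tile_weight_ge0 ?(ltW K20)//.
rewrite sumr_ge0// => i _.
by rewrite !mulr_ge0 ?pw_ge0 ?exprn_ge0 ?tile_weight_ge0// ltW.
Qed.

Lemma tile_weight_gt0 f w : (size w <= f)%N -> 0 < tile_weight f w.
Proof.
elim: f w => [//|f IH] [//|a w] wf.
rewrite (lt_le_trans _ (tile_weight_letter _ _ _))// mulr_gt0 ?invr_gt0//.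
exact: IH.
Qed.

(** Sort by the first tile. Single letters carry at most one half in all; blocks of length [j] carry
    at most al z^j, since the measures of the blocks add up to 1. The parameter [f] is the fuel of
    the recursion. *)
Lemma sum_tile_weight_le1 f n : (n <= f)%N ->
  \sum_(w <- words n) tile_weight f w <= 1.
Proof.
elim: f n => [|f IH] [|n] nf //; first by rewrite sum_allwords0.
  by rewrite sum_allwords0.
have -> : \sum_(w <- words n.+1) tile_weight f.+1 w =
    \sum_(w <- words n.+1) (K2^-1 * tile_weight f (behead w) +
      \sum_(1 <= j < n.+2)
        al * z ^+ j * pw (take j w) * tile_weight f (drop j w)).
  rewrite big_seq [RHS]big_seq; apply: eq_bigr => -[|a w].
    by rewrite mem_words.
  by rewrite mem_words => /eqP wn; rewrite [LHS]/= -/(size (a :: w)) wn.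
rewrite big_split/= [leRHS](splitr 1) lerD//.
  rewrite sum_allwordsS /= big_const_seq count_predT iter_addr_0 -cardE.
  rewrite -big_distrr/=; apply: (@le_trans _ _ (K2^-1 *+ #|C|)).
    by rewrite lerMn2r ler_piMr ?orbT// ?invr_ge0 ?(ltW K20)//; exact: IH.
  have C0 : #|C|%:R != 0 :> R.
    by move: K20; rewrite /K2 ltr0n double_gt0 pnatr_eq0 lt0n.
  by rewrite /K2 -mul2n natrM -mulr_natr le_eqVlt; apply/orP; left; apply/eqP; field.
rewrite exchange_big/= mul1r (le_trans _ (sum_half n.+1))//.
rewrite big_seq [leRHS]big_seq; apply: ler_sum => j.
rewrite mem_index_iota ltnS => /andP[j0 jn].
rewrite -(subnKC jn) sum_allwordsD.
apply: (@le_trans _ _ (\sum_(u <- words j) \sum_(v <- words (n.+1 - j))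
   al * z ^+ j * pw u * tile_weight f v)).
  rewrite big_seq [leRHS]big_seq; apply: ler_sum => u.
  rewrite mem_words => /eqP uj; apply: ler_sum => v _.
  by rewrite take_size_cat// drop_size_cat.
have h : \sum_(v <- words (n.+1 - j)) tile_weight f v <= 1.
  by apply: IH; rewrite leq_subLR (leq_trans nf)// -[leqLHS]add1n leq_add2r.
under eq_bigr do rewrite -big_distrr/=.
rewrite -big_distrl/= -big_distrr/= sum_pw mulr1 ler_piMr//.
by rewrite mulr_ge0 ?exprn_ge0// ltW.
Qed.

Lemma tile_weight_ge_letters f x n : (n <= f)%N ->
  expR (- (ln K2 * n%:R)) <= tile_weight f (word n x).
Proof.
have E : K2^-1 = expR (- ln K2) by rewrite expRN lnK.
elim: f x n => [|f IH] x [|n] nf //=; rewrite ?mulr0 ?oppr0 ?expR0//.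
rewrite (le_trans _ (tile_weight_letter _ _ _))// E.
rewrite -natr1 mulrDr mulr1 opprD addrC expRD ler_pM2l ?expR_gt0//.
exact: IH.
Qed.

Variables (c : R) (L : nat).
Hypothesis c0 : 0 <= c.

Let good := [set x | exists2 j, (0 < j <= L)%N &
  expR (- (c * j%:R)) <= al * z ^+ j * pw (word j x)].

Let bads n x : R := \sum_(i < n) \1_(~` good) (iter i S x).

Let badsD n p x : bads (n + p) x = bads n x + bads p (iter n S x).
Proof.
rewrite /bads big_split_ord/=; congr (_ + _).
by apply: eq_bigr => i _; rewrite addnC iterD.
Qed.

Let bads_ge0 n x : 0 <= bads n x.
Proof. by apply: sumr_ge0 => i _; rewrite indicE. Qed.

Let lnK2 : 0 <= ln K2.
Proof.
apply: ln_ge0; rewrite /K2 ler1n double_gt0.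
by apply/card_gt0P; exists (l point).
Qed.

(** Tile greedily: a good block at a good point, a single letter at a bad one, and single letters in
    the last [L] places, where a block might not fit. Only single letters cost [ln K2]. *)
Lemma tile_weight_ge f x n : (n <= f)%N ->
  expR (- (c * n%:R + ln K2 * (bads n x + L%:R))) <= tile_weight f (word n x).
Proof.
elim: f x n => [|f IH] x n nf.
  by move: nf; rewrite leqn0 => /eqP -> /=; rewrite -expR0 ler_expR oppr_le0
    addr_ge0 ?mulr_ge0// addr_ge0.
have [nL|Ln] := leqP n L.
  rewrite (le_trans _ (tile_weight_ge_letters x nf))// ler_expR lerN2.
  rewrite -[leLHS]add0r lerD ?mulr_ge0// ler_wpM2l//.
  by rewrite -[leLHS]add0r lerD// ler_nat.
have [[j /andP[j0 jL] hj]|nx] := pselect (good x).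
  have jn : (j <= n)%N by rewrite (leq_trans jL)// ltnW.
  have jw : (0 < j <= size (word n x))%N by rewrite size_word j0.
  rewrite (le_trans _ (tile_weight_block f jw))//.
  rewrite take_word// drop_word//.
  have nf' : (n - j <= f)%N.
    by rewrite leq_subLR (leq_trans nf)// -[leqLHS]add1n leq_add2r.
  rewrite (le_trans _ (ler_pM (expR_ge0 _) (expR_ge0 _) hj (IH _ _ nf')))//.
  rewrite -expRD ler_expR -{1 2}(subnKC jn) badsD natrD.
  have := bads_ge0 j x; have := lnK2; nra.
case: n nf Ln => [//|n] nf _ /=.
rewrite (le_trans _ (tile_weight_letter _ _ _))//.
have E : K2^-1 = expR (- ln K2) by rewrite expRN lnK.
rewrite (le_trans _ (ler_wpM2l _ (IH (S x) n nf)))// ?invr_ge0 ?(ltW K20)//.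
rewrite E -expRD ler_expR -[n.+1]add1n badsD natrD.
have -> : bads 1 x = 1 by rewrite /bads big_ord1 /= indicE mem_set.
rewrite /=; have := c0; lra.
Qed.

Hypothesis mgood : measurable good.

(** By Gibbs' inequality the entropy is at most the mean of - ln of a subprobability, here the tile
    weights; the mean number of bad points is n times the measure of the bad set. *)
Lemma block_entropy_le n :
  block_entropy n <= n%:R * (c + ln K2 * prob m (~` good)) + ln K2 * L%:R.
Proof.
pose u w := tile_weight n w.
have u0 w : w \in words n -> 0 < u w.
  by rewrite mem_words => /eqP wn; rewrite tile_weight_gt0// wn.
apply: (@le_trans _ _ (\sum_(w <- words n) - ln (u w) * pw w)).
  (* Gibbs' inequality, from ln r <= r - 1 with r = u / pw. *)
  rewrite -subr_ge0 -sumrB.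
  apply: (@le_trans _ _ (\sum_(w <- words n) (pw w - u w))).
    by rewrite sumrB sum_pw subr_ge0 sum_tile_weight_le1.
  rewrite big_seq [leRHS]big_seq; apply: ler_sum => w /u0 uw.
  have [p0|p0] := eqVneq (pw w) 0.
    by rewrite p0 !mulr0 subrr sub0r oppr_le0 ltW.
  have {}p0 : 0 < pw w by rewrite lt_neqAle eq_sym p0 pw_ge0.
  have h : ln (u w / pw w) <= u w / pw w - 1.
    have := @le_ln1Dx R (u w / pw w - 1); rewrite [1 + _]addrC subrK; apply.
    by rewrite ltrBrDl subrr divr_gt0.
  have := ler_wpM2r (ltW p0) h; rewrite ln_div ?posrE//.
  by rewrite [leRHS]mulrBl mul1r divfK ?gt_eqF//; lra.
have mi i : measurable (iter i S @^-1` (~` good)).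
  rewrite -[X in measurable X]setTI; apply: measurable_iter => //.
  exact: measurableC.
have iE i : (fun x => (\1_(~` good) (iter i S x))%:E) =
    (fun x => (\1_(iter i S @^-1` (~` good)) x)%:E).
  by apply/funext => x; rewrite !indicE.
have ib i : m.-integrable setT (fun x => (\1_(~` good) (iter i S x))%:E).
  by rewrite iE; exact: integrable_indic.
have Ib i : (\int[m]_x (\1_(~` good) (iter i S x))%:E =
    (prob m (~` good))%:E)%E.
  rewrite iE integral_indic// setIT -probE; last exact: measurableC.
  by apply: measure_iter_preimage => //; exact: measurableC.
have isum : m.-integrable setT (fun x => \sum_(i < n) (\1_(~` good) (iter i S x))%:E)%E.
  by apply: integrable_sum.
have ic r : m.-integrable setT (EFin \o cst r).
  exact: finite_measure_integrable_cst.
pose B x := (c * n%:R + ln K2 * (bads n x + L%:R)).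
have BE : EFin \o B = ((EFin \o cst (c * n%:R + ln K2 * L%:R)%R) \+
   (fun x => (ln K2)%:E * \sum_(i < n) (\1_(~` good) (iter i S x))%:E))%E.
  apply/funext => x; rewrite /B /= sumEFin -EFinM -EFinD; congr EFin.
  by rewrite /bads; ring.
have iB : m.-integrable setT (EFin \o B).
  by rewrite BE; apply: integrableD => //; exact: integrableZl.
rewrite -lee_fin -(integral_word (fun w => - ln (u w))).
apply: (@le_trans _ _ (\int[m]_x (EFin \o B) x)%E).
  apply: le_integral => //; first exact: (integrable_word (fun w => - ln (u w))).
  move=> x _; rewrite lee_fin lerNl -ler_expR lnK; first exact: tile_weight_ge.
  by rewrite posrE u0// word_in.
rewrite BE integralD//; last exact: integrableZl.
rewrite integral_cst_probability integralZl//.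
rewrite (@integral_sum _ _ _ _ _ measurableT _
  (fun (i : 'I_n) x => (\1_(~` good) (iter i S x))%:E)%E)//.
under eq_bigr do rewrite Ib.
rewrite sumEFin -EFinM -EFinD lee_fin sumr_const card_ord -mulr_natr.
by rewrite le_eqVlt; apply/orP; left; apply/eqP; ring.
Qed.

End tilings.

(** * Lower half of the Shannon-McMillan-Breiman theorem *)

Section lower_bound.
Variables b c : R.
Hypothesis Hb : forall N, exists2 n, (N <= n)%N & b * n%:R <= block_entropy n.
Hypothesis cb : c < b.

(** The slack [D] makes this set forward invariant, hence of measure 0 or 1: dropping the first
    letter changes the exponent by [c] only. *)
Let often := [set x | exists D : nat, forall k, exists2 n, (k <= n)%N &
  expR (- (c * n%:R) - D%:R) <= pw (word n x)].

Let mge (F : nat -> R) n : measurable [set x | F n <= pw (word n x)].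
Proof.
rewrite (_ : mkset _ = (fun x => pw (word n x)) @^-1` `[F n, +oo[%classic).
  by rewrite -[X in measurable X]setTI; apply: measurable_word => //; exact: measurable_itv.
by apply/seteqP; split => x /=; rewrite in_itv/= andbT.
Qed.

Let moften : measurable often.
Proof.
rewrite (_ : often = \bigcup_D \bigcap_k \bigcup_(n >= k)
    [set x | expR (- (c * n%:R) - D%:R) <= pw (word n x)]).
  apply: bigcupT_measurable => D; apply: bigcapT_measurable => k.
  apply: bigcup_measurable => n _.
  exact: (mge (fun n => expR (- (c * n%:R) - D%:R))).
apply/seteqP; split => x /=.
  by move=> [D h]; exists D => // k _; have [n kn hn] := h k; exists n.
by move=> [D _ h]; exists D => k; have [n /= kn hn] := h k I; exists n.
Qed.

Let often_sub : often `<=` S @^-1` often.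
Proof.
move=> x [D h]; exists (D + Num.bound `|c|)%N => k.
have [[//|n] kn hn] := h k.+1; exists n => //.
have px : pw (word n.+1 x) <= pw (word n (S x)) by exact: pw_cons_le.
rewrite (le_trans _ (le_trans hn px))// ler_expR natrD -natr1.
have : `|c| <= (Num.bound `|c|)%:R by rewrite ltW// archi_boundP.
have := ler_norm c; lra.
Qed.

(** If [often] had full measure, blocks of measure about exp(- c j) would start at most points;
    tilings by them would encode words at a cost near [c] per letter, and the block entropies could
    not reach b n. *)
Let c0 : 0 <= c -> m often = 0%E.
Proof.
move=> c0; have [//|o1] := zero_one mS Sm eS moften often_sub.
(* Of the gap 8 e, [cc] spends 2 e (on z^n and on the constants [D] and [al]), the bad points at
   most 2 e, and the last [L] letters at most [e]. *)
exfalso; pose e := (b - c) / 8.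
have bc : 0 < b - c by rewrite subr_gt0.
have e0 : 0 < e by rewrite divr_gt0.
pose z := expR (- e); have z0 : 0 < z := expR_gt0 _.
have z1 : z < 1 by rewrite expR_lt1 oppr_lt0.
(* Makes the sum of al z^j over all j >= 1 equal to z / 2. *)
pose al := (1 - z) / 2; have al0 : 0 < al by rewrite /al; lra.
have half n : \sum_(1 <= j < n.+1) al * z ^+ j <= 2^-1.
  have := @geometric_le_lim R n (al * z) z.
  rewrite mulr_ge0 ?(ltW al0) ?(ltW z0)// z0 (ger0_norm (ltW z0)) z1.
  move=> /(_ isT isT isT); rewrite /series/= /geometric/= => h.
  rewrite big_add1/=; apply: le_trans (le_trans h _).
    by apply: ler_sum_nat => i _; rewrite exprS mulrA.
  rewrite /al ler_pdivrMr; last lra.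
  by rewrite [leRHS]mulrC ler_piMr ?(ltW al0)// ltW.
pose cc := c + 2 * e.
pose good L := [set x | exists2 j, (0 < j <= L)%N &
  expR (- (cc * j%:R)) <= al * z ^+ j * pw (word j x)].
have mgood L : measurable (good L).
  rewrite (_ : good L = \bigcup_(j in [set j | (0 < j <= L)%N])
     [set x | expR (- (cc * j%:R)) / (al * z ^+ j) <= pw (word j x)]).
    apply: bigcup_measurable => j _.
    exact: (mge (fun j => expR (- (cc * j%:R)) / (al * z ^+ j))).
  have E j x : (expR (- (cc * j%:R)) / (al * z ^+ j) <= pw (word j x)) =
      (expR (- (cc * j%:R)) <= al * z ^+ j * pw (word j x)).
    rewrite ler_pdivrMr; last by rewrite mulr_gt0// exprn_gt0.
    by rewrite [X in _ = (_ <= X)]mulrC.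
  apply/seteqP; split => x /= [j hj h]; exists j => //.
    by rewrite /= E.
  by rewrite -E.
have ogood : often `<=` \bigcup_L good L.
  move=> x [D h].
  have [n hn hp] := h (Num.bound `|(D%:R - ln al) / e|).+1.
  exists n => //; exists n; first by rewrite leqnn (leq_trans _ hn).
  have -> : al * z ^+ n = expR (ln al - e * n%:R).
    by rewrite expRD lnK ?posrE// /z -expRM_natl mulrN [n%:R * e]mulrC.
  apply: le_trans (ler_wpM2l (expR_ge0 _) hp).
  rewrite -expRD ler_expR.
  have : (D%:R - ln al) / e <= n%:R.
    rewrite (le_trans (ler_norm _))// ltW// (lt_trans (archi_boundP _))//.
    by rewrite ltr_nat.
  rewrite ler_pdivrMr// /cc; lra.
have nd n : good n `<=` good n.+1.
  by move=> x [j /andP[j0 jn] h]; exists j => //; rewrite j0 leqW.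
have mU : measurable (\bigcup_L good L) by exact: bigcupT_measurable.
have U1 : prob m (\bigcup_L good L) = 1.
  apply/eqP; rewrite eq_le prob_le1//=.
  have -> : 1 = prob m often by rewrite /prob o1.
  exact: prob_le.
pose D := ln ((#|C|.*2)%:R : R).
have D0 : 0 <= D.
  by apply: ln_ge0; rewrite ler1n double_gt0; apply/card_gt0P; exists (l point).
pose eta := (b - c) / (4 * (D + 1)).
have eta0 : 0 < eta by rewrite divr_gt0//; lra.
have [L hC] := prob_exhaustion eta0 mgood nd U1.
have cc0 : 0 <= cc by rewrite /cc; lra.
have hn n : block_entropy n <= n%:R * (cc + D * eta) + D * L%:R.
  apply: (le_trans (block_entropy_le al0 z0 half cc0 (mgood L) n)).
  by rewrite lerD2r ler_wpM2l// lerD2l ler_wpM2l.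
have Deta : D * eta <= (b - c) / 4.
  rewrite /eta mulrA ler_pdivrMr; last by lra.
  by rewrite [leRHS](_ : _ = (b - c) * (D + 1)); [|field]; nra.
have [n nN hbn] := Hb (Num.bound `|D * L%:R / e|).
have := le_trans hbn (hn n).
have n1 : D * L%:R / e < n%:R.
  rewrite (le_lt_trans (ler_norm _))// (lt_le_trans (archi_boundP _))//.
  by rewrite ler_nat.
move: n1; rewrite ltr_pdivrMr// => n1.
have : n%:R * (cc + D * eta) <= n%:R * (b - 4 * e).
  by rewrite ler_wpM2l// /cc; move: Deta; rewrite /e; lra.
have n0 : 0 <= n%:R :> R by [].
nra.
Qed.

Lemma smb_lower :
  \forall x \ae m, \forall n \near \oo, pw (word n x) <= expR (- (c * n%:R)).
Proof.
have [c00|c00] := leP 0 c; last first.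
  (* For negative [c] the bound is at least 1. *)
  apply: aeW => x; apply: nearW => n; rewrite (le_trans (pw_le1 _ _ _ _))//.
  by rewrite -expR0 ler_expR oppr_ge0 nmulr_rle0.
exists often; split => //; first exact: c0.
move=> x /= nx; exists 0%N => k; apply: contrapT => h; apply: nx.
exists k => // n /= kn; rewrite leNgt; apply/negP => hn; apply: h.
by exists n => //; rewrite subr0 ltW.
Qed.

End lower_bound.

(** An infimum; that it is also the limit is deduced in [cvg_block_entropy] from the two halves of
    the Shannon-McMillan-Breiman theorem. *)
Definition block_entropy_rate : R :=
  inf [set block_entropy n.+1 / n.+1%:R | n in [set: nat]].

Let has_inf_rate : has_inf [set block_entropy n.+1 / n.+1%:R | n in [set: nat]].
Proof.
split; first by exists (block_entropy 1 / 1); exists 0%N.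
by exists 0 => _ [n _ <-]; rewrite divr_ge0 ?block_entropy_ge0.
Qed.

Lemma block_entropy_rate_ge0 : 0 <= block_entropy_rate.
Proof.
apply: lb_le_inf; first by have [] := has_inf_rate.
by move=> _ [n _ <-]; rewrite divr_ge0 ?block_entropy_ge0.
Qed.

Lemma block_entropy_rate_le n : block_entropy_rate * n%:R <= block_entropy n.
Proof.
case: n => [|n]; first by rewrite mulr0 block_entropy_ge0.
rewrite -ler_pdivlMr//; apply: ge_inf; first by have [] := has_inf_rate.
by exists n.
Qed.

Lemma ae_pw_le c : c < block_entropy_rate ->
  \forall x \ae m, \forall n \near \oo, pw (word n x) <= expR (- (c * n%:R)).
Proof.
move=> cb; apply: smb_lower cb => N; exists N => //; exact: block_entropy_rate_le.
Qed.

Lemma ae_pw_ge b : block_entropy_rate < b ->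
  \forall x \ae m, \forall n \near \oo, expR (- (b * n%:R)) <= pw (word n x).
Proof.
move=> hb; have b0 : 0 < b - block_entropy_rate by rewrite subr_gt0.
have [_ [n _ <-]] := inf_adherent b0 has_inf_rate.
rewrite -/block_entropy_rate addrC subrK ltr_pdivrMr// => hn.
(* The increments add up to [block_entropy n.+1], which is less than b (n + 1), so they cannot all
   be at least [b]. *)
have [k hk] : exists k, block_entropy k.+1 - block_entropy k < b.
  apply: contrapT => /forallNP nk; move: hn; rewrite ltNge => /negP; apply.
  elim: n.+1 => [|p IH]; first by rewrite mulr0 block_entropy_ge0.
  have /negP := nk p; rewrite -leNgt -natr1; lra.
exact: smb_upper hk.
Qed.

(** If H_n / n exceeded the infimum by [e] infinitely often, [smb_lower] with exponent h + e/2 would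
    contradict [ae_pw_ge] with exponent h + e/3. *)
Lemma cvg_block_entropy :
  n%:R^-1 * block_entropy n @[n --> \oo] --> block_entropy_rate.
Proof.
apply/cvgrPdist_le => e e0.
pose h := block_entropy_rate.
have [N hN] : exists N, forall n, (N <= n)%N ->
    block_entropy n < (h + e) * n%:R.
  apply: contrapT => /forallNP nN.
  have Hb N : exists2 n, (N <= n)%N & (h + e) * n%:R <= block_entropy n.
    have /existsNP[n /not_implyP[Nn /negP]] := nN N.
    by rewrite -leNgt => ?; exists n.
  have A := smb_lower Hb (_ : h + e / 2 < h + e).
  have B := @ae_pw_ge (h + e / 3).
  have : \forall x \ae m, False.
    apply: filterS2 (A _) (B _); [|lra|rewrite -/h; lra].
    move=> x Ax Bx; have [n [] ] : exists n : nat,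
        (pw (word n.+1 x) <= expR (- ((h + e / 2) * n.+1%:R)) /\
         expR (- ((h + e / 3) * n.+1%:R)) <= pw (word n.+1 x)).
      have [N1 _ h1] := Ax; have [N2 _ h2] := Bx.
      exists (maxn N1 N2); split; [apply: h1|apply: h2] => /=.
        by rewrite (leq_trans (leq_maxl N1 N2)).
      by rewrite (leq_trans (leq_maxr N1 N2)).
    move=> h1 h2; have := le_trans h2 h1; rewrite ler_expR lerN2.
    by rewrite ler_pM2r//; lra.
  move=> [A' [mA' A'0 sub]]; have A'T : A' = setT.
    by apply/seteqP; split => // x _; exact: sub.
  by move: A'0; rewrite A'T => /(congr1 fine); rewrite -/(prob m setT) prob_setT => /eqP; rewrite oner_eq0.
exists N.+1 => // n /= Nn; have n0 : 0 < n%:R :> R by rewrite ltr0n (leq_trans _ Nn).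
have := hN n (ltnW Nn); rewrite -ltr_pdivrMr// => h1.
have := block_entropy_rate_le n; rewrite -ler_pdivlMr// => h2.
move: h1 h2; rewrite [_^-1 * _]mulrC distrC => h1 h2.
by rewrite ger0_norm; move: h1 h2; rewrite -/h; lra.
Qed.

End finite_alphabet.

(** * Comparing labels *)

Section refinements.
Context {R : realType} d (T : measurableType d) (m : probability T R).
Variable S : T -> T.
Hypotheses (mS : measurable_fun setT S) (Sm : invariant_measure S m).
Hypothesis eS : ergodic_measure S m.

Lemma birkhoff_indic_le (E : set T) (r : R) : measurable E -> prob m E < r ->
  \forall x \ae m, \forall n \near \oo,
    \sum_(i < n) \1_E (iter i S x) <= r * n%:R.
Proof.
move=> mE Er; apply: (birkhoff_le mS Sm eS); first exact: integrable_indic.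
by rewrite integral_indic// setIT [ltLHS](_ : _ = (prob m E)%:E)//; exact: probE.
Qed.

Section markov_refinement.
Variables (C : countType) (D : finType) (l : T -> C) (k : T -> D).
Hypothesis ml : forall a, measurable (l @^-1` [set a]).
Hypothesis mk : forall b, measurable (k @^-1` [set b]).
Variables (tau : C -> D) (q : C -> R).
Hypothesis kE : forall x, k x = tau (l x).
Hypothesis q0 : forall a, 0 <= q a.
Hypothesis q1 : forall s b, uniq s -> \sum_(a <- s | tau a == b) q a <= 1.

(** The weights are those of a word of [k] refined letter by letter, independently, according to
    [q]; by [sum_allwords_map] they form a subprobability. *)
Lemma ae_refine_ge e : 0 < e -> \forall x \ae m, \forall n \near \oo,
  pw m S k (word S k n x) * \prod_(i < n) q (l (iter i S x)) <=
  expR (e * n%:R) * pw m S l (word S l n x).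
Proof.
move=> e0; pose v w := pw m S k (map tau w) * \prod_(a <- w) q a.
have v0 w : 0 <= v w by rewrite mulr_ge0 ?pw_ge0 ?prodr_ge0.
have v1 s n : uniq s -> \sum_(w <- allwords s n) v w <= 1.
  move=> us; apply: (@le_trans _ _ (\sum_(u <- allwords (enum D) n) pw m S k u)).
    apply: sum_allwords_map => //.
    - exact: enum_uniq.
    - by move=> a _; rewrite mem_enum.
    - by move=> u; exact: pw_ge0.
    - by move=> b; exact: q1.
  by apply: sum_pw_le1 => //; exact: enum_uniq.
have := ae_weight_le m mS ml e0 v0 v1; apply: filterS => x; apply: filterS => n.
rewrite /v; suff [-> ->] : map tau (word S l n x) = word S k n x /\
    \prod_(a <- word S l n x) q a = \prod_(i < n) q (l (iter i S x)) by [].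
elim: n x => [|n IH] x /=; first by rewrite big_nil big_ord0.
have [-> h] := IH (S x); rewrite kE; split => //.
rewrite big_cons big_ord_recl h; congr (_ * _).
by apply: eq_bigr => i _; rewrite -iterSr.
Qed.

End markov_refinement.

Lemma pw_factor (C D : countType) (l : T -> C) (k : T -> D) (f : D -> C) n x :
  (forall a, measurable (l @^-1` [set a])) ->
  (forall b, measurable (k @^-1` [set b])) ->
  (forall x, l x = f (k x)) -> pw m S k (word S k n x) <= pw m S l (word S l n x).
Proof.
move=> ml mk lE; apply: prob_le; [exact: measurable_cyl..|].
have E y : word S l n y = map f (word S k n y).
  by elim: n y => [//|n IH] y /=; rewrite IH lE.
by rewrite !cyl_word => y /= yx; rewrite !E yx.
Qed.

Lemma measurable_pair_label (C D : countType) (l : T -> C) (k : T -> D) :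
  (forall a, measurable (l @^-1` [set a])) ->
  (forall b, measurable (k @^-1` [set b])) ->
  forall p, measurable ((fun x => (l x, k x)) @^-1` [set p]).
Proof.
move=> ml mk [a b]; rewrite (_ : _ @^-1` _ = l @^-1` [set a] `&` k @^-1` [set b]).
  exact: measurableI.
by apply/seteqP; split => x /=; [case=> -> ->|case=> -> ->].
Qed.

Lemma measurable_neq_label (C : finType) (l k : T -> C) :
  (forall a, measurable (l @^-1` [set a])) ->
  (forall a, measurable (k @^-1` [set a])) ->
  measurable [set x | k x != l x].
Proof.
move=> ml mk; rewrite (_ : mkset _ = ~` \bigcup_(a in [set: C])
    (l @^-1` [set a] `&` k @^-1` [set a])).
  apply: measurableC; apply: fin_bigcup_measurable => //.
  by move=> a _; exact: measurableI.
apply/seteqP; split => x /=.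
  by move=> /eqP kl [a _ [/= la ka]]; apply: kl; rewrite la ka.
by move=> h; apply/eqP => kl; apply: h; exists (l x).
Qed.

Lemma measurable_map_label (C D : countType) (l : T -> C) (f : C -> D) :
  (forall a, measurable (l @^-1` [set a])) ->
  forall b, measurable ((f \o l) @^-1` [set b]).
Proof.
move=> ml b; rewrite (_ : _ @^-1` _ =
    \bigcup_a (if f a == b then l @^-1` [set a] else set0)).
  apply: countable_bigcupT_measurable; first exact: countableP.
  by move=> a; case: ifP.
apply/seteqP; split => x /=.
  by move=> fb; exists (l x) => //; rewrite fb eqxx.
by move=> [a _]; case: eqP => // <- ->.
Qed.

(** Cylinders of [k] are compared with those of the pair (l, k), which lie in cylinders of [l]:
    given the letter of [k], the guess by [phi] gets weight [z] and every other letter [u]. A right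
    guess costs [s], a wrong one [M], but wrong ones are rare. As [r] depends on #|C| and [e] only,
    [k] may be chosen after it. *)
Lemma ae_coarse_le (C : finType) (l : T -> C) (e : R) :
  (forall a, measurable (l @^-1` [set a])) -> 0 < e ->
  exists2 r : R, 0 < r & forall (D : finType) (k : T -> D) (phi : D -> C),
    (forall b, measurable (k @^-1` [set b])) ->
    measurable [set x | phi (k x) != l x] ->
    prob m [set x | phi (k x) != l x] < r ->
    forall c, (\forall x \ae m, \forall n \near \oo,
      pw m S l (word S l n x) <= expR (- (c * n%:R))) ->
    \forall x \ae m, \forall n \near \oo,
      pw m S k (word S k n x) <= expR (- ((c - e) * n%:R)).
Proof.
move=> ml e0; pose s := e / 4; have s0 : 0 < s by rewrite divr_gt0.
have C0 : 0 < #|C|%:R :> R by rewrite ltr0n; apply/card_gt0P; exists (l point).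
pose z := expR (- s); have z0 : 0 < z := expR_gt0 _.
have z1 : z < 1 by rewrite expR_lt1 oppr_lt0.
(* So that z + #|C| u = 1. *)
pose u := (1 - z) / #|C|%:R.
have u0 : 0 < u by rewrite divr_gt0// subr_gt0.
have u1 : u <= 1.
  rewrite ler_pdivrMr// mul1r (@le_trans _ _ 1)//; first by lra.
  by rewrite ler1n; apply/card_gt0P; exists (l point).
pose M := - ln u; have M0 : 0 <= M by rewrite oppr_ge0 ln_le0.
exists (s / (M + 1)); first by rewrite divr_gt0// ltr_wpDl.
move=> D k phi mk mE Er c Hc; set E := [set x | _] in mE Er.
pose q (p : C * D) := if phi p.2 == p.1 then z else u.
have q0 p : 0 <= q p by rewrite /q; case: ifP => _; exact: ltW.
have q1 t b : uniq t -> \sum_(p <- t | p.2 == b) q p <= 1.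
  move=> ut; rewrite -big_filter.
  apply: (@le_trans _ _ (\sum_(p <- [seq (a, b) | a <- enum C]) q p)).
    apply: ler_sum_sub => //; first exact: filter_uniq.
      by rewrite map_inj_uniq ?enum_uniq// => a a' [].
    move=> [a b'] /=; rewrite mem_filter /= => /andP[/eqP -> _].
    by apply/mapP; exists a => //; rewrite mem_enum.
  rewrite big_map big_enum /=.
  apply: (@le_trans _ _ (\sum_(a : C) ((a == phi b)%:R * z + u))).
    apply: ler_sum => a _; rewrite /q /= eq_sym.
    by case: eqP => _; rewrite ?mul1r ?mul0r ?add0r// lerDl ltW.
  rewrite big_split/= -big_distrl/= (bigD1 (phi b))//= eqxx big1 ?addr0.
    rewrite mul1r sumr_const -mulr_natr /u divfK ?gt_eqF//; lra.
  by move=> a /negbTE ->.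
have B := birkhoff_indic_le mE Er.
have Q := ae_refine_ge (measurable_pair_label ml mk) mk (fun x => erefl) q0 q1 s0.
apply: filterS3 B Q Hc => x B Q Hc; near=> n.
have Bn : \sum_(i < n) \1_E (iter i S x) <= s / (M + 1) * n%:R by near: n.
have Qn : pw m S k (word S k n x) *
    \prod_(i < n) q (l (iter i S x), k (iter i S x)) <=
  expR (s * n%:R) * pw m S (fun x => (l x, k x)) (word S (fun x => (l x, k x)) n x).
  by near: n.
have Hn : pw m S l (word S l n x) <= expR (- (c * n%:R)) by near: n.
have F := pw_factor (f := fst) n x ml (measurable_pair_label ml mk) (fun x => erefl).
have P : expR (- (2 * s * n%:R)) <= \prod_(i < n) q (l (iter i S x), k (iter i S x)).
  apply: (@le_trans _ _ (\prod_(i < n) expR (- s - M * \1_E (iter i S x)))).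
    rewrite -expR_sum ler_expR sumrB -mulr_sumr sumr_const card_ord -mulr_natr.
    have := ler_wpM2l M0 Bn; rewrite mulrA.
    have : M * (s / (M + 1)) <= s.
      by rewrite mulrA ler_pdivrMr ?ltr_wpDl// mulrC ler_wpM2l ?(ltW s0)// lerDl.
    move=> h1; have := ler_wpM2r (ler0n R n) h1; lra.
  apply: ler_prod => i _; rewrite expR_ge0 /q /= indicE.
  case: ifPn => [h|h].
    by rewrite /z ler_expR lerBlDr lerDl mulr_ge0// ler0n.
  rewrite mem_set ?mulr1; last by rewrite /E /=.
  rewrite -[leRHS]lnK ?posrE// ler_expR /M; lra.
have := le_trans (ler_wpM2l (pw_ge0 _ _ _ _) P) Qn.
move/le_trans => /(_ _ (ler_wpM2l (expR_ge0 _) (le_trans F Hn))).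
rewrite -ler_pdivlMr ?expR_gt0// -expRN -!expRD; move/le_trans; apply.
have eE : e = 4 * s by rewrite /s; lra.
have sn : 0 <= s * n%:R by rewrite mulr_ge0// ltW.
by rewrite ler_expR eE; lra.
Unshelve. all: by end_near. Qed.

(** The words can differ only at times when the orbit of [x] is in [E]. *)
Lemma agree_word_ge (C : countType) (l : T -> C) (E : set T) (t : R) n x y :
  0 < t -> t < 1 ->
  (forall i, (i < n)%N -> ~ E (iter i S x) -> l (iter i S y) = l (iter i S x)) ->
  expR (ln t * \sum_(i < n) \1_E (iter i S x)) <=
  agree t (word S l n y) (word S l n x).
Proof.
move=> t0 t1; have lnt : ln t <= 0 by rewrite ln_le0// ltW.
elim: n x y => [|n IH] x y h; first by rewrite big_ord0 mulr0 expR0.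
rewrite /= big_ord_recl mulrDr expRD ler_pM ?expR_ge0//.
  rewrite indicE /=; case: ifPn => [_|nxy].
    by rewrite -expR0 ler_expR mulr_le0_ge0.
  rewrite mem_set ?mulr1 ?lnK//; apply: contrapT => nE.
  by move: nxy; rewrite (h 0%N)// eqxx.
rewrite (le_trans _ (IH (S x) (S y) _))//.
  rewrite ler_expR ler_wnM2l// ler_sum// => i _.
  by rewrite -iterSr.
by move=> i ni; rewrite -!iterSr; exact: (h i.+1).
Qed.

(* Bowen balls meet few cylinders: [N w], the sum over words [v] of [pw v]
   damped by a factor [t] per disagreement with [w], is up to the factor
   [(1 + #|C| * t) ^+ n] a subprobability on words [w]. *)
Lemma ae_bowen_ball_le (C : finType) (e : R) : 0 < e ->
  exists2 r : R, 0 < r & forall (l : T -> C) (E : set T),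
    (forall a, measurable (l @^-1` [set a])) -> measurable E -> prob m E < r ->
    forall c, (\forall x \ae m, \forall n \near \oo,
      pw m S l (word S l n x) <= expR (- (c * n%:R))) ->
    \forall x \ae m, \forall n \near \oo, forall B : set T, measurable B ->
      (forall y i, B y -> (i < n)%N -> ~ E (iter i S x) ->
        l (iter i S y) = l (iter i S x)) ->
      prob m B <= expR (- ((c - e) * n%:R)).
Proof.
move=> e0; pose s := e / 4; have s0 : 0 < s by rewrite divr_gt0.
(* Small enough for (1 + #|C| t)^n <= exp(s n); the minimum with 1/2 makes [M] positive. With the
   threshold s / M, visits to [E] cost at most [s] per unit of time. *)
pose t := Num.min 2^-1 (s / #|C|.+1%:R).
have t0 : 0 < t by rewrite lt_min invr_gt0 ltr0n/= divr_gt0.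
have t1 : t < 1 by rewrite gt_min invf_lt1 ?ltr1n// orTb.
have Ct : #|C|%:R * t <= s.
  apply: (@le_trans _ _ (#|C|.+1%:R * t)).
    by rewrite ler_pM2r// ler_nat.
  by rewrite mulrC -ler_pdivlMr// ge_min lexx orbT.
pose M := - ln t; have M0 : 0 < M by rewrite oppr_gt0 ln_lt0// t0.
exists (s / M); first exact: divr_gt0.
move=> l E ml mE Er c Hc.
pose N n w := \sum_(v <- allwords (enum C) n) pw m S l v * agree t v w.
have N0 n w : 0 <= N n w.
  by apply: sumr_ge0 => v _; rewrite mulr_ge0 ?pw_ge0 ?agree_ge0 ?ltW.
pose v w := N (size w) w / (1 + #|C|%:R * t) ^+ size w.
have D0 : 0 < 1 + #|C|%:R * t by rewrite ltr_wpDr// mulr_ge0// ltW.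
have v0 w : 0 <= v w by rewrite divr_ge0// exprn_ge0 ?ltW.
have v1 (u : seq C) n : uniq u -> \sum_(w <- allwords u n) v w <= 1.
  move=> uu; apply: (@le_trans _ _
      (\sum_(w <- allwords u n) N n w / (1 + #|C|%:R * t) ^+ n)).
    rewrite big_seq [leRHS]big_seq; apply: ler_sum => w.
    by rewrite mem_allwords => /andP[/eqP wn _]; rewrite /v wn.
  rewrite -mulr_suml ler_pdivrMr ?exprn_gt0// mul1r /N exchange_big/=.
  apply: (@le_trans _ _ (\sum_(j <- allwords (enum C) n)
      pw m S l j * (1 + #|C|%:R * t) ^+ n)).
    rewrite big_seq [leRHS]big_seq; apply: ler_sum => j.
    rewrite mem_allwords => /andP[/eqP jn _].
    rewrite -mulr_sumr ler_wpM2l ?pw_ge0// -jn.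
    apply: (le_trans (sum_agree j (ltW t0) uu)).
    have uC : (size u <= #|C|)%N by rewrite -(card_uniqP uu) max_card.
    rewrite lerXn2r ?nnegrE ?addr_ge0 ?mulr_ge0 ?(ltW t0)//.
    by rewrite lerD2l ler_wpM2r ?(ltW t0)// ler_nat.
  rewrite -mulr_suml sum_pw// mul1r.
  by [].
have W := ae_weight_le m mS ml s0 v0 v1.
have A := birkhoff_indic_le mE Er.
apply: filterS3 A W Hc => x A W Hc; near=> n => B mB HB.
have An : \sum_(i < n) \1_E (iter i S x) <= s / M * n%:R by near: n.
have Wn : v (word S l n x) <= expR (s * n%:R) * pw m S l (word S l n x) by near: n.
have Hn : pw m S l (word S l n x) <= expR (- (c * n%:R)) by near: n.
have agB y : B y -> expR (- (M * \sum_(i < n) \1_E (iter i S x))) <=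
    agree t (word S l n y) (word S l n x).
  move=> By; rewrite /M mulNr opprK; apply: agree_word_ge => // i.
  exact: HB.
have mw w : measurable (word S l n @^-1` [set w]).
  have [<-|nw] := eqVneq (size w) n; first exact: (measurable_cyl mS ml w).
  rewrite (_ : _ @^-1` _ = set0)// -subset0 => y /= yw.
  by move: nw; rewrite -yw size_word eqxx.
(* [B] is cut up by words; a word that meets [B] agrees with that of [x] except during visits to
   [E]. *)
have BN : expR (- (M * \sum_(i < n) \1_E (iter i S x))) * prob m B <=
    N n (word S l n x).
  rewrite -(@prob_fibers _ _ _ m _ (word S l n) (allwords (enum C) n) _ mB mw); last 2 first.
  - by apply: uniq_allwords; exact: enum_uniq.
  - by move=> y _; exact: word_in.
  rewrite mulr_sumr big_seq [leRHS]big_seq; apply: ler_sum => w.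
  rewrite mem_allwords => /andP[/eqP wn _].
  have [[y [By yw]]|nB] := pselect (B `&` word S l n @^-1` [set w] !=set0).
    rewrite mulrC ler_pM ?prob_ge0 ?expR_ge0//.
      by apply: prob_le => //; [exact: measurableI|exact: measurable_cyl|
        rewrite /cyl wn => z []].
    by rewrite -yw; exact: agB.
  rewrite (_ : _ `&` _ = set0); last by apply/eqP/negPn/negP => /set0P.
  by rewrite {1}/prob measure0 mulr0 mulr_ge0 ?pw_ge0 ?agree_ge0// ltW.
have D1 : (1 + #|C|%:R * t) ^+ n <= expR (s * n%:R).
  rewrite [s * _]mulrC expRM_natl lerXn2r ?nnegrE ?expR_ge0 ?(ltW D0)//.
  by rewrite (le_trans (expR_ge1Dx _))// ler_expR.
have Nn : N n (word S l n x) <= expR (s * n%:R) * expR (s * n%:R) * expR (- (c * n%:R)).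
  move: Wn; rewrite /v size_word ler_pdivrMr ?exprn_gt0// => Wn.
  apply: (le_trans Wn); rewrite -mulrA -(mulrA (expR (s * n%:R))) ler_wpM2l ?expR_ge0// mulrC.
  by apply: ler_pM => //; [rewrite exprn_ge0// ltW|exact: pw_ge0].
have := le_trans BN Nn.
rewrite -ler_pdivlMl ?expR_gt0// -expRN opprK -!expRD; move/le_trans; apply.
rewrite ler_expR.
have := ler_wpM2l (ltW M0) An; rewrite mulrCA mulrA divfK ?gt_eqF//.
have eE : e = 4 * s by rewrite /s; lra.
have sn : 0 <= s * n%:R by rewrite mulr_ge0// ltW.
by rewrite eE; lra.
Unshelve. all: by end_near. Qed.

Lemma integral_tail_lt (g : T -> R) (l : T -> nat) (e : R) : 0 < e ->
  (forall x, 0 <= g x) -> (forall a, measurable (l @^-1` [set a])) ->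
  m.-integrable setT (EFin \o g) -> exists K,
    m.-integrable setT (EFin \o (fun x => g x * \1_[set x | (K <= l x)%N] x)) /\
    (\int[m]_x (g x * \1_[set x | (K <= l x)%N] x)%:E < e%:E)%E.
Proof.
move=> e0 g0 ml ig.
have mE K : measurable [set x | (K <= l x)%N].
  rewrite (_ : mkset _ = \bigcup_(a in [set a | (K <= a)%N]) (l @^-1` [set a])).
    exact: bigcup_measurable.
  by apply/seteqP; split => x /=; [exists (l x)|move=> [a /= Ka ->]].
pose h K x := g x * \1_[set x | (K <= l x)%N] x.
have mg : measurable_fun setT g by exact/measurable_EFinP/(measurable_int m).
have mh K : measurable_fun setT (EFin \o h K).
  by apply/measurable_EFinP; apply: measurable_funM => //; exact: measurable_indic.
have hg K x : (`|(EFin \o h K) x| <= (EFin \o g) x)%E.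
  rewrite /= lee_fin ger0_norm; last by rewrite mulr_ge0// indicE.
  by rewrite /h ler_piMr// indicE lern1 leq_b1.
have ih K : m.-integrable setT (EFin \o h K).
  apply: le_integrable ig => // x _; apply: (le_trans (hg K x)) => /=.
  by rewrite lee_fin ler_norm.
have ch : {ae m, forall x, setT x -> (EFin \o h n) x @[n --> \oo] --> (cst 0%E) x}.
  apply: aeW => x _; apply: cvg_near_cst; exists (l x).+1 => // n /= ln.
  by rewrite /h indicE memNset ?mulr0//= leqNgt ln.
have dh : {ae m, forall x n, setT x -> (`|(EFin \o h n) x| <= (EFin \o g) x)%E}.
  by apply: aeW => x n _; exact: hg.
have [_ _] := dominated_convergence measurableT mh (measurable_cst _) ch ig dh.
rewrite integral0 => /fine_cvgP[_ /cvgrPdist_lt /(_ e e0)] [K _ /(_ K (leqnn K))] /=.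
rewrite sub0r normrN => hK; exists K; split; first exact: ih.
have fin := integrable_fin_num measurableT (ih K).
rewrite -(fineK fin) lte_fin (le_lt_trans (ler_norm _))//.
Qed.

(* A partition with finite entropy into countably many atoms refines a finite
   one, obtained by merging the atoms of index at least [K], at a cost given by
   the tail of its entropy. *)
Lemma ae_countable_ge (A : finType) (l : T -> nat) (k : T -> A) (b e : R) :
  (forall i, measurable (l @^-1` [set i])) ->
  (forall a, measurable (k @^-1` [set a])) ->
  m.-integrable setT (EFin \o (fun x => - ln (prob m (l @^-1` [set l x])))) ->
  (forall (D : finType) (f : nat * A -> D),
    let h := f \o (fun x => (l x, k x)) in
    \forall x \ae m, \forall n \near \oo,
      expR (- (b * n%:R)) <= pw m S h (word S h n x)) ->
  0 < e -> \forall x \ae m, \forall n \near \oo,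
    expR (- ((b + e) * n%:R)) <=
    pw m S (fun x => (l x, k x)) (word S (fun x => (l x, k x)) n x).
Proof.
move=> ml mk ig Hb e0; pose g x := - ln (prob m (l @^-1` [set l x])).
pose s := e / 2; have s0 : 0 < s by rewrite divr_gt0.
have g0 x : 0 <= g x by rewrite oppr_ge0 ln_le0// prob_le1.
have [K [iK hK]] := integral_tail_lt s0 g0 ml ig.
pose tau (p : nat * A) : 'I_K.+1 * A := (inord (minn p.1 K), p.2).
(* A letter of index below [K] is alone in its fibre of [tau] and gets weight 1; the letters of the
   tail share a fibre according to their measures. *)
pose q (p : nat * A) := if (p.1 < K)%N then 1 else prob m (l @^-1` [set p.1]).
have q0 p : 0 <= q p by rewrite /q; case: ifP => // _; exact: prob_ge0.
have tauE p p' : tau p = tau p' -> (minn p.1 K = minn p'.1 K) /\ p.2 = p'.2.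
  by case=> /(congr1 val) /=; rewrite !inordK ?ltnS ?geq_minr// => -> ->.
have q1 t c : uniq t -> \sum_(p <- t | tau p == c) q p <= 1.
  move=> ut; rewrite -big_filter; pose u := [seq p <- t | tau p == c]; rewrite -/u.
  have uu : uniq u by exact: filter_uniq.
  have [[p pu pK]|nu] := pselect (exists2 p, p \in u & (p.1 < K)%N).
    rewrite (_ : u = [:: p]) ?big_seq1 /q ?pK//.
    have {}uE p' : p' \in u -> p' = p.
      move: pu; rewrite !mem_filter => /andP[/eqP <- _] /andP[/eqP /tauE[]].
      case: p p' pK => [i a] [j a'] /= iltK + -> _.
      rewrite (minn_idPl (ltnW iltK)) /minn; case: ltnP => [_ ->//|_ iE].
      by rewrite -iE ltnn in iltK.
    case: u uu pu uE => [//|p1 [|p2 u]] uu pu uE.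
      by rewrite (uE p1)// mem_head.
    have := uE p1 (mem_head _ _); have := uE p2.
    rewrite !inE eqxx orbT => /(_ isT) p2E p1E.
    by move: uu; rewrite /= p1E p2E inE eqxx.
  apply: (@le_trans _ _ (\sum_(i <- map fst u) prob m (l @^-1` [set i]))).
    rewrite big_map big_seq [leRHS]big_seq; apply: ler_sum => p pu.
    by rewrite /q; case: ifP => // pK; exfalso; apply: nu; exists p.
  have um : uniq (map fst u).
    rewrite map_inj_in_uniq// => -[i a] [j a'] /=.
    rewrite !mem_filter => /andP[/eqP <- _] /andP[/eqP /tauE[_ /= ->] _] ->.
    by [].
  have := @prob_fibers_le _ _ _ m _ l _ _ measurableT ml um.
  rewrite prob_setT; apply: le_trans; apply: ler_sum => i _.
  by rewrite setTI.
have mh : forall c, measurable ((tau \o (fun x => (l x, k x))) @^-1` [set c]).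
  exact: measurable_map_label (measurable_pair_label ml mk).
have Q := ae_refine_ge (measurable_pair_label ml mk) mh (fun x => erefl) q0 q1 s0.
have B := birkhoff_le mS Sm eS iK hK.
have P := ae_pw_gt0 m mS ml.
have {}Hb := Hb _ tau.
have BP : \forall x \ae m, (forall n, 0 < pw m S l (word S l n x)) /\
  (\forall n \near \oo, expR (- (b * n%:R)) <=
    pw m S (tau \o (fun x => (l x, k x))) (word S (tau \o (fun x => (l x, k x))) n x)).
  by apply: filterS2 P Hb.
apply: filterS3 Q B BP => {P Hb} x Q B [P H]; near=> n.
have Qn : pw m S (tau \o (fun x => (l x, k x))) (word S (tau \o (fun x => (l x, k x))) n x) *
    \prod_(i < n) q (l (iter i S x), k (iter i S x)) <=
  expR (s * n%:R) * pw m S (fun x => (l x, k x)) (word S (fun x => (l x, k x)) n x).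
  by near: n.
have Bn : \sum_(i < n) (g (iter i S x) * \1_[set x | (K <= l x)%N] (iter i S x))
    <= s * n%:R by near: n.
have Hn : expR (- (b * n%:R)) <= pw m S (tau \o (fun x => (l x, k x)))
    (word S (tau \o (fun x => (l x, k x))) n x) by near: n.
have qE : expR (- (s * n%:R)) <= \prod_(i < n) q (l (iter i S x), k (iter i S x)).
  apply: (@le_trans _ _ (\prod_(i < n) expR (- (g (iter i S x) *
      \1_[set x | (K <= l x)%N] (iter i S x))))).
    by rewrite -expR_sum ler_expR sumrN lerN2.
  apply: ler_prod => i _; rewrite expR_ge0 /q /= indicE.
  case: ltnP => h; first by rewrite -expR0 ler_expR oppr_le0 mulr_ge0.
  rewrite mem_set// mulr1 /g opprK lnK// posrE.
  have := lt_le_trans (P (i + 1)%N) (pw_word_iter mS Sm ml i 1 x).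
  rewrite /pw cyl_word /= (_ : [set y | _] = l @^-1` [set l (iter i S x)])//.
  by apply/seteqP; split => y /=; [case|move=> ->].
have := le_trans (ler_pM (expR_ge0 _) (expR_ge0 _) Hn qE) Qn.
rewrite -ler_pdivrMl ?expR_gt0// -expRN -!expRD; apply: le_trans.
rewrite ler_expR; have eE : e = 2 * s by rewrite /s; lra.
by rewrite eE; lra.
Unshelve. all: by end_near. Qed.

End refinements.

(** * Images and Jacobians *)

Section borel_sets.

Lemma open_borel (T : ptopologicalType) (U : set T) :
  open U -> measurable (U : set (borel T)).
Proof. by move=> oU; exact: sub_sigma_algebra. Qed.

Lemma closed_borel (T : ptopologicalType) (F : set T) :
  closed F -> measurable (F : set (borel T)).
Proof.
move=> cF; rewrite -(setCK F); apply: (@measurableC _ (borel T)).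
by apply: open_borel; exact: closed_openC.
Qed.

Lemma continuous_borel (T U : ptopologicalType) (g : T -> U) :
  continuous g -> measurable_fun setT (g : borel T -> borel U).
Proof.
move=> cg; apply: (@measurability _ _ (borel T) (borel U) setT g (@open U)) => //.
move=> _ [V oV <-].
rewrite setTI; apply: open_borel; by move/continuousP : cg; exact.
Qed.

End borel_sets.

Section metric_images.
Context {R : realType} {X : pmetricType R}.

Lemma open_mdist (x : X) (r : R) : open [set y : X | mdist x y < r].
Proof.
rewrite openE => y /= xy; apply/nbhs_ballP; exists (r - mdist x y) => /=.
  by rewrite subr_gt0.
move=> z; rewrite ballEmdist /= => yz.
by rewrite (le_lt_trans (metric_triangle x y z))// -ltrBrDl.
Qed.

Lemma closed_mdist (x : X) (r : R) : closed [set y : X | mdist x y <= r].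
Proof.
rewrite (_ : mkset _ = ~` [set y : X | r < mdist x y]).
  apply: open_closedC; rewrite openE => y /= xy.
  apply/nbhs_ballP; exists (mdist x y - r) => /=; first by rewrite subr_gt0.
  move=> z; rewrite ballEmdist /= => yz.
  have := metric_triangle x z y; rewrite [mdist z y]metric_sym; lra.
by apply/seteqP; split => y /=; rewrite leNgt => /negP.
Qed.

Hypothesis cX : compact [set: X].

Lemma finite_ball_cover (r : X -> R) : (forall x, 0 < r x) ->
  exists s : seq X, forall y, exists2 x, x \in s & mdist x y < r x.
Proof.
move=> r0; have := cX; rewrite compact_cover.
move=> /(_ X setT (fun x => [set y : X | mdist x y < r x])).
move=> [|y _|s _ h]; first by move=> x _; exact: open_mdist.
  by exists y => //=; rewrite mdistxx.
by exists (finmap.enum_fset s) => y; have [x xs xy] := h y I; exists x.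
Qed.

Variable f : X -> X.
Hypotheses (cf : continuous f) (lf : locally_injective f).

(** Injectivity is required on closed balls, which are compact, and the covering is by the open
    ones. *)
Lemma injective_ball_cover : exists (s : seq X) (r : X -> R),
  [/\ forall x, 0 < r x,
      forall x, {in [set y | mdist x y <= r x] &, injective f} &
      forall y, exists2 x, x \in s & mdist x y < r x].
Proof.
have /choice[r hr] : forall x, exists r : R, 0 < r /\
    {in [set y | mdist x y <= r] &, injective f}.
  move=> x; have [U /nbhs_ballP[e e0 eU] fU] := lf x.
  exists (e / 2); split; first exact: divr_gt0.
  have sub y : y \in [set y | mdist x y <= e / 2] -> y \in U.
    rewrite !inE /= => xy; apply: eU; rewrite ballEmdist /=.
    by rewrite (le_lt_trans xy)// ltr_pdivrMr// ltr_pMr// ltr1n.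
  by move=> y z /sub yU /sub zU; exact: fU.
have [s hs] := finite_ball_cover (fun x => (hr x).1).
by exists s, r; split => // x; [exact: (hr x).1|exact: (hr x).2].
Qed.

Lemma closed_image (F : set X) : closed F -> closed (f @` F).
Proof.
move=> cF; apply: compact_closed; first exact: metric_hausdorff.
apply: continuous_compact; first exact: continuous_subspaceT.
exact: subclosed_compact cF cX _.
Qed.

(** On a closed ball [K x] where [f] is injective, images commute with complements, so the sets with
    Borel image form a sigma-algebra. It contains every open [U], because the image of the part of
    the ball in [U] is the difference of two compact images. *)
Lemma measurable_image (B : set (borel X)) :
  measurable B -> measurable (f @` B : set (borel X)).
Proof.
move=> mB; have [s [r [r0 fr sr]]] := injective_ball_cover.
pose K x : set (borel X) := [set y | mdist x y <= r x].
have -> : f @` B = \bigcup_(x in [set` s]) (f @` (B `&` K x)).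
  apply/seteqP; split => [_ [y By <-]|_ [x _ [y [By _] <-]]]; last by exists y.
  have [x xs xy] := sr y; exists x => //; exists y => //; split => //.
  exact: ltW.
apply: (@fin_bigcup_measurable _ (borel X)); first exact: finite_seq.
move=> x _; have mfK : measurable (f @` K x : set (borel X)).
  by apply: closed_borel; apply: closed_image; exact: closed_mdist.
pose G := [set A : set X | measurable (f @` (A `&` K x) : set (borel X))].
suff : <<s @open X >> `<=` G by apply.
apply: smallest_sub.
  split.
  - by rewrite /G /= set0I image_set0; exact: measurable0.
  - move=> A GA; rewrite /G /=.
    rewrite (_ : f @` _ = (f @` K x) `\` (f @` (A `&` K x))).
      exact: (@measurableD _ (borel X)).
    apply/seteqP; split => [_ [y [[_ nAy] Ky] <-]|_ [[y Ky <-] nfy]].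
      split; first by exists y.
      move=> [z [Az Kz] fzy]; apply: nAy.
      by rewrite -(fr x z y) ?inE.
    by exists y => //; split => //; split => // Ay; apply: nfy; exists y.
  - move=> A GA; rewrite /G /= setI_bigcupl image_bigcup.
    by apply: (@bigcupT_measurable _ (borel X)) => k; exact: GA.
move=> U oU; rewrite /G /=.
have -> : f @` (U `&` K x) = (f @` K x) `\` (f @` (K x `&` ~` U)).
  apply/seteqP; split => [_ [y [Uy Ky] <-]|_ [[y Ky <-] nfy]].
    split; first by exists y.
    move=> [z [Kz nUz] fzy]; apply: nUz.
    by rewrite (fr x z y) ?inE.
  exists y => //; split => //; apply: contrapT => nUy.
  by apply: nfy; exists y.
apply: (@measurableD _ (borel X)) => //.
apply: closed_borel; apply: closed_image; apply: closedI.
  exact: closed_mdist.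
exact: open_closedC.
Qed.

Lemma measurable_image_iter n (B : set (borel X)) :
  measurable B -> measurable (iter n f @` B : set (borel X)).
Proof.
move=> mB; elim: n => [|n IH]; first by rewrite image_id.
have -> : iter n.+1 f @` B = f @` (iter n f @` B) by rewrite image_comp.
exact: measurable_image.
Qed.

Section jacobian_estimates.
Variables (mu : probability (borel X) R) (J : borel X -> R).
Hypothesis Smu : invariant_measure (f : borel X -> borel X) mu.
Hypothesis HJ : is_jacobian f mu J.

Let mJ : measurable_fun setT J. Proof. by have [] := HJ. Qed.

Let mf : measurable_fun setT (f : borel X -> borel X).
Proof. exact: continuous_borel. Qed.

(** Overlaps between the images of the pieces [A i] only lower the left-hand side, so [f] may fail
    to be injective on [B]. *)
Lemma prob_image_le (B : set (borel X)) (s : R) : measurable B -> 0 <= s ->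
  (\forall x \ae mu, B x -> J x <= s) -> prob mu (f @` B) <= s * prob mu B.
Proof.
move=> mB s0 Js; have [_ [A [mA tA UA fA HA]]] := HJ.
have mBA i : measurable (B `&` A i) by exact: measurableI.
have mfBA i : measurable (f @` (B `&` A i) : set (borel X)) by exact: measurable_image.
have BE : B = \bigcup_i (B `&` A i) by rewrite -setI_bigcupr UA setIT.
have fBE : f @` B = \bigcup_i (f @` (B `&` A i)) by rewrite [in LHS]BE image_bigcup.
have mfB := measurable_image mB.
have le_i i : (mu (f @` (B `&` A i)) <= s%:E * mu (B `&` A i))%E.
  rewrite (HA i)//.
  (* The sign of [J] is not known here; the negative part is dropped. *)
  rewrite integralE -[leRHS]adde0.
  have h1 : (\int[mu]_(x in B `&` A i) (fun x => (J x)%:E)^\+%E x <= s%:E * mu (B `&` A i))%E.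
    rewrite -integral_cst//; apply: ae_ge0_le_integral => //.
    - by apply: measurable_funepos; apply/measurable_EFinP; exact: measurable_funTS.
    move: Js; apply: filterS => x Jx [/Jx {}Jx _].
    by rewrite funeposE /= -EFin_max lee_fin ge_max Jx.
  by apply: leeD => //; rewrite oppe_le0; exact: integral_ge0.
rewrite -lee_fin -probE// EFinM -probE// [X in (mu X <= _)%E]fBE.
apply: (le_trans (generalized_Boole_inequality mu mfBA _)).
  by rewrite -fBE.
apply: (@le_trans _ _ (\sum_(i <oo) (s%:E * mu (B `&` A i)))%E).
  by apply: lee_nneseries => [i _ _|i _]; [exact: measure_ge0|exact: le_i].
rewrite nneseriesZl// lee_wpmul2l// ?lee_fin//.
rewrite [in leRHS]BE measure_bigcup//; last first.
  by apply: trivIset_setIl.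
rewrite le_eqVlt; apply/orP; left; apply/eqP.
by apply: eq_eseriesl => i; rewrite in_setT.
Qed.

(** Injectivity on [B] makes the images of the pieces disjoint, so their measures add up. *)
Lemma prob_image_ge (B : set (borel X)) (s : R) : measurable B -> 0 <= s ->
  (forall x, B x -> s <= J x) -> {in B &, injective f} ->
  s * prob mu B <= prob mu (f @` B).
Proof.
move=> mB s0 Js fB; have [_ [A [mA tA UA fA HA]]] := HJ.
have mBA i : measurable (B `&` A i) by exact: measurableI.
have mfBA i : measurable (f @` (B `&` A i) : set (borel X)) by exact: measurable_image.
have BE : B = \bigcup_i (B `&` A i) by rewrite -setI_bigcupr UA setIT.
have fBE : f @` B = \bigcup_i (f @` (B `&` A i)) by rewrite [in LHS]BE image_bigcup.
have mfB := measurable_image mB.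
have le_i i : (s%:E * mu (B `&` A i) <= mu (f @` (B `&` A i)))%E.
  rewrite (HA i)//.
  rewrite -integral_cst//; apply: ge0_le_integral => //.
  - by apply/measurable_EFinP; exact: measurable_funTS.
  - by move=> x [Bx _]; rewrite lee_fin Js.
rewrite -lee_fin EFinM -!probE//.
have t1 : trivIset setT (fun i => B `&` A i) by exact: trivIset_setIl.
have t2 : trivIset setT (fun i => f @` (B `&` A i)).
  apply/trivIsetP => i j _ _ ij; rewrite -subset0 => _ [[y [By Ay] <-] [z [Bz Az]]].
  move=> /fB; rewrite !inE => /(_ Bz By) zy; move: Az; rewrite zy => Ajy.
  have /trivIsetP/(_ i j I I ij)/seteqP[+ _] := tA.
  by move=> /(_ y (conj Ay Ajy)).
rewrite [X in (mu X)%E]BE [X in (_ <= mu X)%E]fBE !measure_bigcup//.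
rewrite -nneseriesZl//; apply: lee_nneseries => [i _ _|i _]; last exact: le_i.
by rewrite mule_ge0// lee_fin.
Qed.

Lemma prob_le_image (B : set (borel X)) : measurable B ->
  prob mu B <= prob mu (f @` B).
Proof.
move=> mB; have mfB := measurable_image mB.
rewrite -[leRHS](prob_preimage Smu mfB); apply: prob_le => //.
  exact: (measurable_preimage mf).
by move=> x Bx; exists x.
Qed.

(** By invariance [f] never decreases measure, yet it would shrink a non-null set on which [J] is at
    most 1 - 1/(n+1). *)
Lemma jacobian_ge1 : \forall x \ae mu, 1 <= J x.
Proof.
pose N n := [set x : borel X | J x <= 1 - n.+1%:R^-1].
have mN n : measurable (N n).
  rewrite (_ : N n = J @^-1` `]-oo, 1 - n.+1%:R^-1]%classic).
    by rewrite -[X in measurable X]setTI; apply: mJ => //; exact: measurable_itv.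
  by apply/seteqP; split => x; rewrite /N /= in_itv.
have N0 n : mu (N n) = 0%E.
  rewrite probE//; congr EFin; apply/eqP; rewrite eq_le prob_ge0 andbT.
  have h : prob mu (N n) <= (1 - n.+1%:R^-1) * prob mu (N n).
    apply: (le_trans (prob_le_image (mN n))); apply: prob_image_le => //.
      by rewrite subr_ge0 invf_le1// ler1n.
    exact: aeW.
  have n0 : 0 < n.+1%:R^-1 :> R by rewrite invr_gt0.
  by move: h n0; set a := _^-1 => h a0; rewrite -(pmulr_rle0 _ a0); lra.
have : mu.-negligible (\bigcup_n N n).
  apply: negligible_bigcup => n; exists (N n); split; [exact: mN|exact: N0|].
  exact: subset_refl.
apply: negligibleS => x /= /negP; rewrite -ltNge => Jx.
exists (Num.bound (1 - J x)^-1) => //; rewrite /N /= lerBrDr -lerBrDl.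
have J1 : 0 < 1 - J x by rewrite subr_gt0.
rewrite -[leRHS]invrK lef_pV2 ?posrE ?invr_gt0//.
rewrite ltW// (lt_trans (archi_boundP _)) ?ltr_nat// invr_ge0 ltW//.
Qed.

Lemma prob_image_iter_le (B : set (borel X)) (s : nat -> R) n : measurable B ->
  (forall i, 0 <= s i) ->
  (forall i, (i < n)%N -> \forall x \ae mu, (iter i f @` B) x -> J x <= s i) ->
  prob mu (iter n f @` B) <= (\prod_(i < n) s i) * prob mu B.
Proof.
move=> mB s0; elim: n => [|n IH] h; first by rewrite image_id big_ord0 mul1r.
have -> : iter n.+1 f @` B = f @` (iter n f @` B) by rewrite image_comp.
have mn := measurable_image_iter n mB.
rewrite (le_trans (prob_image_le mn (s0 n) (h n (ltnSn n))))//.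
rewrite big_ord_recr /= mulrAC -[leRHS]mulrC ler_wpM2l//.
by apply: IH => i ni; apply: h; exact: ltnW.
Qed.

Lemma prob_image_iter_ge (B : set (borel X)) (s : nat -> R) n : measurable B ->
  (forall i, 0 <= s i) ->
  (forall i, (i < n)%N -> {in iter i f @` B &, injective f}) ->
  (forall i x, (i < n)%N -> (iter i f @` B) x -> s i <= J x) ->
  (\prod_(i < n) s i) * prob mu B <= prob mu (iter n f @` B).
Proof.
move=> mB s0; elim: n => [|n IH] fB h; first by rewrite image_id big_ord0 mul1r.
have -> : iter n.+1 f @` B = f @` (iter n f @` B) by rewrite image_comp.
have mn := measurable_image_iter n mB.
rewrite (le_trans _ (prob_image_ge mn (s0 n) _ (fB n (ltnSn n))))//; last first.
  by move=> x; exact: h.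
rewrite big_ord_recr /= mulrAC -[leLHS]mulrC ler_wpM2l//.
by apply: IH => [i ni|i x ni]; [apply: fB|apply: h]; exact: ltnW.
Qed.

End jacobian_estimates.

End metric_images.

(** * Folding entropy *)

Section mixtures.
Context {R : realType} d (T : measurableType d) (m : probability T R).
Variable l : T -> {measure set T -> \bar R}.
Hypothesis ml : forall U, measurable U -> measurable_fun setT (l ^~ U).
Hypothesis lm : forall A, measurable A -> m A = (\int[m]_x l x A)%E.

Lemma integral_mixture_nnsfun (h : {nnsfun T >-> R}) :
  (\int[m]_x \int[l x]_y (h y)%:E = \int[m]_y (h y)%:E)%E.
Proof.
rewrite [RHS]integralT_nnsfun sintegralE.
under eq_integral do rewrite integralT_nnsfun sintegralE.
have mh r : measurable (h @^-1` [set r]) by exact: measurable_funPTI.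
have h0 r x : (0 <= r%:E * l x (h @^-1` [set r]))%E.
  have [r0|r0] := leP 0 r; first by rewrite mule_ge0// lee_fin.
  rewrite (_ : _ @^-1` _ = set0) ?measure0 ?mule0// -subset0 => y /= hy.
  by rewrite -hy ltNge fun_ge0 in r0.
rewrite ge0_integral_fsum//; do ?[by move=> r; apply: measurable_funeM; exact: ml].
apply: eq_fsbigr => r rh.
have r0 : 0 <= r by move: rh; rewrite inE => -[y _ <-]; exact: fun_ge0.
rewrite ge0_integralZl//; last exact: ml.
by congr (_ * _)%E; rewrite -lm.
Qed.

Lemma ge0_integral_mixture (g : T -> \bar R) : (forall x, (0 <= g x)%E) ->
  measurable_fun setT g ->
  (\int[m]_x \int[l x]_y g y = \int[m]_y g y)%E.
Proof.
move=> g0 mg; pose g_ := nnsfun_approx measurableT mg.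
have gE x : g x = limn (fun n => (g_ n x)%:E).
  by apply/esym/cvg_lim => //; exact: cvg_nnsfun_approx.
have nd x : {homo (fun n => (g_ n x)%:E) : n p / (n <= p)%N >-> (n <= p)%E}.
  by move=> n p np; rewrite lee_fin; exact/lefP/nd_nnsfun_approx.
have gn0 n x : (0 <= (g_ n x)%:E)%E by rewrite lee_fin.
have mgn n : measurable_fun setT (fun x => (g_ n x)%:E).
  by apply/measurable_EFinP; exact: measurable_funP.
have limE (mu : {measure set T -> \bar R}) :
    (\int[mu]_x g x = limn (fun n => \int[mu]_x (g_ n x)%:E))%E.
  under eq_integral do rewrite gE.
  by rewrite monotone_convergence.
rewrite [RHS]limE.
under eq_integral do rewrite limE.
rewrite monotone_convergence//.
- by under eq_fun do rewrite integral_mixture_nnsfun.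
- by move=> n; exact: measurable_fun_integral_kernel.
- by move=> n x _; exact: integral_ge0.
- move=> x _ n p np; apply: ge0_le_integral => // y _; exact: nd.
Qed.

Lemma mixture_null (N : set T) : measurable N -> m N = 0%E ->
  \forall x \ae m, l x N = 0%E.
Proof.
move=> mN N0; have h := lm mN; rewrite N0 in h.
have mlN : measurable_fun setT (l ^~ N) by exact: ml.
have /(ae_eq_integral_abs m measurableT mlN) : (\int[m]_x `|l x N| = 0)%E.
  by rewrite h; apply: eq_integral => x _; rewrite gee0_abs.
by apply: filterS => x; exact.
Qed.

End mixtures.

Lemma ae_forall_countable {R : realType} d (T : measurableType d)
    (m : {measure set T -> \bar R}) (C : countType) (P : C -> T -> Prop) :
  (forall c, \forall x \ae m, P c x) -> \forall x \ae m, forall c, P c x.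
Proof.
move=> h; have : \forall x \ae m, forall n, forall c, pickle c = n -> P c x.
  apply: ae_foralln => n; have [[c cn]|nc] := pselect (exists c : C, pickle c = n).
    apply: filterS (h c) => x Pcx c'; rewrite -cn => /(pcan_inj (@pickleK _)) ->.
    by [].
  by apply: aeW => x c cn; exfalso; apply: nc; exists c.
by apply: filterS => x hx c; exact: (hx (pickle c)).
Qed.

Section folding.
Context {R : realType} {X : pmetricType R}.
Hypothesis cX : compact [set: X].
Variable f : X -> X.
Hypotheses (cf : continuous f) (lf : locally_injective f).
Variables (mu : probability (borel X) R) (J : borel X -> R).
Hypothesis Smu : invariant_measure (f : borel X -> borel X) mu.
Hypothesis HJ : is_jacobian f mu J.
Variable k : R.-pker (borel X) ~> (borel X).
Hypothesis Hk : fiber_disintegration f mu k.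

Let mf : measurable_fun setT (f : borel X -> borel X).
Proof. exact: continuous_borel. Qed.

Let mJ : measurable_fun setT J. Proof. by have [] := HJ. Qed.

Let kf (x : borel X) : {measure set (borel X) -> \bar R} := k (f x).

Let mkf U : measurable U -> measurable_fun setT (kf ^~ U).
Proof.
move=> mU; have := measurable_kernel k _ mU => mk.
exact: (measurableT_comp mk mf).
Qed.

Let kfm A : measurable A -> mu A = (\int[mu]_x kf x A)%E.
Proof. by have [_] := Hk; exact. Qed.

Lemma measurable_singleton (x : X) : measurable ([set x] : set (borel X)).
Proof.
by apply: closed_borel; apply: accessible_closed_set1;
  exact/hausdorff_accessible/metric_hausdorff.
Qed.

Let mfib (x : X) : measurable (f @^-1` [set x] : set (borel X)).
Proof. exact: (measurable_preimage mf (measurable_singleton x)). Qed.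

Lemma kernel_fiberI (x : X) (A : set (borel X)) : measurable A ->
  k (f x) (f @^-1` [set f x]) = 1%E -> k (f x) A = k (f x) (A `&` f @^-1` [set f x]).
Proof.
move=> mA k1; have mI := measurableI _ _ mA (mfib (f x)).
have : kf x A = (kf x (A `&` f @^-1` [set f x]) + kf x (A `\` f @^-1` [set f x]))%E.
  rewrite -measureU//; first by rewrite setUIDK.
    exact: (@measurableD _ (borel X)).
  by rewrite -subset0 => z [[_ fz] [_ /(_ fz)]].
rewrite /kf => ->; rewrite [X in (_ + X)%E](_ : _ = 0%E) ?adde0//.
apply/eqP; rewrite eq_le measure_ge0 andbT.
have mD : measurable (A `\` f @^-1` [set f x]) by exact: (@measurableD _ (borel X)).
have mC : measurable (~` (f @^-1` [set f x]) : set (borel X)).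
  exact: (@measurableC _ (borel X)).
have le : (kf x (A `\` f @^-1` [set f x]) <= kf x (~` (f @^-1` [set f x])))%E.
  by apply: le_measure; rewrite ?inE// => z [].
apply: (le_trans le).
have : (1 = 1 + kf x (~` (f @^-1` [set f x])))%E.
  rewrite -[X in (_ = X + _)%E]k1 -/(kf x) -measureU//; last exact: setICr.
  by rewrite setUv; apply/esym; exact: prob_kernel.
case: (kf x _) (measure_ge0 (kf x) (~` (f @^-1` [set f x]))) => [r| |]//=.
by move=> _ /(congr1 fine) /= r0; rewrite lee_fin; lra.
Qed.

Section injective_piece.
Variable A : set (borel X).
Hypotheses (mA : measurable A) (fA : {in A &, injective f}).

Let phi x := fine (kf x A).

Let kfE x B : measurable B -> kf x B = (fine (kf x B))%:E.
Proof.
move=> mB; rewrite fineK// ge0_fin_numE// (@le_lt_trans _ _ 1%E) ?ltry//.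
by rewrite -(prob_kernel (s := k) (f x)); apply: le_measure; rewrite ?inE.
Qed.

Let phi0 x : 0 <= phi x. Proof. by rewrite fine_ge0. Qed.

Let mphi : measurable_fun setT phi.
Proof. by apply/measurable_EFinP; rewrite (_ : EFin \o phi = kf ^~ A);
  [exact: mkf|apply/funext => x; rewrite /phi /= -kfE]. Qed.

(** A fibre meets [A] in at most one point, and it meets [N] in the same point or not at all. *)
Let kf_sub x N : k (f x) (f @^-1` [set f x]) = 1%E -> measurable N -> N `<=` A ->
  ((f @` N) (f x) -> kf x N = (phi x)%:E) /\ (~ (f @` N) (f x) -> kf x N = 0%E).
Proof.
move=> k1 mN NA; rewrite /phi -kfE// /kf (kernel_fiberI mA k1) (kernel_fiberI mN k1); split.
  move=> [y Ny fy]; congr (k (f x) _); apply/seteqP; split => z [Az /= fz].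
    by split => //; exact: NA.
  by split => //; rewrite -(fA (x := y) (y := z)) ?inE//; [exact: NA|rewrite fy].
move=> nN; rewrite (_ : _ `&` _ = set0) ?measure0// -subset0 => z [Nz /= fz].
by apply: nN; exists z.
Qed.

Let integral_indic_preimage (s : R) (N : set (borel X)) : measurable N -> 0 <= s ->
  (\int[mu]_x (s%:E * (\1_(f @^-1` (f @` N)) x)%:E) = (s * prob mu (f @` N))%:E)%E.
Proof.
move=> mN s0; have mfN := measurable_image cX cf lf mN.
have mp := measurable_preimage mf mfN.
rewrite ge0_integralZl//.
- rewrite integral_indic// setIT EFinM; congr (_ * _)%E.
  by rewrite -probE//; exact: Smu.
- by apply/measurable_EFinP; exact: measurable_indic.
Qed.

(** By disintegration mu N is the integral of [phi] over the preimage of f N, whose measure is mu (f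
    N). As [phi] is constant on fibres, its bound on [N] holds on this whole preimage. *)
Let mixture_ge s N : 0 <= s -> measurable N -> N `<=` A ->
  (forall x, N x -> s <= phi x) -> s * prob mu (f @` N) <= prob mu N.
Proof.
move=> s0 mN NA sphi; have mfN := measurable_image cX cf lf mN.
have mp := measurable_preimage mf mfN.
rewrite -lee_fin -[leRHS]probE// kfm// -integral_indic_preimage//.
apply: ae_ge0_le_integral => //.
- by move=> x _; rewrite mule_ge0// lee_fin.
- by apply: measurable_funeM; apply/measurable_EFinP; exact: measurable_indic.
- exact: mkf.
have [k1 _] := Hk; apply: (@filterS _ _ (ae_filter_ringOfSetsType mu) _ _ _ k1) => x {}k1 _.
have [h1 h2] := kf_sub k1 mN NA; rewrite indicE.
have [fx|nfx] := pselect ((f @` N) (f x)).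
  rewrite mem_set// mule1 h1// lee_fin; have [y Ny fy] := fx.
  by rewrite /phi /kf -fy; exact: sphi.
by rewrite memNset// mule0.
Qed.

Let mixture_le s N : 0 <= s -> measurable N -> N `<=` A ->
  (forall x, N x -> phi x <= s) -> prob mu N <= s * prob mu (f @` N).
Proof.
move=> s0 mN NA sphi; have mfN := measurable_image cX cf lf mN.
have mp := measurable_preimage mf mfN.
rewrite -lee_fin -[leLHS]probE// kfm// -integral_indic_preimage//.
apply: ae_ge0_le_integral => //.
- exact: mkf.
- by move=> x _; rewrite mule_ge0// lee_fin.
- by apply: measurable_funeM; apply/measurable_EFinP; exact: measurable_indic.
have [k1 _] := Hk; apply: (@filterS _ _ (ae_filter_ringOfSetsType mu) _ _ _ k1) => x {}k1 _.
have [h1 h2] := kf_sub k1 mN NA; rewrite indicE.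
have [fx|nfx] := pselect ((f @` N) (f x)).
  rewrite mem_set// mule1 h1// lee_fin; have [y Ny fy] := fx.
  by rewrite /phi /kf -fy; exact: sphi.
by rewrite memNset// mule0 h2.
Qed.

Let mlev (g : borel X -> R) (i : interval R) : measurable_fun setT g ->
  measurable (g @^-1` [set` i]).
Proof. by move=> mg; rewrite -[X in measurable X]setTI; apply: mg => //; exact: measurable_itv. Qed.

(** If phi <= s and J <= t on [N], then mu N <= s mu (f N) <= s t mu N, so [N] is null when s t < 1;
    likewise with the inequalities reversed. Countably many such sets, with [s] and [t] rational,
    cover the points where phi J differs from 1. *)
Lemma ae_kernel_piece : \forall x \ae mu, A x -> fine (kf x A) * J x = 1.
Proof.
have Q (p : rat * rat) : \forall x \ae mu, A x ->
    ~ (0 <= ratr p.1 :> R /\ 0 <= ratr p.2 :> R /\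
       (ratr p.1 <= phi x /\ ratr p.2 <= J x /\ 1 < ratr p.1 * ratr p.2 :> R \/
       phi x <= ratr p.1 /\ J x <= ratr p.2 /\ ratr p.1 * ratr p.2 < 1 :> R)).
  have [[s0 t0]|n0] := pselect (0 <= ratr p.1 :> R /\ 0 <= ratr p.2 :> R); last first.
    by apply: aeW => x _ [? [? _]]; apply: n0.
  move: s0 t0; set s : R := ratr p.1; set t : R := ratr p.2 => s0 t0.
  have [st|st|st] := ltgtP (s * t) 1.
  - pose N := A `&` (phi @^-1` [set` `]-oo, s]] `&` J @^-1` [set` `]-oo, t]]).
    have mN : measurable N.
      by apply: measurableI => //; apply: measurableI; exact: mlev.
    have N0 : mu N = 0%E.
      rewrite probE//; congr EFin; apply/eqP; rewrite eq_le prob_ge0 andbT.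
      have h1 : prob mu N <= s * prob mu (f @` N).
        apply: mixture_le => //; first by move=> x [].
        by move=> x [_ [/=]]; rewrite in_itv.
      have h2 : prob mu (f @` N) <= t * prob mu N.
        apply: (prob_image_le cX cf lf HJ) => //; apply: aeW => x [_ [_ /=]].
        by rewrite in_itv.
      have := ler_wpM2l s0 h2; have st' : 0 < 1 - s * t by rewrite subr_gt0.
      by move=> h3; rewrite -(pmulr_rle0 _ st') mulrBl mul1r; lra.
    exists N; split => // x /= /not_implyP[Ax /contrapT[_ [_ [[_ [_]]|[h1 [h2 _]]]]]].
      by [].
    by split => //; split; rewrite /= in_itv.
  - pose N := A `&` (phi @^-1` [set` `[s, +oo[] `&` J @^-1` [set` `[t, +oo[]).
    have mN : measurable N.
      by apply: measurableI => //; apply: measurableI; exact: mlev.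
    have N0 : mu N = 0%E.
      rewrite probE//; congr EFin; apply/eqP; rewrite eq_le prob_ge0 andbT.
      have h1 : s * prob mu (f @` N) <= prob mu N.
        apply: mixture_ge => //; first by move=> x [].
        by move=> x [_ [/=]]; rewrite in_itv/= andbT.
      have h2 : t * prob mu N <= prob mu (f @` N).
        apply: (prob_image_ge cX cf lf HJ) => //.
          by move=> x [_ [_ /=]]; rewrite in_itv/= andbT.
        by move=> x y; rewrite !inE => -[Ax _] [Ay _]; apply: fA; rewrite inE.
      have := ler_wpM2l s0 h2; have st' : 0 < s * t - 1 by rewrite subr_gt0.
      by move=> h3; rewrite -(pmulr_rle0 _ st') mulrBl mul1r; lra.
    exists N; split => // x /= /not_implyP[Ax /contrapT[_ [_ [[h1 [h2 _]]|[_ [_]]]]]].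
      by split => //; split; rewrite /= in_itv/= andbT.
    by [].
  - by apply: aeW => x Ax [_ [_ [[_ [_ //]]|[_ [_ //]]]]].
have J1 := jacobian_ge1 cX cf lf Smu HJ.
have := ae_forall_countable Q; move: J1; apply: filterS2 => x J1 h Ax.
have J0 : 0 < J x by exact: lt_le_trans J1.
apply/eqP; case: (ltgtP (phi x * J x) 1) => // hlt; exfalso.
- have : phi x < (J x)^-1 by rewrite -ltr_pdivlMr ?div1r in hlt.
  move=> /rat_in_itvoo[p]; rewrite in_itv/= => /andP[p1 p2].
  have p0 : 0 < ratr p :> R by exact: le_lt_trans p1.
  have : J x < (ratr p)^-1 by rewrite -[J x]invrK ltf_pV2 ?posrE ?invr_gt0.
  move=> /rat_in_itvoo[q]; rewrite in_itv/= => /andP[q1 q2].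
  apply: (h (p, q) Ax) => /=; split; first exact: ltW.
  split; first by rewrite ltW// (lt_trans J0).
  right; split; first exact: ltW. split; first exact: ltW.
  by rewrite mulrC -ltr_pdivlMr// div1r.
- have : (J x)^-1 < phi x by rewrite -ltr_pdivrMr ?div1r in hlt.
  move=> /rat_in_itvoo[p]; rewrite in_itv/= => /andP[p1 p2].
  have p0 : 0 < ratr p :> R by rewrite (lt_trans _ p1)// invr_gt0.
  have : (ratr p)^-1 < J x by rewrite -[J x]invrK ltf_pV2 ?posrE ?invr_gt0.
  move=> /rat_in_itvoo[q]; rewrite in_itv/= => /andP[q1 q2].
  apply: (h (p, q) Ax) => /=; split; first exact: ltW.
  split; first by rewrite ltW// (lt_trans _ q1)// invr_gt0.
  left; split; first exact: ltW. split; first exact: ltW.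
  by rewrite mulrC -ltr_pdivrMr// div1r.
Qed.

End injective_piece.

(** The fibre of [x] meets the piece [A i] that contains [x] in [x] alone. *)
Lemma ae_kernel_singleton : \forall x \ae mu, k (f x) [set x] = ((J x)^-1)%:E.
Proof.
have [_ [A [mA tA UA fA _]]] := HJ.
have h : \forall x \ae mu, forall i, A i x -> fine (kf x (A i)) * J x = 1.
  by apply: ae_foralln => i; exact: ae_kernel_piece.
have [k1 _] := Hk; move: k1; apply: filterS2 h => x h k1.
have [i _ Ax] : (\bigcup_i A i) x by rewrite UA.
have E : k (f x) [set x] = kf x (A i).
  rewrite /kf (kernel_fiberI (mA i) k1); congr (k (f x) _).
  apply/seteqP; split => z /=; first by move=> ->.
  by move=> [Az fz]; apply: (fA i) => //; rewrite inE.
have h1 := h i Ax; rewrite E.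
have : kf x (A i) \is a fin_num.
  rewrite ge0_fin_numE// (@le_lt_trans _ _ 1%E) ?ltry//.
  by rewrite -(prob_kernel (s := k) (f x)); apply: le_measure; rewrite ?inE//; exact: mA.
move=> /fineK <-; congr EFin; have J0 : J x != 0.
  by apply/eqP => J0; move: h1; rewrite J0 mulr0 => /eqP; rewrite eq_sym oner_eq0.
by rewrite -[LHS]mulr1 -(divff J0) mulrA h1 mul1r.
Qed.

(** On the fibre through [x] a point [y] has conditional measure 1 / J y, so the inner integral is
    that of ln J; integrating over [x] undoes the disintegration. *)
Lemma folding_entropyE :
  (folding_entropy f mu k = \int[mu]_x (ln (J x))%:E)%E.
Proof.
(* The maximum makes the integrand nonnegative everywhere and alters it on a null set only. *)
pose g x : \bar R := (ln (Num.max 1 (J x)))%:E.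
have mg : measurable_fun setT g.
  apply/measurable_EFinP; apply: measurableT_comp; first exact: measurable_ln.
  by apply: measurable_maxr.
have g0 x : (0 <= g x)%E by rewrite lee_fin ln_ge0// le_max lexx.
have J1 := jacobian_ge1 cX cf lf Smu HJ.
have k1 := ae_kernel_singleton.
have : \forall x \ae mu, 1 <= J x /\ k (f x) [set x] = ((J x)^-1)%:E.
  by apply: filterS2 J1 k1.
move=> [N [mN N0 NE]].
have NE' x : ~ N x -> 1 <= J x /\ k (f x) [set x] = ((J x)^-1)%:E.
  by move=> nx; apply: contrapT => nP; apply: nx; exact: NE.
have inner : \forall x \ae mu,
    (\int[k (f x)]_y (- lne (k (f x) [set y])) = \int[kf x]_y g y)%E.
  (* The exceptional set [N] is null for almost every conditional measure as well. *)
  have kN := mixture_null mkf kfm mN N0.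
  have [kx _] := Hk; move: kx; apply: filterS2 kN => x kN kx.
  pose M := N `|` ~` (f @^-1` [set f x]).
  have mC : measurable (~` (f @^-1` [set f x]) : set (borel X)).
    exact: (@measurableC _ (borel X)).
  have mM : measurable M by exact: measurableU.
  apply: (@integral_eq_off_null _ _ _ (kf x) M setT _ _ mM).
    rewrite /kf (kernel_fiberI mM kx).
    rewrite (_ : _ `&` _ = N `&` f @^-1` [set f x]); last first.
      by apply/seteqP; split => z [] => [[]|] // Nz fz; split => //; left.
    apply/eqP; rewrite eq_le measure_ge0 andbT -kN.
    by apply: le_measure; rewrite ?inE//; first [exact: measurableI|exact: subIsetl].
  move=> y _ nM; have nNy : ~ N y by move=> Ny; apply: nM; left.
  have fy : f y = f x by apply: contrapT => fy; apply: nM; right.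
  have [Jy] := NE' y nNy; rewrite -fy => ->; have J0 : 0 < J y by exact: lt_le_trans Jy.
  by rewrite lneV// oppeK lne_EFin// /g (max_idPr Jy).
have [N2 [mN2 N20 N2E]] := inner.
rewrite /folding_entropy (@integral_eq_off_null _ _ _ mu N2 setT _
  (fun x => \int[kf x]_y g y)%E mN2 N20); last first.
  by move=> x _ nx; apply: contrapT => nP; apply: nx; exact: N2E.
rewrite (ge0_integral_mixture mkf kfm g0 mg).
apply: (@integral_eq_off_null _ _ _ mu N setT _ _ mN N0) => x _ /NE'[Jx _].
by rewrite /g (max_idPr Jx).
Qed.

End folding.

(** * The natural extension *)

Section pasts_space.
Context {R : realType} {X : pmetricType R}.

(** The inverse of [lift_map] on the inverse limit: along its orbits the zeroth coordinate runs
    through x_0, x_-1, x_-2, ... *)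
Definition shift (x : pasts X) : pasts X := fun i => x i.+1.

Lemma iter_shift n (x : pasts X) i : iter n shift x i = x (n + i)%N.
Proof. by elim: n i => [//|n IH] i; rewrite iterS /shift IH addnS. Qed.

Lemma coordinate_continuous i : continuous (fun x : pasts X => x i).
Proof. exact: (@proj_continuous nat (fun=> X) i). Qed.

Lemma shift_continuous : continuous shift.
Proof.
move=> x; apply/cvg_sup => i; apply/cvg_image.
  by apply/seteqP; split => // y _; exists (fun=> y).
move=> V nV; exists ((fun z : pasts X => z i) @^-1` V).
  exact: (@coordinate_continuous i.+1 x V nV).
apply/seteqP; split => [_ [z Vz <-]//|y Vy]; exists (fun=> y) => //.
Qed.

Lemma measurable_shift : measurable_fun setT (shift : borel (pasts X) -> borel (pasts X)).
Proof. by apply: continuous_borel; exact: shift_continuous. Qed.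

Lemma measurable_coordinate i :
  measurable_fun setT ((fun x => x i) : borel (pasts X) -> borel X).
Proof. by apply: continuous_borel; exact: coordinate_continuous. Qed.

Lemma measurable_coordinate_preimage i (A : set (borel X)) : measurable A ->
  measurable ([set x | A (x i)] : set (borel (pasts X))).
Proof.
move=> mA; have := measurable_coordinate i measurableT mA.
by rewrite setTI.
Qed.

Hypothesis cX : compact [set: X].
Variable f : X -> X.
Hypothesis cf : continuous f.

Lemma closed_inverse_limit : closed (inverse_limit f).
Proof.
have -> : inverse_limit f = \bigcap_i [set x : pasts X | f (x i.+1) = x i].
  by apply/seteqP; split => x h; [move=> i _; exact: h|move=> i; exact: h].
apply: closed_bigI => i _ x clx.
apply: (@metric_hausdorff R X) => A B nA nB.
have cA : nbhs x [set y : pasts X | A (f (y i.+1))].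
  have c : {for x, continuous (f \o (fun y : pasts X => y i.+1))}.
    apply: continuous_comp; [exact: coordinate_continuous|exact: cf].
  exact: c nA.
have cB : nbhs x [set y : pasts X | B (y i)].
  exact: (coordinate_continuous nB).
have [y [/= fy [Ay By]]] := clx _ (filterI cA cB).
by exists (y i); split => //; rewrite -fy.
Qed.

Lemma compact_pasts : compact [set: pasts X].
Proof.
have := @tychonoff nat (fun=> X) (fun=> setT) (fun=> cX).
by congr compact; apply/seteqP; split.
Qed.

Lemma measurable_inverse_limit : measurable (inverse_limit f : set (borel (pasts X))).
Proof. by apply: closed_borel; exact: closed_inverse_limit. Qed.

(** The points with an infinite past. As [f] is not assumed surjective, inverse balls and atoms are
    images of subsets of [core], which is closed, hence Borel, and has full measure. *)
Definition core : set X := (fun x : pasts X => x 0%N) @` inverse_limit f.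

Lemma closed_core : closed core.
Proof.
apply: compact_closed; first exact: metric_hausdorff.
apply: continuous_compact.
  by apply: continuous_subspaceT; exact: coordinate_continuous.
exact: subclosed_compact closed_inverse_limit compact_pasts _.
Qed.

Lemma iter_inverse_limit (x : pasts X) n i : inverse_limit f x ->
  iter n f (x (n + i)%N) = x i.
Proof.
by move=> ilx; elim: n i => [//|n IH] i; rewrite iterSr addSn ilx IH.
Qed.

Variables (mu : probability (borel X) R) (muhat : probability (borel (pasts X)) R).
Hypothesis Hm : inverse_limit_measure f mu muhat.

Local Notation sh := (shift : borel (pasts X) -> borel (pasts X)).

Let lift_measurable_set (A : set (borel (pasts X))) : measurable A ->
  measurable (sh @^-1` A).
Proof. exact: (measurable_preimage measurable_shift). Qed.

(** On all sequences [shift] after [lift_map] is the identity; this passes invariance, and below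
    ergodicity, from [lift_map] to [shift]. *)
Lemma shift_invariant : invariant_measure sh muhat.
Proof.
move=> A mA; have [_ inv _ _] := Hm.
by rewrite -[LHS]inv//; exact: lift_measurable_set.
Qed.

Lemma shift_ergodic : ergodic_measure sh muhat.
Proof.
move=> A mA shA; have [_ _ erg _] := Hm; apply: erg => //.
by rewrite -[in LHS]shA.
Qed.

Lemma ae_inverse_limit : \forall x \ae muhat, inverse_limit f x.
Proof.
have [m1 _ _ _] := Hm; have mI := measurable_inverse_limit.
exists (~` inverse_limit f); split => //; first exact: (@measurableC _ (borel (pasts X))).
have := probability_setC muhat mI; rewrite (_ : muhat (inverse_limit f) = 1%E)//.
by move=> ->; rewrite subee.
Qed.

Lemma coordinate_law i (A : set (borel X)) : measurable A ->
  prob muhat [set x | A (x i)] = prob mu A.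
Proof.
move=> mA; have [_ _ _ law] := Hm; rewrite /prob -law//; congr fine.
have := measure_iter_preimage measurable_shift shift_invariant i
  (measurable_coordinate_preimage 0 mA).
by move=> <-; congr (muhat _); apply/seteqP; split => x /=; rewrite iter_shift addn0.
Qed.

Lemma ae_coordinate (Q : X -> Prop) : (\forall x \ae mu, Q x) ->
  \forall x \ae muhat, forall i, Q (x i).
Proof.
move=> [N [mN N0 NQ]]; apply: ae_foralln => i.
exists [set x | N (x i)]; split.
- exact: measurable_coordinate_preimage.
- have E : prob muhat [set x | N (x i)] = 0 by rewrite coordinate_law// /prob N0.
  exact: (etrans (probE muhat (measurable_coordinate_preimage i mN)) (congr1 EFin E)).
- by move=> x /= nQ; apply: NQ.
Qed.

Lemma prob_inverse_limitI B : measurable B ->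
  prob muhat B = prob muhat (B `&` inverse_limit f).
Proof.
move=> mB; have mI := measurable_inverse_limit.
have mCI : measurable (~` inverse_limit f : set (borel (pasts X))).
  exact: (@measurableC _ (borel (pasts X))).
have I0 : prob muhat (~` inverse_limit f) = 0.
  have [m1' _ _ _] := Hm; rewrite /prob (probability_setC muhat mI).
  by rewrite (_ : muhat (inverse_limit f) = 1%E)// subee.
have D0 : prob muhat (B `\` inverse_limit f) = 0.
  apply/eqP; rewrite eq_le prob_ge0 andbT -I0; apply: prob_le => //.
  exact: (@measurableD _ (borel (pasts X))).
by rewrite (prob_splitI muhat mB mI) D0 addr0.
Qed.

(** On the inverse limit x_-i is the image of x_-n under f^(n-i), and x_-n has law [mu]. *)
Lemma past_law n (A : nat -> set (borel X)) :
  (forall i, measurable (A i)) ->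
  prob muhat [set x | forall i, (i <= n)%N -> A i (x i)] =
  prob mu [set z | forall i, (i <= n)%N -> A i (iter (n - i) f z)].
Proof.
move=> mA; have mf : measurable_fun setT (f : borel X -> borel X).
  exact: continuous_borel.
have bigE (T : Type) (B : nat -> set T) :
    [set x | forall i, (i <= n)%N -> B i x] = \bigcap_(i in [set i | (i <= n)%N]) B i.
  by [].
have m1 : measurable ([set x | forall i, (i <= n)%N -> A i (x i)] : set (borel (pasts X))).
  rewrite (bigE _ (fun i x => A i (x i))).
  by apply: bigcap_measurable => [|i _]; [exists 0%N|exact: measurable_coordinate_preimage].
have m2 : measurable ([set z | forall i, (i <= n)%N -> A i (iter (n - i) f z)] : set (borel X)).
  rewrite (bigE _ (fun i z => A i (iter (n - i) f z))).
  apply: bigcap_measurable => [|i _]; first by exists 0%N.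
  by rewrite -[X in measurable X]setTI; exact: (measurable_iter mf).
rewrite -(coordinate_law n m2).
have mc := measurable_coordinate_preimage n m2.
have E : [set x | forall i, (i <= n)%N -> A i (x i)] `&` inverse_limit f =
    [set x | forall i, (i <= n)%N -> A i (iter (n - i) f (x n))] `&` inverse_limit f.
  apply/seteqP; split => x [h ilx]; split => // i ni; have := h i ni;
    by have := iter_inverse_limit (n - i) i ilx; rewrite subnK// => ->.
by rewrite (prob_inverse_limitI m1) E -(prob_inverse_limitI mc).
Qed.

Lemma prob_core : prob mu core = 1.
Proof.
have mc : measurable (core : set (borel X)) by apply: closed_borel; exact: closed_core.
apply/eqP; rewrite eq_le prob_le1//= -(coordinate_law 0 mc).
have [m1 _ _ _] := Hm; rewrite -[X in X <= _]/(fine 1%E) -m1.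
apply: prob_le; [exact: measurable_inverse_limit|exact: measurable_coordinate_preimage|].
by move=> x ilx; exists x.
Qed.

Section hat_labels.
Variables (C : countType) (l : borel X -> C).
Hypothesis ml : forall a, measurable (l @^-1` [set a]).

Definition hat (x : borel (pasts X)) : C := l (x 0%N).

Lemma measurable_hat a : measurable (hat @^-1` [set a]).
Proof. exact: (measurable_coordinate_preimage 0 (ml a)). Qed.

(** Both words list the labels of x_0, ..., x_-n, in opposite orders; [n] steps join [n.+1]
    points. *)
Lemma word_hatE n (x : pasts X) : inverse_limit f x ->
  word sh hat n.+1 x = rev (word (f : borel X -> borel X) l n.+1 (x n)).
Proof.
move=> ilx; pose c := l point.
apply: (@eq_from_nth _ c); first by rewrite size_rev !size_word.
move=> i; rewrite size_word => ni.
rewrite nth_rev size_word// subSS !word_nth// ?ltnS ?leq_subr//.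
rewrite /hat iter_shift addn0 -{1}(iter_inverse_limit (n - i) i ilx) subnK//.
Qed.

Lemma pw_hat (w : seq C) : pw muhat sh hat w = pw mu (f : borel X -> borel X) l (rev w).
Proof.
(* The empty word is treated apart, since [word_hatE] concerns positive lengths. *)
case/lastP: w => [|w a]; first by rewrite !pw_nil.
have mf : measurable_fun setT (f : borel X -> borel X).
  exact: continuous_borel.
rewrite /pw; have sw : size (rcons w a) = (size w).+1 by rewrite size_rcons.
rewrite -(coordinate_law (size w)); last exact: measurable_cyl.
have m1 := measurable_cyl measurable_shift measurable_hat (rcons w a).
have m2 := measurable_coordinate_preimage (size w) (measurable_cyl mf ml (rev (rcons w a))).
rewrite (prob_inverse_limitI m1) (prob_inverse_limitI m2); congr prob.
apply/seteqP; split => x [+ ilx]; rewrite /cyl /= size_rev sw => h; split => //.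
  by rewrite -h (word_hatE _ ilx) revK.
by rewrite (word_hatE _ ilx) [X in rev X]h revK.
Qed.

End hat_labels.

Lemma block_entropy_hat (C : finType) (l : borel X -> C) n :
  (forall a, measurable (l @^-1` [set a])) ->
  block_entropy muhat sh (hat l) n = block_entropy mu (f : borel X -> borel X) l n.
Proof.
move=> ml; rewrite /block_entropy.
under eq_bigr do rewrite (pw_hat ml).
have -> : \sum_(w <- allwords (enum C) n)
    - ln (pw mu f l (rev w)) * pw mu f l (rev w) =
  \sum_(w <- map rev (allwords (enum C) n)) - ln (pw mu f l w) * pw mu f l w.
  by rewrite big_map.
apply: perm_big; apply: uniq_perm.
- by rewrite map_inj_uniq ?uniq_allwords ?enum_uniq//; exact: (can_inj revK).
- by apply: uniq_allwords; exact: enum_uniq.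
- move=> w; apply/mapP/idP => [[v + ->]|].
    by rewrite !mem_allwords size_rev all_rev.
  move=> wn; exists (rev w); last by rewrite revK.
  by move: wn; rewrite !mem_allwords size_rev all_rev.
Qed.

End pasts_space.

(** * Partitions and labels *)

Section entropy_of_labels.
Context {R : realType} d (T : measurableType d) (m : probability T R).
Variable S : T -> T.
Hypotheses (mS : measurable_fun setT S) (Sm : invariant_measure S m).
Hypothesis eS : ergodic_measure S m.

Lemma joined_word (C : countType) (l : T -> C) (P : T -> set T) n x :
  (forall x y, P x y <-> l x = l y) ->
  joined S P n x = cyl S l (word S l n x).
Proof.
move=> Pl; rewrite cyl_word /joined; apply/seteqP; split => y /= h.
  apply: (@eq_from_nth _ (l point)); rewrite !size_word// => i ni.
  by rewrite !word_nth//; apply/esym/Pl; exact: h.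
move=> i ni; apply/Pl; rewrite -(word_nth _ _ _ (l point) ni) -h word_nth//.
Qed.

Section finite_label.
Variables (C : finType) (l : T -> C) (P : T -> set T).
Hypothesis ml : forall a, measurable (l @^-1` [set a]).
Hypothesis Pl : forall x y, P x y <-> l x = l y.

(** Cylinders of measure zero, where the information is +oo while [ln] stays real, are met on a null
    set only. *)
Lemma partition_entropy_joined n :
  partition_entropy m (joined S P n) = (block_entropy m S l n)%:E.
Proof.
have [N [mN N0 NE]] := ae_pw_gt0 m mS ml.
rewrite /partition_entropy (@integral_eq_off_null _ _ _ m N setT _
  (fun x => (- ln (pw m S l (word S l n x)))%:E) mN N0); last first.
  move=> x _ Nx; have px : forall k, 0 < pw m S l (word S l k x).
    by apply: contrapT => h; apply: Nx; exact: NE.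
  rewrite (joined_word _ _ Pl).
  have -> : m (cyl S l (word S l n x)) = (pw m S l (word S l n x))%:E.
    by apply: probE; exact: measurable_cyl.
  by rewrite lne_EFin.
by rewrite (integral_word m mS ml (fun w => - ln (pw m S l w))).
Qed.

Lemma entropy_along_joined :
  entropy_along S m P = (block_entropy_rate m S l)%:E.
Proof.
rewrite /entropy_along; under eq_fun do rewrite partition_entropy_joined -EFinM.
apply/cvg_lim => //; apply: cvg_EFin; first exact: nearW.
exact: cvg_block_entropy.
Qed.

End finite_label.

Lemma label_partition (C : finType) (l : T -> C) :
  (forall a, measurable (l @^-1` [set a])) ->
  finite_measurable_partition (fun x => [set y | l y = l x]).
Proof.
move=> ml; split.
- by split => // x y /= ->.
- by move=> x; exact: ml.
- apply: (@sub_finite_set _ _ ((fun a => [set y | l y = a]) @` [set: C])).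
    by move=> _ [x _ <-]; exists (l x).
  by apply: finite_image; exact: finite_finset.
Qed.

Lemma partition_label (P : T -> set T) : finite_measurable_partition P ->
  exists (C : finType) (l : T -> C), (forall a, measurable (l @^-1` [set a])) /\
    forall x y, P x y <-> l x = l y.
Proof.
move=> [[Px PE] mP /finite_seqP[s sE]].
have Ps x : P x \in s by have : [set` s] (P x) by rewrite -sE; exists x.
have inj x y : inord (index (P x) s) = inord (index (P y) s) :> 'I_(size s).+1 -> P x = P y.
  move=> /(congr1 val) /=; rewrite !inordK ?ltnS ?index_size// => e.
  by rewrite -(nth_index set0 (Ps x)) e nth_index.
exists 'I_(size s).+1, (fun x => inord (index (P x) s)); split => [a|x y].
  have [[x xa]|nx] := pselect (exists x, inord (index (P x) s) = a).
    rewrite (_ : _ @^-1` _ = P x) //; apply/seteqP; split => y /=.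
      by rewrite -xa => /inj <-.
    by move=> /PE; rewrite -xa => ->.
  rewrite (_ : _ @^-1` _ = set0)// -subset0 => x /= xa; apply: nx.
  by exists x.
by split => [/PE ->//|/inj ->].
Qed.

Hypothesis hfin : (measure_entropy S m < +oo)%E.

Let rate_le_sup (C : finType) (l : T -> C) : (forall a, measurable (l @^-1` [set a])) ->
  ((block_entropy_rate m S l)%:E <= measure_entropy S m)%E.
Proof.
move=> ml; apply: ereal_sup_ubound; exists (fun x => [set y | l y = l x]).
  exact: label_partition.
by apply: entropy_along_joined => //; split => ->.
Qed.

Lemma measure_entropy_fin_num : measure_entropy S m \is a fin_num.
Proof.
rewrite ge0_fin_numE//.
have mu : forall a : unit, measurable ((fun _ : T => tt) @^-1` [set a]).
  by case; rewrite (_ : _ @^-1` _ = setT)//; apply/seteqP; split.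
apply: le_trans (rate_le_sup mu); rewrite lee_fin; exact: block_entropy_rate_ge0.
Qed.

Lemma block_entropy_rate_le_entropy (C : finType) (l : T -> C) :
  (forall a, measurable (l @^-1` [set a])) ->
  block_entropy_rate m S l <= fine (measure_entropy S m).
Proof.
move=> ml; rewrite -lee_fin fineK ?measure_entropy_fin_num//.
exact: rate_le_sup.
Qed.

Lemma block_entropy_rate_gt_entropy (e : R) : 0 < e ->
  exists (C : finType) (l : T -> C), (forall a, measurable (l @^-1` [set a])) /\
    fine (measure_entropy S m) - e < block_entropy_rate m S l.
Proof.
move=> e0; have := ub_ereal_sup_adherent e0 measure_entropy_fin_num.
move=> [_ [P /[dup] fP /partition_label[C [l [ml Pl]]] <-]].
rewrite (entropy_along_joined ml Pl) => h; exists C, l; split => //.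
by rewrite -lte_fin EFinB fineK// measure_entropy_fin_num.
Qed.

End entropy_of_labels.

Section countable_partitions.
Context {R : realType} d (T : measurableType d) (m : probability T R).
Variable P : T -> set T.
Hypothesis HP : measurable_partition P.
Hypothesis fP : (partition_entropy m P < +oo)%E.

Lemma measurable_partition_atom x : measurable (P x).
Proof.
have [B mB PE] := HP; rewrite PE.
rewrite (_ : mkset _ = \bigcap_k (if `[< B k x >] then B k else ~` B k)).
  by apply: bigcapT_measurable => k; case: ifP => // _; exact: measurableC.
apply/seteqP; split => y h k.
  by move=> _; case: asboolP => Bx; [exact/(h k)|move=> By; apply: Bx; exact/(h k)].
have := h k I; case: asboolP => Bx By; split=> //.
Qed.

Lemma measurable_partition_eq x y : P x y -> P x = P y.
Proof.
have [B mB PE] := HP; rewrite !PE => /= xy; apply/seteqP; split => z /= h k.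
  by split => ?; [exact/h/xy|exact/xy/h].
by split => ?; [exact/h/xy|exact/xy/h].
Qed.

Lemma measurable_partition_refl x : P x x.
Proof. by have [B mB PE] := HP; rewrite PE. Qed.

Let mfiber C : measurable (P @^-1` [set C]).
Proof.
have [[x xC]|nx] := pselect (exists x, P x = C).
  rewrite (_ : _ @^-1` _ = P x); first exact: measurable_partition_atom.
  apply/seteqP; split => y /=.
    by rewrite -xC => <-; exact: measurable_partition_refl.
  by move=> /measurable_partition_eq <-.
by rewrite (_ : _ @^-1` _ = set0)// -subset0 => x /= xC; apply: nx; exists x.
Qed.

Let fiberE x : P @^-1` [set P x] = P x.
Proof.
apply/seteqP; split => y /=; first by move=> <-; exact: measurable_partition_refl.
by move=> /measurable_partition_eq ->.
Qed.

(** Fewer than n + 2 disjoint atoms can have measure above 1/(n+1). *)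
Lemma countable_positive_atoms : countable [set C | range P C /\ 0 < prob m C].
Proof.
rewrite (_ : mkset _ = \bigcup_(n in [set: nat])
    [set C | range P C /\ n.+1%:R^-1 < prob m C]); last first.
  apply/seteqP; split => [C [PC C0]|C [n _ [PC Cn]]].
    exists (Num.bound (prob m C)^-1) => //; split => //.
    rewrite -[ltRHS]invrK ltf_pV2 ?posrE ?invr_gt0//.
    rewrite (lt_trans (archi_boundP _)) ?ltr_nat// invr_ge0 ltW//.
  by split => //; apply: lt_trans Cn; rewrite invr_gt0.
apply: bigcup_countable => // n _; apply: finite_set_countable.
apply: contrapT => /(infinite_set_fset n.+2)[F FP nF].
have := prob_fibers_le m measurableT mfiber (finmap.fset_uniq F).
rewrite prob_setT leNgt => /negP; apply.
have h C : C \in finmap.enum_fset F -> n.+1%:R^-1 <= prob m (setT `&` P @^-1` [set C]).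
  move=> /FP[[x _ <-] /ltW]; by rewrite setTI fiberE.
apply: (@lt_le_trans _ _ (\sum_(C <- finmap.enum_fset F) n.+1%:R^-1)).
  rewrite big_const_seq count_predT iter_addr_0 -[ltRHS]mulr_natl ltr_pdivlMr//.
  by rewrite mul1r ltr_nat.
by rewrite big_seq [leRHS]big_seq; apply: ler_sum => C /h.
Qed.

(** Atoms of positive measure receive positive labels and 0 gathers the null atoms. Their union is
    null, because the information is +oo on it and the entropy is finite. *)
Lemma countable_label : exists l : T -> nat,
  [/\ forall i, measurable (l @^-1` [set i]),
      \forall x \ae m, forall y, P x y <-> l x = l y &
      m.-integrable setT (EFin \o (fun x => - ln (prob m (l @^-1` [set l x]))))].
Proof.
have /countable_injP[io ioI] := countable_positive_atoms.
pose l x := if 0 < prob m (P x) then (io (P x)).+1 else 0%N.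
have linj x y : 0 < prob m (P x) -> l x = l y -> P x = P y.
  rewrite /l => x0; rewrite x0; case: ifP => // y0 [].
  by move=> h; apply: ioI h; rewrite inE; split.
have lE x : 0 < prob m (P x) -> l @^-1` [set l x] = P x.
  move=> x0; apply/seteqP; split => y /=.
    by move=> /esym /(linj _ _ x0) ->; exact: measurable_partition_refl.
  by move=> /measurable_partition_eq xy; rewrite /l -xy.
have mlS i : measurable (l @^-1` [set i.+1]).
  have [[x xi]|nx] := pselect (exists x, l x = i.+1).
    rewrite -xi lE; first exact: measurable_partition_atom.
    by move: xi; rewrite /l; case: ifP.
  by rewrite (_ : _ @^-1` _ = set0)// -subset0 => x /= xC; apply: nx; exists x.
have ml i : measurable (l @^-1` [set i]).
  case: i => [|i]; last exact: mlS.
  rewrite (_ : _ @^-1` _ = ~` \bigcup_i (l @^-1` [set i.+1])).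
    by apply: measurableC; exact: bigcupT_measurable.
  apply/seteqP; split => x /= h; first by move=> [i _ /=]; rewrite h.
  by apply: contrapT => lx; apply: h; exists (l x).-1 => //=; case: (l x) lx.
have Z0 : m (l @^-1` [set 0%N]) = 0%E.
  rewrite probE//; congr EFin; apply/eqP; rewrite eq_le prob_ge0 andbT leNgt.
  apply/negP => Z0; set Z := l @^-1` [set 0%N] in Z0.
  have h (r : R) : 0 <= r -> (r%:E * m Z <= partition_entropy m P)%E.
    move=> r0; have mZ : measurable Z := ml 0%N.
    rewrite -[in leLHS](setIT Z) -integral_indic// -ge0_integralZl//; last first.
      by apply/measurable_EFinP; exact: measurable_indic.
    apply: (@ge0_le_integral_off_null _ _ _ m set0) => //.
    - by move=> x; rewrite mule_ge0// lee_fin.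
    - move=> x; rewrite leeNr oppe0 lne_le0.
      by apply: probability_le1; exact: measurable_partition_atom.
    move=> x _; have mPx := measurable_partition_atom x.
    rewrite indicE; have [xZ|xZ] := boolP (x \in Z); last first.
      rewrite mule0 leeNr oppe0 lne_le0; exact: probability_le1.
    have : l x = 0%N by move: xZ; rewrite inE.
    rewrite /l; case: ifPn => // + _.
    rewrite -leNgt => p0; have -> : m (P x) = 0%E.
      by rewrite probE//; congr EFin; apply/eqP; rewrite eq_le p0 prob_ge0.
    by rewrite le0_lneNy// leey.
  have fPn : partition_entropy m P \is a fin_num.
    by rewrite ge0_fin_numE// (le_trans _ (h 0 _))// mul0e.
  have mZ : measurable Z := ml 0%N.
  (* Then r m(Z) exceeds the entropy by 1, against [h]. *)
  pose r := (fine (partition_entropy m P) + 1) / prob m Z.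
  have c0 : 0 <= fine (partition_entropy m P).
    by rewrite fine_ge0// (le_trans _ (h 0 _))// mul0e.
  have := h r; rewrite divr_ge0 ?addr_ge0 ?prob_ge0// => /(_ isT).
  rewrite probE// -EFinM -(fineK fPn) lee_fin /r divfK ?gt_eqF//; lra.
exists l; split => //.
  exists (l @^-1` [set 0%N]); split => // x /= nh; apply: contrapT => lx; apply: nh => y.
  have x0 : 0 < prob m (P x) by move: lx; rewrite /l; case: ifP.
  by rewrite -[X in X <-> _]/(P x y) -(lE x x0) /=; split.
have g0 x : 0 <= - ln (prob m (l @^-1` [set l x])).
  by rewrite oppr_ge0 ln_le0// prob_le1.
have mlab (F : nat -> R) : measurable_fun setT (F \o l).
  move=> _ Y mY; rewrite setTI.
  rewrite (_ : _ @^-1` _ = \bigcup_(i in [set i | Y (F i)]) (l @^-1` [set i])).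
    by apply: bigcup_measurable => i _; exact: ml.
  by apply/seteqP; split => x /=; [move=> h; exists (l x)|move=> [i /= h ->]].
apply/integrableP; split.
  by apply/measurable_EFinP; exact: (mlab (fun i => - ln (prob m (l @^-1` [set i])))).
apply: le_lt_trans fP; apply: (@ge0_le_integral_off_null _ _ _ m (l @^-1` [set 0%N])) => //.
  move=> x; rewrite leeNr oppe0 lne_le0; apply: probability_le1.
  exact: measurable_partition_atom.
move=> x /= lx; have x0 : 0 < prob m (P x) by move: lx; rewrite /l; case: ifP.
rewrite ger0_norm//= lE// [m (P x)](_ : _ = (prob m (P x))%:E); last first.
  by apply: probE; exact: measurable_partition_atom.
by rewrite lne_EFin.
Qed.

End countable_partitions.

Lemma near_inftyS (Q : nat -> Prop) :
  (\forall n \near \oo, Q n) -> \forall n \near \oo, Q n.+1.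
Proof. by move=> [N _ h]; exists N => // n /= Nn; apply: h => /=; exact: leqW. Qed.

Lemma integrable_bounded {R : realType} d (T : measurableType d)
    (m : probability T R) (g : T -> R) (K : R) :
  measurable_fun setT g -> (forall x, `|g x| <= K) ->
  m.-integrable setT (EFin \o g).
Proof.
move=> mg gK; apply: (@le_integrable _ _ _ m setT measurableT _ (EFin \o cst K)).
- exact/measurable_EFinP.
- by move=> x _; rewrite /= lee_fin (le_trans (gK x))// ler_norm.
- exact: finite_measure_integrable_cst.
Qed.

Lemma inv_bound_lt {R : realType} (e : R) : 0 < e ->
  (Num.bound e^-1).+1%:R^-1 < e.
Proof.
move=> e0; rewrite invf_plt ?posrE//.
by rewrite (lt_trans (archi_boundP _)) ?ltr_nat// invr_ge0 ltW.
Qed.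

(** * Inverse balls and atoms as images under iterates *)

Section inverse_sets.
Context {R : realType} {X : pmetricType R} (f : X -> X).

(** The entry x_-n of a past determines x_-i for i <= n; conversely, a past of a point of [core] is
    prolonged by the forward orbit of that point. Balls about the entries of a past, or their atoms,
    are later taken for [A i]. *)
Lemma inverse_setE (A : nat -> set X) n :
  [set y | exists z : pasts X, [/\ inverse_limit f z, z 0%N = y &
    forall i, (i <= n)%N -> A i (z i)]] =
  iter n f @` (core f `&` [set z | forall i, (i <= n)%N -> A i (iter (n - i) f z)]).
Proof.
apply/seteqP; split => [_ [z [Iz <- Az]]|_ [_ [[z Iz <-] Az] <-]].
  exists (z n); last by have := iter_inverse_limit n 0 Iz; rewrite addn0.
  split.
    by exists (iter n shift z) => [i|]; rewrite !iter_shift ?addn0// addnS; exact: Iz.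
  move=> i ni; have := Az i ni; rewrite -[in X in X -> _](iter_inverse_limit (n - i) i Iz).
  by rewrite subnK.
(* Truncated subtraction merges two cases: forward iterates of [z 0] for i <= n, its past for i >=
   n. *)
exists (fun i => iter (n - i) f (z (i - n)%N)); split => [i||i ni].
- have [ni|ni] := leqP n i.
    have -> : (n - i = 0)%N by apply/eqP; rewrite subn_eq0.
    have -> : (n - i.+1 = 0)%N by apply/eqP; rewrite subn_eq0 leqW.
    by rewrite subSn//; exact: Iz.
  have -> : (i.+1 - n = 0)%N by apply/eqP; rewrite subn_eq0.
  have -> : (i - n = 0)%N by apply/eqP; rewrite subn_eq0 ltnW.
  by rewrite -iterS -subSn// subSS.
- by rewrite subn0 sub0n.
- by have -> : (i - n = 0)%N by [apply/eqP; rewrite subn_eq0]; exact: Az.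
Qed.

End inverse_sets.

Section natural_extension.
Context {R : realType} {X : pmetricType R}.
Hypothesis cX : compact [set: X].
Variable f : X -> X.
Hypothesis cf : continuous f.
Variables (mu : probability (borel X) R) (muhat : probability (borel (pasts X)) R).
Hypothesis Hm : inverse_limit_measure f mu muhat.

Local Notation sh := (shift : borel (pasts X) -> borel (pasts X)).
Local Notation proj i := ((fun x => x i) : borel (pasts X) -> borel X).

Let lawE i (A : set (borel X)) : measurable A -> muhat (proj i @^-1` A) = mu A.
Proof.
move=> mA; have mB := measurable_coordinate_preimage i mA.
rewrite (_ : muhat _ = (prob muhat [set x | A (x i)])%:E); last exact: probE.
by rewrite (coordinate_law Hm i mA); apply/esym/probE.
Qed.

Lemma integrable_coordinate i (F : borel X -> \bar R) :
  mu.-integrable setT F -> muhat.-integrable setT (F \o proj i).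
Proof.
move=> /integrableP[mF iF]; have mp := @measurable_coordinate _ X i.
apply/integrableP; split; first exact: measurableT_comp.
have mF' : measurable_fun setT (fun x => `|F x|)%E by exact: measurableT_comp.
have := @ge0_integral_pushforward _ _ _ _ R _ mp muhat setT _ measurableT mF'
  (fun y _ => abse_ge0 _).
rewrite preimage_setT /comp => <-.
rewrite (@eq_measure_integral _ _ _ setT mu)// => A mA _; exact: lawE.
Qed.

Lemma integral_coordinate i (F : borel X -> \bar R) : mu.-integrable setT F ->
  (\int[muhat]_x F (x i) = \int[mu]_x F x)%E.
Proof.
move=> iF; have iFi := integrable_coordinate i iF.
have mp := @measurable_coordinate _ X i.
have mF : measurable_fun setT F by case/integrableP: iF.
have := integral_pushforward mp mF iFi measurableT.
rewrite preimage_setT => <-; apply: eq_measure_integral => A mA _.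
exact: lawE.
Qed.

(** The offset [k] will be 1: f^n carries x_-n to x_0 by applying [f] at x_-n, ..., x_-1. *)
Lemma coordinate_birkhoff_le k (g : borel X -> R) (c : R) :
  mu.-integrable setT (EFin \o g) -> (\int[mu]_x (g x)%:E < c%:E)%E ->
  \forall x \ae muhat, \forall n \near \oo,
    \sum_(i < n) g (x (i + k)%N) <= c * n%:R.
Proof.
move=> ig gc; have ms := @measurable_shift _ X.
have := birkhoff_le ms (shift_invariant Hm) (shift_ergodic Hm)
  (integrable_coordinate k ig).
move=> /(_ c); rewrite (_ : (\int[_]_x _ = \int[mu]_x (g x)%:E)%E); last first.
  exact: (integral_coordinate k ig).
move=> /(_ gc); apply: filterS => x; apply: filterS => n.
by under eq_bigr do rewrite iter_shift.
Qed.

Lemma coordinate_birkhoff_ge k (g : borel X -> R) (c : R) :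
  mu.-integrable setT (EFin \o g) -> (c%:E < \int[mu]_x (g x)%:E)%E ->
  \forall x \ae muhat, \forall n \near \oo,
    c * n%:R <= \sum_(i < n) g (x (i + k)%N).
Proof.
move=> ig gc; have iN : mu.-integrable setT (EFin \o (fun x => - g x)).
  rewrite (_ : _ \o _ = (fun x => - (EFin \o g) x)%E) //; exact: integrableN.
have := coordinate_birkhoff_le k (c := - c) iN.
rewrite (_ : (\int[mu]_x (- g x)%:E = - \int[mu]_x (g x)%:E)%E); last first.
  by rewrite -integralN ?integrable_add_def//; apply: eq_integral.
rewrite EFinN lteN2 => /(_ gc).
apply: (@filterS _ _ (ae_filter_ringOfSetsType muhat)) => x; apply: filterS => n.
by rewrite sumrN mulNr lerN2.
Qed.

Lemma block_entropy_rate_hat (C : finType) (l : borel X -> C) :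
  (forall a, measurable (l @^-1` [set a])) ->
  block_entropy_rate muhat sh (hat l) = block_entropy_rate mu (f : borel X -> borel X) l.
Proof.
move=> ml; rewrite /block_entropy_rate; congr (inf (image _ _)).
by apply/funext => n; rewrite (block_entropy_hat cf Hm n.+1 ml).
Qed.

Lemma measurable_inverse_set (A : nat -> set (borel X)) n :
  locally_injective f -> (forall i, measurable (A i)) ->
  measurable ([set y | exists z : pasts X, [/\ inverse_limit f z, z 0%N = y &
    forall i, (i <= n)%N -> A i (z i)]] : set (borel X)).
Proof.
move=> lf mA; rewrite inverse_setE; apply: measurable_image_iter => //.
apply: measurableI; first by apply: closed_borel; exact: closed_core.
rewrite (_ : mkset _ = \bigcap_(i in [set i | (i <= n)%N]) (iter (n - i) f @^-1` A i)).
  apply: bigcap_measurable => [|i _]; first by exists 0%N.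
  apply: measurable_preimage => //; apply: measurable_iter; exact: continuous_borel.
by apply/seteqP; split.
Qed.

End natural_extension.

Section log_jacobian.
Context {R : realType} {X : pmetricType R}.
Hypothesis cX : compact [set: X].
Variable f : X -> X.
Hypotheses (cf : continuous f) (lf : locally_injective f).
Variables (mu : probability (borel X) R) (J : borel X -> R).
Hypothesis Smu : invariant_measure (f : borel X -> borel X) mu.
Hypothesis HJ : is_jacobian f mu J.
Hypothesis bJ : jacobian_bounded mu J.

(** [J] is truncated to the interval [1, M'] before the logarithm is taken, so that the bounds on
    [g] hold everywhere and not just almost everywhere. *)
Lemma log_jacobian : exists (g : borel X -> R) (K : R),
  [/\ measurable_fun setT g, forall x, 0 <= g x, forall x, g x <= K,
    \forall x \ae mu, J x = expR (g x) &
    (\int[mu]_x (ln (J x))%:E = \int[mu]_x (g x)%:E)%E].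
Proof.
have [M JM] := bJ; pose M' := Num.max 1 M.
have M0 : 0 < M' by rewrite lt_max ltr01.
pose j x := Num.max 1 (Num.min (J x) M').
have j1 x : 1 <= j x by rewrite le_max lexx.
have jM x : j x <= M' by rewrite ge_max le_max lexx/= ge_min lexx orbT.
have jE : \forall x \ae mu, J x = j x.
  have J1 := jacobian_ge1 cX cf lf Smu HJ.
  apply: filterS2 J1 JM => x J1 JM; rewrite /j.
  have JM' : J x <= M' by rewrite (le_trans (ler_norm _))// le_max JM orbT.
  by rewrite (min_idPl JM') (max_idPr J1).
exists (fun x => ln (j x)), (ln M'); split.
- apply: measurableT_comp; first exact: measurable_ln.
  apply: measurable_maxr => //; apply: measurable_minr => //.
  by have [] := HJ.
- by move=> x; rewrite ln_ge0.
- by move=> x; rewrite ler_ln ?posrE// (lt_le_trans _ (j1 x)).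
- by apply: filterS jE => x ->; rewrite lnK// posrE (lt_le_trans _ (j1 x)).
- have [N [mN N0 NE]] := jE.
  apply: (integral_eq_off_null mN N0) => x _ Nx; congr (ln _)%:E.
  by apply: contrapT => h; apply: Nx; exact: NE.
Qed.

End log_jacobian.

(** * Lower bound for inverse atoms *)

Section ae_logic.
Context {R : realType} d (T : measurableType d) (m : probability T R).

Lemma ae_imply (P Q : T -> Prop) : (forall x, P x -> Q x) ->
  (\forall x \ae m, P x) -> \forall x \ae m, Q x.
Proof. by move=> PQ; apply: filterS. Qed.

Lemma ae_and (P Q : T -> Prop) : (\forall x \ae m, P x) ->
  (\forall x \ae m, Q x) -> \forall x \ae m, P x /\ Q x.
Proof. by move=> mP mQ; apply: filterS2 mP mQ. Qed.

End ae_logic.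

Section finite_labels.
Context {R : realType} d (T : measurableType d).

Lemma measurable_ffun_label (I : finType) (A : I -> set T) :
  (forall i, measurable (A i)) ->
  forall a, measurable ((fun y => [ffun i => `[< A i y >]]) @^-1` [set a]).
Proof.
move=> mA a; rewrite (_ : _ @^-1` _ =
    \bigcap_(i in [set: I]) (if a i then A i else ~` A i)).
  apply: fin_bigcap_measurable; first exact: finite_finset.
  by move=> i _; case: ifP => // _; exact: measurableC.
apply/seteqP; split => [y /= <- i _|y h /=].
  by rewrite ffunE; case: ifP => /asboolP.
apply/ffunP => i; rewrite ffunE; have := h i Logic.I.
by case: (a i) => h'; [exact/asboolT|exact/asboolF].
Qed.

Lemma level_label (g : T -> R) (K e : R) : measurable_fun setT g ->
  (forall x, 0 <= g x) -> (forall x, g x <= K) -> 0 < e ->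
  exists (A : finType) (k : T -> A), (forall a, measurable (k @^-1` [set a])) /\
    forall x y, k x = k y -> g x <= g y + e.
Proof.
move=> mg g0 gK e0; have ge0 x : 0 <= g x / e by rewrite divr_ge0// ltW.
pose k x := Num.truncn (g x / e); pose L := Num.truncn (K / e).
have kL x : (k x <= L)%N.
  rewrite le_truncn//.
  by rewrite ler_pM2r ?invr_gt0.
have mk (a : nat) : measurable (k @^-1` [set a]).
  rewrite (_ : _ @^-1` _ = [set x | a%:R * e <= g x] `&` [set x | g x < a.+1%:R * e]).
    apply: measurableI.
      rewrite (_ : mkset _ = g @^-1` `[a%:R * e, +oo[%classic); last first.
        by apply/seteqP; split => x /=; rewrite in_itv/= andbT.
      by rewrite -[X in measurable X]setTI; apply: mg.
    rewrite (_ : mkset _ = g @^-1` `]-oo, a.+1%:R * e[%classic); last first.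
      by apply/seteqP; split => x /=; rewrite in_itv.
    by rewrite -[X in measurable X]setTI; apply: mg.
  apply/seteqP; split => [x /= /eqP|x /= [h1 h2]].
    by rewrite /k truncn_eq// ler_pdivlMr// ltr_pdivrMr// => /andP[].
  by apply/eqP; rewrite truncn_eq// ler_pdivlMr// ltr_pdivrMr// h1 h2.
exists 'I_L.+1, ((fun n => inord n) \o k); split.
  exact: measurable_map_label.
move=> x y /= /(congr1 val) /=; rewrite !inordK ?ltnS// => kE.
have /andP[_ h1] := truncn_itv (ge0 x); have /andP[h2 _] := truncn_itv (ge0 y).
move: h1 h2; rewrite -/(k x) -/(k y) kE ltr_pdivrMr// ler_pdivlMr// -natr1; lra.
Qed.

End finite_labels.

Section upper_bound.
Context {R : realType} {X : pmetricType R}.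
Hypothesis cX : compact [set: X].
Variable f : X -> X.
Hypotheses (cf : continuous f) (lf : locally_injective f).
Variables (mu : probability (borel X) R) (muhat : probability (borel (pasts X)) R).
Variable J : borel X -> R.
Hypothesis Smu : invariant_measure (f : borel X -> borel X) mu.
Hypothesis Emu : ergodic_measure (f : borel X -> borel X) mu.
Hypothesis HJ : is_jacobian f mu J.
Hypothesis Hm : inverse_limit_measure f mu muhat.
Variables (g : borel X -> R) (K : R).
Hypotheses (mg : measurable_fun setT g) (g0 : forall x, 0 <= g x).
Hypothesis gK : forall x, g x <= K.
Hypothesis Jg : \forall x \ae mu, J x = expR (g x).
Hypothesis hfin : (measure_entropy (f : borel X -> borel X) mu < +oo)%E.

Local Notation fb := (f : borel X -> borel X).
Local Notation sh := (shift : borel (pasts X) -> borel (pasts X)).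
Local Notation h := (fine (measure_entropy fb mu)).
Local Notation F := (fine (\int[mu]_x (g x)%:E)).

Let mf : measurable_fun setT fb.
Proof. exact: continuous_borel. Qed.

Lemma integrable_log_jacobian : mu.-integrable setT (EFin \o g).
Proof.
by apply: (@integrable_bounded _ _ _ mu g K mg) => x; rewrite ger0_norm.
Qed.

(** The label records which closed balls of the cover contain the point, so points with equal labels
    share a ball on which [f] is injective. *)
Lemma injective_label : exists (A : finType) (k : borel X -> A),
  (forall a, measurable (k @^-1` [set a])) /\
  forall y z, k y = k z -> f y = f z -> y = z.
Proof.
have [s [r [r0 fr sr]]] := injective_ball_cover cX lf.
pose D (i : 'I_(size s)) : set (borel X) :=
  let x := tnth (in_tuple s) i in [set y | mdist x y <= r x].
exists _, (fun y => [ffun i => `[< D i y >]]); split.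
  by apply: measurable_ffun_label => i; apply: closed_borel; exact: closed_mdist.
move=> y z yz fyz; have [x xs /ltW xy] := sr y.
have [i xi] : exists i, x = tnth (in_tuple s) i.
  by apply/tnthP; exact: xs.
have Dy : D i y by rewrite /D/= -xi.
have Dz : D i z.
  by move/ffunP : yz => /(_ i); rewrite !ffunE asboolT// => /esym/asboolP.
by apply: (fr x y z) => //; rewrite inE//=; move: Dz; rewrite /D/= -xi.
Qed.

(** Every finite factor of [lk] has entropy rate at most [h]. Half of [e] makes this inequality
    strict, the other half pays for the passage to the countable label. *)
Lemma ae_countable_past_ge (A : finType) (l : borel X -> nat) (k : borel X -> A)
    (e : R) :
  (forall i, measurable (l @^-1` [set i])) ->
  (forall a, measurable (k @^-1` [set a])) ->
  mu.-integrable setT (EFin \o (fun x => - ln (prob mu (l @^-1` [set l x])))) ->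
  0 < e -> let lk y := (l y, k y) in
  \forall x \ae muhat, \forall n \near \oo,
    expR (- ((h + e) * n%:R)) <= pw muhat sh (hat lk) (word sh (hat lk) n x).
Proof.
move=> ml mk il e0 lk; have ms := @measurable_shift _ X.
have sI := shift_invariant Hm; have sE := shift_ergodic Hm.
have e2 : 0 < e / 2 by rewrite divr_gt0.
have -> : h + e = (h + e / 2) + e / 2 by lra.
apply: (ae_countable_ge ms sI sE (l := hat l) (k := hat k)) => //.
- exact: measurable_hat.
- exact: measurable_hat.
- have := integrable_coordinate Hm 0 il.
  congr (_ .-integrable _ _); apply/funext => x /=; congr (- ln _)%:E.
  exact/esym/(coordinate_law Hm 0).
- move=> D f' /=; have mD : forall a, measurable ((f' \o lk) @^-1` [set a]).
    by apply: measurable_map_label; exact: measurable_pair_label.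
  apply: (@ae_pw_ge _ _ _ muhat sh ms sI sE D (hat (f' \o lk)) (measurable_hat mD)).
  rewrite (block_entropy_rate_hat cf Hm mD).
  have := block_entropy_rate_le_entropy mf Smu Emu hfin mD; lra.
Qed.

(** f^n maps almost all of the cylinder of length [n.+1] at x_-n into the inverse atom. Each image
    on the way lies in one class of [lk], where [f] is injective and [g] varies by at most [t]. *)
Lemma inverse_atom_ge (P : borel X -> set (borel X)) (e : R) :
  finite_entropy_partition mu P -> 0 < e ->
  \forall x \ae muhat, \forall n \near \oo,
    expR (- ((h - F + e) * n%:R)) <= prob mu (inverse_atom f P n x).
Proof.
(* Four of the five [t] are spent: on the cylinder, the Birkhoff sums, the variation of [g], and the
   extra letter of a word of length [n.+1]. *)
move=> [mP fP] e0; pose t := e / 5; have t0 : 0 < t by rewrite divr_gt0.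
have [l [ml Pl il]] := countable_label mP fP.
have [A1 [k1 [mk1 k1I]]] := injective_label.
have [A2 [k2 [mk2 k2I]]] := level_label mg g0 gK t0.
pose k y := (k1 y, k2 y); have mk : forall a, measurable (k @^-1` [set a]).
  exact: measurable_pair_label.
pose lk y := (l y, k y).
have mlk : forall a, measurable (lk @^-1` [set a]) by exact: measurable_pair_label.
have H1 := ae_countable_past_ge ml mk il t0.
have ig := integrable_log_jacobian.
have Ffin := integrable_fin_num measurableT ig.
have Ft : ((F - t)%:E < \int[mu]_x (g x)%:E)%E.
  by rewrite -[ltRHS]fineK// lte_fin ltrBlDr ltrDl.
have H2 := coordinate_birkhoff_ge Hm 1 ig Ft.
have H3 := ae_coordinate Hm Pl.
have [N [mN N0 NE]] := Jg.
(* The points whose orbit meets a null set containing all points where [J] differs from exp(g). They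
   are removed because [prob_image_iter_ge] asks for pointwise bounds. *)
pose Ns := \bigcup_i (iter i fb @^-1` N).
have mNs : measurable Ns.
  by apply: bigcupT_measurable => i; apply: measurable_preimage => //; exact: measurable_iter.
have Ns0 : mu Ns = 0%E.
  apply: measure_negligible => //; apply: negligible_bigcup => i.
  exists (iter i fb @^-1` N); split => //.
    by apply: measurable_preimage => //; exact: measurable_iter.
  by rewrite -[RHS]N0; exact: (measure_iter_preimage mf Smu).
have mcore : measurable (core f : set (borel X)).
  by apply: closed_borel; exact: closed_core.
have core0 : prob mu (~` core f) = 0.
  have := prob_splitI mu measurableT mcore.
  by rewrite prob_setT setTI setTD (prob_core cX cf Hm); lra.
have mPP := measurable_partition_atom mP.
have H4 := ae_inverse_limit cf Hm.
have H12 := ae_and (ae_and H1 H2) (ae_and H3 H4).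
apply: ae_imply H12 => x [[{}H1 {}H2] [{}H3 ilx]].
have {}H1 := near_inftyS H1.
near=> n.
have h1 : expR (- ((h + t) * n.+1%:R)) <= pw muhat sh (hat lk) (word sh (hat lk) n.+1 x).
  by near: n.
have h2 : (F - t) * n%:R <= \sum_(i < n) g (x (i + 1)%N) by near: n.
have h3 : h + t <= t * n%:R.
  rewrite mulrC -ler_pdivrMr//; near: n; exact: nbhs_infty_ger.
move: h1; rewrite (pw_hat cf Hm mlk) (word_hatE lk n ilx) revK => h1.
pose C := cyl fb lk (word fb lk n.+1 (x n)).
have mC : measurable C by exact: measurable_cyl.
pose B := (C `&` core f) `\` Ns.
have mB : measurable B by apply: measurableD => //; exact: measurableI.
have CB : prob mu C <= prob mu B.
  rewrite (prob_splitI mu mC mcore) (prob_splitI mu (measurableI _ _ mC mcore) mNs).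
  have E1 : prob mu (C `&` core f `&` Ns) <= 0.
    have <- : prob mu Ns = 0 by rewrite /prob Ns0.
    by apply: prob_le => //; do 2 apply: measurableI => //.
  have E2 : prob mu (C `\` core f) <= 0.
    rewrite -core0; apply: prob_le; [exact: measurableD|exact: measurableC|].
    by move=> z [].
  by rewrite -/B; lra.
have Bx z i : B z -> (i <= n)%N -> lk (iter i f z) = lk (x (n - i)%N).
  move=> [[Cz _] _] ni; move: Cz; rewrite /C cyl_word /= -/(word fb lk n.+1 z) -/(word fb lk n.+1 (x n)).
  move=> /(congr1 (fun w => nth (lk z) w i)); rewrite !word_nth// => ->.
  congr lk; have := iter_inverse_limit i (n - i) ilx.
  by rewrite subnKC.
pose s i := expR (g (x (n - i)%N) - t).
have main : (\prod_(i < n) s i) * prob mu B <= prob mu (iter n f @` B).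
  apply: (prob_image_iter_ge cX cf lf HJ) => //.
  - by move=> i; exact: expR_ge0.
  - move=> i ni y z; rewrite !inE => -[y' By' <-] [z' Bz' <-].
    apply: k1I; have [_ + _] := Bx _ _ By' (ltnW ni).
    by have [_ -> _] := Bx _ _ Bz' (ltnW ni).
  - move=> i _ ni [z Bz <-]; have [_ Nz] := Bz.
    have -> : J (iter i f z) = expR (g (iter i f z)).
      apply: contrapT => hJ; apply: Nz; exists i => //; exact: NE.
    rewrite ler_expR lerBlDr; apply: k2I.
    by have [_ _ ->] := Bx _ _ Bz (ltnW ni).
have sE : \prod_(i < n) s i = expR (\sum_(i < n) g (x (i + 1)%N) - t * n%:R).
  rewrite -expR_sum sumrB sumr_const card_ord mulr_natr; congr (expR (_ - _)).
  rewrite (reindex_inj rev_ord_inj); apply: eq_bigr => i _ /=.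
  by rewrite subKn// addn1.
have sub : iter n f @` B `<=` inverse_atom f P n x.
  rewrite /inverse_atom (inverse_setE f (fun i => P (x i))).
  move=> _ [z Bz <-]; exists z => //; split; first by case: Bz => -[].
  move=> i ni; apply/H3; have [-> _ _] := Bx _ _ Bz (leq_subr i n).
  by rewrite subKn.
have matom : measurable (inverse_atom f P n x : set (borel X)).
  by apply: (measurable_inverse_set cX cf (A := fun i => P (x i)) n lf) => i; exact: mPP.
have fin : prob mu (iter n f @` B) <= prob mu (inverse_atom f P n x).
  by apply: prob_le => //; exact: measurable_image_iter.
apply: le_trans fin; apply: le_trans main; rewrite sE.
apply: (@le_trans _ _ (expR ((F - t) * n%:R - t * n%:R) * expR (- ((h + t) * n.+1%:R)))).
  rewrite -expRD ler_expR -natr1.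
  have eE : e = 5 * t by rewrite /t; lra.
  have tn0 : 0 <= t * n%:R by rewrite mulr_ge0// ltW.
  rewrite eE; lra.
apply: ler_pM => //; rewrite ?expR_ge0//.
  by rewrite ler_expR lerD2r.
by rewrite (le_trans h1).
Unshelve. all: by end_near. Qed.

End upper_bound.

(** * Approximate continuity *)

Section approximate_continuity.
Context {R : realType} {X : pmetricType R}.
Variable mu : probability (borel X) R.
Implicit Types (A B E U : set (borel X)).

Lemma open_enlargement (A : set X) (r : R) :
  open [set x : X | exists2 y, A y & mdist y x < r].
Proof.
rewrite (_ : mkset _ = \bigcup_(y in A) [set x : X | mdist y x < r]); last first.
  by apply/seteqP; split => x [y Ay yx]; exists y.
by apply: bigcup_open => y _; exact: open_mdist.
Qed.

Lemma closed_shrinking (A : set X) (r : R) :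
  closed [set x : X | forall y, mdist x y < r -> A y].
Proof.
rewrite (_ : mkset _ = ~` [set x : X | exists2 y, (~` A) y & mdist y x < r]).
  by apply: open_closedC; exact: open_enlargement.
apply/seteqP; split => x /= h; first by move=> [y nAy]; rewrite metric_sym => /h.
by move=> y xy; apply: contrapT => nAy; apply: h; exists y => //; rewrite metric_sym.
Qed.

Lemma prob_setU_le A B : measurable A -> measurable B ->
  prob mu (A `|` B) <= prob mu A + prob mu B.
Proof.
move=> mA mB; have mAB : measurable (A `|` B) by exact: measurableU.
rewrite (prob_splitI mu mAB mA) lerD//.
  by apply: prob_le => //; exact: measurableI.
by apply: prob_le => //; [exact: measurableD|move=> x [[]]].
Qed.

(* Lusin's property for the indicator function of [A], with a uniform radius. *)
Definition nearly_clopen A := forall e : R, 0 < e ->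
  exists E (r : R), [/\ measurable E, prob mu E < e, 0 < r &
    forall x y, ~ E x -> ~ E y -> mdist x y < r -> A x -> A y].

Let nearly_clopenU A B : nearly_clopen A -> nearly_clopen B ->
  nearly_clopen (A `|` B).
Proof.
move=> nA nB e e0; have e2 : 0 < e / 2 by rewrite divr_gt0.
have [E [r [mE Ee r0 Er]]] := nA _ e2; have [F [s [mF Fe s0 Fs]]] := nB _ e2.
exists (E `|` F), (Num.min r s); split; first exact: measurableU.
- by have := prob_setU_le mE mF; lra.
- by rewrite lt_min r0.
- move=> x y nx ny; rewrite lt_min => /andP[xyr xys] [Ax|Bx].
    by left; apply: (Er x) => // ?; [apply: nx|apply: ny]; left.
  by right; apply: (Fs x) => // ?; [apply: nx|apply: ny]; right.
Qed.

Let nearly_clopenC A : nearly_clopen A -> nearly_clopen (~` A).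
Proof.
move=> nA e e0; have [E [r [mE Ee r0 Er]]] := nA _ e0.
exists E, r; split => // x y nx ny xy nAx Ay; apply: nAx.
by apply: (Er y) => //; rewrite metric_sym.
Qed.

(** Once the small set A minus B joins the exceptional set, the remaining points of [A] belong to
    [B]. *)
Let nearly_clopen_small A : measurable A ->
  (forall e, 0 < e -> exists B, [/\ measurable B, nearly_clopen B, B `<=` A &
    prob mu (A `\` B) < e]) -> nearly_clopen A.
Proof.
move=> mA h e e0; have e2 : 0 < e / 2 by rewrite divr_gt0.
have [B [mB nB BA ABe]] := h _ e2; have [E [r [mE Ee r0 Er]]] := nB _ e2.
have mAB : measurable (A `\` B) by exact: measurableD.
exists (E `|` (A `\` B)), r; split => //; first exact: measurableU.
  by have := prob_setU_le mE mAB; lra.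
move=> x y nx ny xy Ax; apply: BA; apply: (Er x) => //.
- by move=> Ex; apply: nx; left.
- by move=> Ey; apply: ny; left.
- by apply: contrapT => nBx; apply: nx; right.
Qed.

Lemma approximation_from_below A (F : nat -> set (borel X)) (e : R) :
  measurable A -> 0 < e -> (forall n, measurable (F n)) ->
  (forall n, F n `<=` F n.+1) -> A `<=` \bigcup_n F n ->
  exists n, prob mu (A `\` F n) < e.
Proof.
move=> mA e0 mF ndF AF; have mCA : measurable (~` A) by exact: measurableC.
(* Adjoining the complement of [A] turns the cover of [A] into an exhaustion of the whole space. *)
have [|n|n||n hn] := @prob_exhaustion _ _ _ mu (fun n => F n `|` ~` A) (e / 2).
- by rewrite divr_gt0.
- exact: measurableU.
- by move=> x [Fx|nAx]; [left; exact: ndF|right].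
- rewrite -[RHS](prob_setT mu); congr prob; apply/seteqP; split => // x _.
  by have [/AF[n _ Fx]|nAx] := pselect (A x); [exists n => //; left|exists 0%N => //; right].
exists n; rewrite (_ : A `\` F n = ~` (F n `|` ~` A)); first lra.
by rewrite setCU setCK setIC.
Qed.

(** The sets with this property form a sigma-algebra, countable unions being approximated from
    inside by finite ones. For an open set, the exceptional points are those at distance less than
    1/(n+1) from the complement. *)
Lemma borel_nearly_clopen A : measurable A -> nearly_clopen A.
Proof.
pose G := [set A : set X | measurable (A : set (borel X)) /\ nearly_clopen A].
suff h : <<s @open X >> `<=` G by move=> /h[].
apply: smallest_sub.
  split.
  - split; first exact: measurable0.
    move=> e e0; exists set0, 1; split => //.
    by rewrite (_ : prob mu set0 = 0)// /prob measure0.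
  - move=> B [mB nB]; split; first by rewrite setTD; exact: (@measurableC _ (borel X)).
    by rewrite setTD; exact: nearly_clopenC.
  - move=> B GB; have mB : measurable (\bigcup_i B i : set (borel X)).
      by apply: (@bigcupT_measurable _ (borel X)) => i; have [] := GB i.
    split => //; apply: nearly_clopen_small => // e e0.
    pose F n : set (borel X) := \big[setU/set0]_(i < n) B i.
    have mF n : measurable (F n).
      by apply: bigsetU_measurable => i _; have [] := GB i.
    have nF n : nearly_clopen (F n).
      elim: n => [|n IH]; last first.
        by rewrite /F big_ord_recr; apply: nearly_clopenU => //; have [] := GB n.
      move=> d d0; exists set0, 1; split => //; first by rewrite /prob measure0.
      by rewrite /F big_ord0.
    have [n|x [i _ Bx]|n Fn] := @approximation_from_below _ F e mB e0 mF.
    + by rewrite /F big_ord_recr => x Fx; left.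
    + by exists i.+1 => //; rewrite /F big_ord_recr; right.
    exists (F n); split => // x; rewrite /F -bigcup_mkord => -[i _ Bx].
    by exists i.
move=> U oU; have mU := open_borel oU; split => //.
move=> e e0; pose V n : set (borel X) := [set x | forall y, mdist x y < n.+1%:R^-1 -> U y].
have mV n : measurable (V n) by apply: closed_borel; exact: closed_shrinking.
have [n|x Ux|n Vn] := @approximation_from_below _ V e mU e0 mV.
- move=> x Vx y xy; apply: Vx; apply: (lt_le_trans xy).
  by rewrite lef_pV2 ?posrE// ler_nat.
- have /nbhs_ballP[r /= r0 rU] : nbhs (x : X) U by exact: open_nbhs_nbhs.
  exists (Num.bound r^-1) => // y xy; apply: rU; rewrite ballEmdist /=.
  by apply: (lt_trans xy); exact: inv_bound_lt.
exists (U `\` V n), n.+1%:R^-1; split => //; first exact: measurableD.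
move=> x y nx _ xy Ux; have : V n x by apply: contrapT => nV; apply: nx.
exact.
Qed.

Lemma label_nearly_continuous (C : finType) (l : borel X -> C) (e : R) :
  (forall a, measurable (l @^-1` [set a])) -> 0 < e ->
  exists E (r : R), [/\ measurable E, prob mu E < e, 0 < r &
    forall x y, ~ E x -> ~ E y -> mdist x y < r -> l x = l y].
Proof.
move=> ml; suff h (s : seq C) (d : R) : 0 < d ->
    exists E (r : R), [/\ measurable E, prob mu E < d, 0 < r &
    forall x y, ~ E x -> ~ E y -> mdist x y < r -> l x \in s -> l x = l y].
  move=> /(h (enum C))[E [r [mE Ee r0 Er]]]; exists E, r; split => // x y nx ny xy.
  by apply: Er => //; rewrite mem_enum.
elim: s d => [|a s IH] d d0.
  exists set0, 1; split => //; by rewrite /prob measure0.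
have d2 : 0 < d / 2 by rewrite divr_gt0.
have [E [r [mE Ee r0 Er]]] := IH _ d2.
have [E' [r' [mE' Ee' r0' Er']]] := borel_nearly_clopen (ml a) d2.
exists (E `|` E'), (Num.min r r'); split; first exact: measurableU.
- by have := prob_setU_le mE mE'; lra.
- by rewrite lt_min r0.
- move=> x y nx ny; rewrite lt_min => /andP[xyr xyr'].
  rewrite inE => /orP[/eqP xa|xs].
    rewrite xa; apply/esym; apply: (Er' x y) => // h; [apply: nx|apply: ny]; by right.
  by apply: Er => // h; [apply: nx|apply: ny]; left.
Qed.

(* [k] extends [l] from the complement of [E] to its neighbourhood, so a small
   ball centred off [E] lies in one atom of [k], whatever the boundaries of the
   atoms are. *)
Lemma robust_label (C : finType) (l : borel X -> C) (e : R) :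
  (forall a, measurable (l @^-1` [set a])) -> 0 < e ->
  exists (k : borel X -> C) E (r : R),
    [/\ forall a, measurable (k @^-1` [set a]), measurable E, prob mu E < e, 0 < r &
    forall x, ~ E x -> k x = l x /\ forall y, mdist x y < r -> k y = k x].
Proof.
move=> ml e0; have [E [r [mE Ee r0 Er]]] := label_nearly_continuous ml e0.
(* Half the radius: if [V a] and [V b] meet, they do so around centres less than [r] apart, which
   forces a = b. *)
pose V a : set (borel X) := [set y | exists2 x, ~ E x /\ l x = a & mdist x y < r / 2].
pose k y := if [pick a | `[< V a y >]] is Some a then a else l point.
have mV a : measurable (V a) by apply: open_borel; exact: open_enlargement.
have VE a b y : V a y -> V b y -> a = b.
  move=> [x [Ex <-] xy] [x' [Ex' <-] x'y]; apply: Er => //.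
  rewrite (le_lt_trans (metric_triangle x y x'))//.
  by rewrite [mdist y x']metric_sym; lra.
have kV a y : V a y -> k y = a.
  move=> Vy; rewrite /k; case: pickP => [b /asboolP Vb|/(_ a)].
    exact: VE Vb Vy.
  by move/asboolP.
exists k, E, (r / 2); split => //; last 2 first.
- by rewrite divr_gt0.
- move=> x nEx; have kx y : mdist x y < r / 2 -> k y = l x.
    by move=> xy; apply: kV; exists x.
  by rewrite (kx x) ?mdistxx ?divr_gt0.
move=> b; rewrite (_ : _ @^-1` _ = V b `|`
    (if b == l point then ~` \bigcup_(a in [set: C]) V a else set0)).
  apply: measurableU => //; case: ifP => // _; apply: measurableC.
  by apply: fin_bigcup_measurable => //; exact: finite_finset.
apply/seteqP; split => y /=.
  rewrite /k; case: pickP => [a /asboolP Va <-|h]; first by left.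
  move=> <-; right; rewrite eqxx => -[a _ Va].
  by have := h a; rewrite asboolT.
move=> [/kV//|]; case: eqP => // -> nV.
rewrite /k; case: pickP => // a /asboolP Va; exfalso; apply: nV.
by exists a.
Qed.

(** Here small balls must lie in the atoms of [P] itself, and the null boundary provides this: a
    point off the boundary is interior to its atom, so the sets [V n] exhaust a set of full
    measure. *)
Lemma robust_atoms (P : borel X -> set (borel X)) (e : R) :
  finite_measurable_partition P -> mu (partition_boundary P) = 0%E -> 0 < e ->
  exists E (r : R), [/\ measurable E, prob mu E < e, 0 < r &
    forall x y, ~ E x -> mdist x y < r -> P x y].
Proof.
move=> [[Px PE] mP fP] bP e0.
pose V n : set (borel X) := [set x | forall y, mdist x y < n.+1%:R^-1 -> P x y].
have mV n : measurable (V n).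
  rewrite (_ : V n = \bigcup_(A in range P)
      [set x | forall y, mdist x y < n.+1%:R^-1 -> A y]).
    apply: fin_bigcup_measurable => // A _; apply: closed_borel.
    exact: closed_shrinking.
  apply/seteqP; split => x; first by move=> Vx; exists (P x) => //; exists x.
  move=> [_ [z _ <-] /= h] y xy; rewrite -(PE z x); first exact: h.
  by apply: h; rewrite mdistxx invr_gt0.
pose B := partition_boundary P.
have mB : measurable (B : set (borel X)).
  rewrite /B /partition_boundary (_ : \bigcup_x _ =
      \bigcup_(A in range P) (closure (A : set X) `\` interior (A : set X))).
    apply: fin_bigcup_measurable => // A _; apply: (@measurableD _ (borel X)).
      by apply: closed_borel; exact: closed_closure.
    by apply: open_borel; exact: open_interior.
  by rewrite bigcup_image.
have mCB : measurable (~` B : set (borel X)) by exact: (@measurableC _ (borel X)).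
have [n|x nBx|n Vn] := @approximation_from_below (~` B) V e mCB e0 mV.
- move=> x Vx y xy; apply: Vx; apply: (lt_le_trans xy).
  by rewrite lef_pV2 ?posrE// ler_nat.
- have /nbhs_ballP[r /= r0 rP] : nbhs (x : X) (P x).
    apply: contrapT => nP; apply: nBx; exists x => //; split => //.
    exact: subset_closure.
  exists (Num.bound r^-1) => // y xy; apply: rP; rewrite ballEmdist /=.
  by apply: (lt_trans xy); exact: inv_bound_lt.
exists (~` V n), n.+1%:R^-1; split => //.
- exact: measurableC.
- have mCV : measurable (~` V n) by exact: measurableC.
  rewrite (prob_splitI mu mCV mCB) (_ : ~` V n `&` ~` B = ~` B `\` V n); last first.
    by rewrite setIC.
  suff : prob mu (~` V n `\` ~` B) <= 0 by lra.
  have <- : prob mu B = 0 by rewrite /prob bP.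
  by apply: prob_le => //; [exact: measurableD|move=> x [_ /contrapT]].
- by move=> x y /contrapT Vx; exact: Vx.
Qed.

End approximate_continuity.

(** * Upper bound for inverse balls *)

Section lower_bound.
Context {R : realType} {X : pmetricType R}.
Hypothesis cX : compact [set: X].
Variable f : X -> X.
Hypotheses (cf : continuous f) (lf : locally_injective f).
Variables (mu : probability (borel X) R) (muhat : probability (borel (pasts X)) R).
Variable J : borel X -> R.
Hypothesis Smu : invariant_measure (f : borel X -> borel X) mu.
Hypothesis Emu : ergodic_measure (f : borel X -> borel X) mu.
Hypothesis HJ : is_jacobian f mu J.
Hypothesis Hm : inverse_limit_measure f mu muhat.
Variables (g : borel X -> R) (K : R).
Hypotheses (mg : measurable_fun setT g) (g0 : forall x, 0 <= g x).
Hypothesis gK : forall x, g x <= K.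
Hypothesis Jg : \forall x \ae mu, J x = expR (g x).
Hypothesis hfin : (measure_entropy (f : borel X -> borel X) mu < +oo)%E.
Hypothesis zJ : zero_boundary mu J.

Local Notation fb := (f : borel X -> borel X).
Local Notation sh := (shift : borel (pasts X) -> borel (pasts X)).
Local Notation h := (fine (measure_entropy fb mu)).
Local Notation F := (fine (\int[mu]_x (g x)%:E)).

Let mf : measurable_fun setT fb.
Proof. exact: continuous_borel. Qed.

(** For [x] in the inverse limit, the Bowen ball about x_-n along the n + 1 points x_-n, ...,
    x_0. *)
Let past_ball n (x : pasts X) (r : R) : set (borel X) :=
  [set z | forall i, (i <= n)%N -> mdist (x i) (iter (n - i) f z) < r].

Let mball (x : X) (r : R) : measurable ([set y : X | mdist x y < r] : set (borel X)).
Proof. by apply: open_borel; exact: open_mdist. Qed.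

Let measurable_past_ball n x r : measurable (past_ball n x r).
Proof.
rewrite (_ : past_ball n x r = \bigcap_(i in [set i | (i <= n)%N])
    (iter (n - i) fb @^-1` [set y : X | mdist (x i) y < r])).
  apply: bigcap_measurable => [|i _]; first by exists 0%N.
  by apply: measurable_preimage; [exact: measurable_iter|exact: mball].
by apply/seteqP; split.
Qed.

(** Nothing is known of the boundaries of a label [l] with entropy near [h], so it is replaced by a
    robust label [k]. By [ae_coarse_le] the cylinders of [k] are nearly as small, and
    [ae_bowen_ball_le] applies to [k]. Both thresholds are available before [k] is chosen. *)
Lemma ae_past_ball_le (e : R) : 0 < e -> exists2 r : R, 0 < r &
  \forall x \ae muhat, \forall n \near \oo,
    prob mu (past_ball n x r) <= expR (- ((h - e) * n.+1%:R)).
Proof.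
(* One [t] each for the entropy of [l], the change of label and the Bowen ball. *)
move=> e0; pose t := e / 3; have t0 : 0 < t by rewrite divr_gt0.
have ms := @measurable_shift _ X.
have sI := shift_invariant Hm; have sE := shift_ergodic Hm.
have [C [l [ml hl]]] := block_entropy_rate_gt_entropy mf Smu Emu hfin t0.
have mhl := measurable_hat ml.
have H1 : \forall x \ae muhat, \forall n \near \oo,
    pw muhat sh (hat l) (word sh (hat l) n x) <= expR (- ((h - t) * n%:R)).
  apply: (@ae_pw_le _ _ _ muhat sh ms sI sE C (hat l) mhl).
  by rewrite (block_entropy_rate_hat cf Hm ml).
have [r1 r10 H2] := ae_coarse_le ms sI sE mhl t0.
have [r2 r20 H3] := @ae_bowen_ball_le _ _ _ muhat sh ms sI sE C t t0.
have [|k [E [r [mk mE Er r0 kE]]]] := @robust_label _ _ mu C l (Num.min r1 r2) ml.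
  by rewrite lt_min r10.
exists r => //; have mhk := measurable_hat mk.
have mhE : measurable ([set x | E (x 0%N)] : set (borel (pasts X))).
  exact: measurable_coordinate_preimage.
have hE : prob muhat [set x : pasts X | E (x 0%N)] < Num.min r1 r2.
  by rewrite (coordinate_law Hm 0 mE).
move: hE; rewrite lt_min => /andP[hE1 hE2].
have {}H2 := H2 C (hat k) id mhk.
have mD : measurable [set x | id (hat k x) != hat l x].
  exact: (measurable_neq_label mhl mhk).
have {}H2 := H2 mD; have D1 : prob muhat [set x | id (hat k x) != hat l x] < r1.
  apply: le_lt_trans hE1; apply: prob_le => // x /= /eqP nkl.
  by apply: contrapT => nE; apply: nkl; exact: (kE _ nE).1.
have {}H2 := H2 D1 _ H1.
have {}H3 := H3 _ _ mhk mhE hE2 _ H2.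
apply: ae_imply H3 => x /near_inftyS; apply: filterS => n Hn.
(* The Bowen ball has the measure of the set of pasts close to [x] up to time n, to which the
   estimate for [shift] applies. *)
rewrite /past_ball -(past_law cf Hm n (A := fun i => [set y : X | mdist (x i) y < r])) //.
have eE : h - e = h - t - t - t by rewrite /t; lra.
rewrite eE; apply: Hn.
  rewrite (_ : mkset _ = \bigcap_(i in [set i | (i <= n)%N])
      [set y : pasts X | mdist (x i) (y i) < r]); last by apply/seteqP; split.
  apply: bigcap_measurable => [|i _]; first by exists 0%N.
  exact: (measurable_coordinate_preimage i (mball (x i) r)).
move=> y i Hy ni nE; apply: (kE _ nE).2.
have it (z : pasts X) : (iter i sh z : pasts X) 0%N = z i.
  by have := iter_shift i z 0; rewrite addn0.
by rewrite !it; exact: Hy.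
Qed.

(** When x_-j is outside [E], the image of [B] near x_-j lies in the atom of x_-j, where almost
    surely [g] exceeds its value at x_-j by at most [t]; at the remaining, rare times [g] is bounded
    by [K]. *)
Lemma ae_image_past_ball_le (e : R) : 0 < e -> exists2 r : R, 0 < r &
  \forall x \ae muhat, \forall n \near \oo, forall B : set (borel X),
    measurable B -> B `<=` past_ball n x r -> inverse_limit f x ->
    prob mu (iter n f @` B) <= expR ((F + e) * n%:R) * prob mu B.
Proof.
move=> e0; pose t := e / 3; have t0 : 0 < t by rewrite divr_gt0.
have [P [fP bP JP]] := zJ t0.
have K0 : 0 <= K by rewrite (le_trans (g0 point)).
(* Visits to [E] then cost on average at most K b <= t per step. *)
pose b := t / (K + 1); have b0 : 0 < b by rewrite divr_gt0// ltr_wpDl.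
have [E [r [mE Eb r0 EP]]] := robust_atoms fP bP b0.
exists r => //.
have JPg : \forall x \ae mu, \forall y \ae mu, P x y -> g y <= g x + t.
  apply: ae_imply (ae_and JP Jg) => x [{}JP Jx].
  apply: ae_imply (ae_and JP Jg) => y [{}JP Jy] /JP.
  rewrite Jx Jy -expRB ger0_norm ?expR_ge0// !ltr_expR => /andP[+ _]; lra.
have H1 := ae_coordinate Hm JPg.
have ig : mu.-integrable setT (EFin \o g).
  by apply: (@integrable_bounded _ _ _ mu g K mg) => x; rewrite ger0_norm.
have Ffin := integrable_fin_num measurableT ig.
have Ft : (\int[mu]_x (g x)%:E < (F + t)%:E)%E.
  by rewrite -[ltLHS]fineK// lte_fin ltrDl.
have H2 := coordinate_birkhoff_le Hm 1 ig Ft.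
have iE : mu.-integrable setT (EFin \o (\1_E : borel X -> R)) by exact: integrable_indic.
have Ebb : (\int[mu]_x (\1_E x)%:E < b%:E)%E.
  by rewrite integral_indic// setIT [ltLHS](_ : _ = (prob mu E)%:E)//; exact: probE.
have H3 := coordinate_birkhoff_le Hm 1 iE Ebb.
apply: ae_imply (ae_and H1 (ae_and H2 H3)) => x [{}H1 [{}H2 {}H3]].
near=> n => B mB Bx ilx.
have h2 : \sum_(i < n) g (x (i + 1)%N) <= (F + t) * n%:R by near: n.
have h3 : \sum_(i < n) \1_E (x (i + 1)%N) <= b * n%:R by near: n.
pose s i := expR (g (x (n - i)%N) + t + K * \1_E (x (n - i)%N)).
have := @prob_image_iter_le _ _ cX f cf lf mu J HJ B s n mB.
have -> : \prod_(i < n) s i = expR (\sum_(i < n) g (x (i + 1)%N) + t * n%:R +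
    K * \sum_(i < n) \1_E (x (i + 1)%N)).
  have rv (u : X -> R) : \sum_(i < n) u (x (n - i)%N) = \sum_(i < n) u (x (i + 1)%N).
    rewrite (reindex_inj rev_ord_inj); apply: eq_bigr => i _ /=.
    by rewrite subKn// addn1.
  rewrite -expR_sum !big_split/= sumr_const card_ord -mulr_sumr (rv g) (rv \1_E).
  by rewrite -[t *+ n]mulr_natr.
move=> main; apply: le_trans (main _ _) _.
- by move=> i; exact: expR_ge0.
- move=> i ni; apply: ae_imply (ae_and (H1 (n - i)%N) Jg) => w [{}H1 Jw] [z Bz zw].
  rewrite /s Jw ler_expR indicE; case: (boolP (x (n - i)%N \in E)) => xE.
    by rewrite mulr1; have := gK w; have := g0 (x (n - i)%N); lra.
  rewrite mulr0 addr0; apply: H1; apply: EP => [/mem_set|]; first exact/negP.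
  by rewrite -zw; have := Bx _ Bz (n - i)%N (leq_subr _ _); rewrite subKn// ltnW.
rewrite ler_wpM2r ?prob_ge0// ler_expR.
have h4 : K * \sum_(i < n) \1_E (x (i + 1)%N) <= t * n%:R.
  rewrite (le_trans (ler_wpM2l K0 h3))// mulrA ler_wpM2r// /b mulrCA.
  by rewrite ler_piMr ?(ltW t0)// ler_pdivrMr ?mul1r ?lerDl// ltr_wpDl.
have eE : e = 3 * t by rewrite /t; lra.
rewrite eE; lra.
Unshelve. all: by end_near. Qed.

Lemma inverse_ball_le (e : R) : 0 < e -> exists2 r : R, 0 < r &
  \forall x \ae muhat, \forall n \near \oo,
    prob mu (inverse_ball f n x r) <= expR (- ((h - F - e) * n%:R)).
Proof.
move=> e0; pose t := e / 3; have t0 : 0 < t by rewrite divr_gt0.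
have [r1 r10 H1] := ae_past_ball_le t0.
have [r2 r20 H2] := ae_image_past_ball_le t0.
exists (Num.min r1 r2); first by rewrite lt_min r10.
have H3 := ae_inverse_limit cf Hm.
have mcore : measurable (core f : set (borel X)).
  by apply: closed_borel; exact: closed_core.
apply: ae_imply (ae_and H1 (ae_and H2 H3)) => x [{}H1 [{}H2 ilx]].
near=> n.
have h1 : prob mu (past_ball n x r1) <= expR (- ((h - t) * n.+1%:R)) by near: n.
have h2 : forall B : set (borel X),
    measurable B -> B `<=` past_ball n x r2 -> inverse_limit f x ->
    prob mu (iter n f @` B) <= expR ((F + t) * n%:R) * prob mu B by near: n.
(* Pays for the exponent [n.+1], instead of [n], in [h1]. *)
have h3 : t - h <= t * n%:R.
  rewrite mulrC -ler_pdivrMr//; near: n; exact: nbhs_infty_ger.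
rewrite /inverse_ball (inverse_setE f (fun i => [set y | mdist (x i) y < Num.min r1 r2])).
set B := core f `&` _; have mB : measurable (B : set (borel X)).
  by apply: measurableI => //; exact: (measurable_past_ball n x (Num.min r1 r2)).
have Br (r : R) : Num.min r1 r2 <= r -> B `<=` past_ball n x r.
  by move=> le z [_ Bz] i ni; apply: lt_le_trans le; exact: Bz.
apply: (le_trans (h2 _ mB _ ilx)); first by apply: Br; rewrite ge_min lexx orbT.
apply: (@le_trans _ _ (expR ((F + t) * n%:R) * expR (- ((h - t) * n.+1%:R)))).
  rewrite ler_wpM2l ?expR_ge0// (le_trans _ h1)//.
  by apply: prob_le => //; apply: Br; rewrite ge_min lexx.
have tn0 : 0 <= t * n%:R by rewrite mulr_ge0// ltW.
have eE : e = 3 * t by rewrite /t; lra.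
by rewrite -expRD ler_expR -natr1 eE; lra.
Unshelve. all: by end_near. Qed.

End lower_bound.

(** * Conclusion *)

Section lim_bounds.
Context {R : realType}.

Lemma limn_esup_le (u : nat -> \bar R) (b : \bar R) :
  (\forall n \near \oo, (u n <= b)%E) -> (limn_esup u <= b)%E.
Proof.
move=> ub; rewrite /limn_esup /limf_esup.
apply: (@le_trans _ _ (ereal_sup (u @` [set n | (u n <= b)%E]))).
  by apply: ereal_inf_lbound; exists [set n | (u n <= b)%E].
by apply: ge_ereal_sup => _ [n /= h <-].
Qed.

Lemma limn_einf_ge (u : nat -> \bar R) (b : \bar R) :
  (\forall n \near \oo, (b <= u n)%E) -> (b <= limn_einf u)%E.
Proof.
move=> ub; rewrite /limn_einf leeNr; apply: limn_esup_le.
by apply: filterS ub => n; rewrite leeN2.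
Qed.

Lemma lim_at_right0 (L : R -> \bar R) (c : R) :
  (forall e, 0 < e -> (L e <= c%:E)%E) ->
  (forall d, 0 < d -> exists2 r : R, 0 < r &
    forall e, 0 < e -> e < r -> ((c - d)%:E <= L e)%E) ->
  lim (L e @[e --> (0 : R)^'+]) = c%:E.
Proof.
move=> Lc cL; apply/cvg_lim => //.
have near_bounds (d : R) : 0 < d ->
    \forall e \near (0 : R)^'+, ((c - d)%:E <= L e <= c%:E)%E.
  move=> /cL[r r0 rL]; near=> e.
  have e0 : 0 < e by near: e; exact: nbhs_right_gt.
  by rewrite Lc// rL//; near: e; exact: nbhs_right_lt.
apply/fine_cvgP; split.
  apply: filterS (near_bounds 1 ltr01) => e /andP[].
  by case: (L e).
apply/cvgrPdist_le => d d0; apply: filterS (near_bounds d d0) => e /andP[] /=.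
case: (L e) => //= y; rewrite !lee_fin => h1 h2.
by rewrite ger0_norm; lra.
Unshelve. all: by end_near. Qed.

End lim_bounds.

Section full_measure_integral.
Context {R : realType} d (T : measurableType d) (m : probability T R).
Variable D : set T.
Hypothesis aD : \forall x \ae m, D x.

Lemma ae_exists (Q : T -> Prop) : (\forall x \ae m, Q x) -> exists x, Q x.
Proof.
move=> [N [mN N0 QN]]; apply: contrapT => nQ.
have NT : N = setT.
  by apply/seteqP; split => // x _; apply: QN => Qx; apply: nQ; exists x.
have := prob_setT m; rewrite -NT /prob N0 => /esym/eqP.
by rewrite oner_eq0.
Qed.

Lemma full_integral_eq (G : T -> \bar R) (c : R) :
  (\forall x \ae m, G x = c%:E) -> (\int[m]_(x in D) G x = c%:E)%E.
Proof.
move=> Gc; have [N [mN N0 GN]] := ae_and Gc aD.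
rewrite integral_mkcond -[RHS](integral_cst_probability m c).
apply: (integral_eq_off_null mN N0) => x _ Nx.
have [Gx Dx] : G x = c%:E /\ D x by apply: contrapT => h; apply: Nx; exact: GN.
by rewrite patchE mem_set.
Qed.

Lemma full_integral_le (G : T -> \bar R) (c : R) : (forall x, (0 <= G x)%E) ->
  (\forall x \ae m, (G x <= c%:E)%E) -> (\int[m]_(x in D) G x <= c%:E)%E.
Proof.
move=> G0 Gc; have [N [mN N0 GN]] := Gc.
have [x0 Gx0] := ae_exists Gc.
have c0 : (0 <= c%:E)%E by exact: le_trans Gx0.
rewrite integral_mkcond -[leRHS](integral_cst_probability m c).
apply: (ge0_le_integral_off_null mN N0) => //.
  by move=> x; rewrite patchE; case: ifP.
move=> x Nx; rewrite patchE; case: ifP => // _.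
by apply: contrapT => h; apply: Nx; exact: GN.
Qed.

Lemma full_integral_ge (G : T -> \bar R) (c : R) : (forall x, (0 <= G x)%E) ->
  (\forall x \ae m, (c%:E <= G x)%E) -> (c%:E <= \int[m]_(x in D) G x)%E.
Proof.
move=> G0 Gc; have [N [mN N0 GN]] := ae_and Gc aD.
(* The comparison of integrals asks for nonnegative functions, and [c] may be negative. *)
apply: (@le_trans _ _ (Num.max 0 c)%:E); first by rewrite lee_fin le_max lexx orbT.
rewrite integral_mkcond -[leLHS](integral_cst_probability m).
apply: (ge0_le_integral_off_null mN N0) => //.
- by move=> x; rewrite lee_fin le_max lexx.
- by move=> x; rewrite patchE; case: ifP.
move=> x Nx; have [Gx Dx] : (c%:E <= G x)%E /\ D x.
  by apply: contrapT => h; apply: Nx; exact: GN.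
by rewrite patchE mem_set// /comp /cst EFin_max ge_max G0.
Qed.

End full_measure_integral.

Section decay_rates.
Context {R : realType} {X : pmetricType R}.
Variable mu : probability (borel X) R.

Lemma decay_rate_ge0 (A : set (borel X)) n : measurable A ->
  (0 <= decay_rate mu A n)%E.
Proof.
move=> mA; rewrite /decay_rate mule_ge0// ?lee_fin ?invr_ge0//.
by rewrite leeNr oppe0 lne_le0; exact: probability_le1.
Qed.

Lemma decay_rate_le (A : set (borel X)) n (b : R) : measurable A ->
  (0 < n)%N -> expR (- (b * n%:R)) <= prob mu A -> (decay_rate mu A n <= b%:E)%E.
Proof.
move=> mA n0 bA; have A0 : 0 < prob mu A by rewrite (lt_le_trans _ bA) ?expR_gt0.
rewrite /decay_rate (_ : mu A = (prob mu A)%:E); last exact: probE.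
rewrite lne_EFin// -EFinN -EFinM lee_fin mulrC ler_pdivrMr ?ltr0n//.
by rewrite lerNl -ler_expR lnK.
Qed.

Lemma decay_rate_ge (A : set (borel X)) n (b : R) : measurable A ->
  (0 < n)%N -> prob mu A <= expR (- (b * n%:R)) -> (b%:E <= decay_rate mu A n)%E.
Proof.
move=> mA n0 bA; rewrite /decay_rate (_ : mu A = (prob mu A)%:E); last exact: probE.
have [A0|A0] := ltP 0 (prob mu A); last first.
  (* A null set decays at rate +oo, since n > 0. *)
  by rewrite le0_lneNy// gt0_muley ?leey// lte_fin invr_gt0 ltr0n.
rewrite lne_EFin// -EFinN -EFinM lee_fin mulrC ler_pdivlMr ?ltr0n//.
by rewrite lerNr -ler_expR lnK.
Qed.

Lemma limn_esup_decay_le (A : nat -> set (borel X)) (b : R) :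
  (forall n, measurable (A n)) ->
  (\forall n \near \oo, expR (- (b * n%:R)) <= prob mu (A n)) ->
  (limn_esup (fun n => decay_rate mu (A n) n) <= b%:E)%E.
Proof.
move=> mA bA; apply: limn_esup_le; near=> n; apply: decay_rate_le => //.
  by near: n; exact: nbhs_infty_gt.
by near: n.
Unshelve. all: by end_near. Qed.

Lemma limn_einf_decay_ge (A : nat -> set (borel X)) (b : R) :
  (forall n, measurable (A n)) ->
  (\forall n \near \oo, prob mu (A n) <= expR (- (b * n%:R))) ->
  (b%:E <= limn_einf (fun n => decay_rate mu (A n) n))%E.
Proof.
move=> mA bA; apply: limn_einf_ge; near=> n; apply: decay_rate_ge => //.
  by near: n; exact: nbhs_infty_gt.
by near: n.
Unshelve. all: by end_near. Qed.

End decay_rates.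

Section assembly.
Context {R : realType} {X : pmetricType R}.
Hypothesis cX : compact [set: X].
Variable f : X -> X.
Hypotheses (cf : continuous f) (lf : locally_injective f).
Variables (mu : probability (borel X) R) (muhat : probability (borel (pasts X)) R).
Variable J : borel X -> R.
Hypothesis Smu : invariant_measure (f : borel X -> borel X) mu.
Hypothesis Emu : ergodic_measure (f : borel X -> borel X) mu.
Hypothesis HJ : is_jacobian f mu J.
Hypothesis Hm : inverse_limit_measure f mu muhat.
Variables (g : borel X -> R) (K : R).
Hypotheses (mg : measurable_fun setT g) (g0 : forall x, 0 <= g x).
Hypothesis gK : forall x, g x <= K.
Hypothesis Jg : \forall x \ae mu, J x = expR (g x).
Hypothesis hfin : (measure_entropy (f : borel X -> borel X) mu < +oo)%E.
Hypothesis zJ : zero_boundary mu J.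

Local Notation fb := (f : borel X -> borel X).
Local Notation c :=
  (fine (measure_entropy fb mu) - fine (\int[mu]_x (g x)%:E)).

Let mf : measurable_fun setT fb.
Proof. exact: continuous_borel. Qed.

Lemma measurable_inverse_ball n (x : pasts X) (e : R) :
  measurable (inverse_ball f n x e : set (borel X)).
Proof.
apply: (measurable_inverse_set cX cf (A := fun i => [set y | mdist (x i) y < e]) n lf).
by move=> i; apply: open_borel; exact: open_mdist.
Qed.

Lemma measurable_inverse_atom (P : borel X -> set (borel X)) n (x : pasts X) :
  measurable_partition P -> measurable (inverse_atom f P n x : set (borel X)).
Proof.
move=> mP; apply: (measurable_inverse_set cX cf (A := fun i => P (x i)) n lf).
by move=> i; exact: measurable_partition_atom.
Qed.

(** The label records membership in balls of radius r/2 that cover the space; its entropy is a block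
    entropy of length 1, hence finite. *)
Lemma small_partition (r : R) : 0 < r -> exists P : borel X -> set (borel X),
  finite_entropy_partition mu P /\ forall x y, P x y -> mdist (x : X) y < r.
Proof.
move=> r0; have r2 : 0 < r / 2 by rewrite divr_gt0.
have [s sr] := finite_ball_cover cX (r := fun=> r / 2) (fun=> r2).
pose D (i : 'I_(size s)) : set (borel X) :=
  [set y | mdist (tnth (in_tuple s) i) y < r / 2].
pose l y := [ffun i => `[< D i y >]].
have ml : forall a, measurable (l @^-1` [set a]).
  by apply: measurable_ffun_label => i; apply: open_borel; exact: open_mdist.
pose P x : set (borel X) := [set y | l x = l y].
have Pl x y : P x y <-> l x = l y by [].
exists P; split; last first.
  move=> x y xy; have [z zs zx] := sr x.
  have [i zi] : exists i, z = tnth (in_tuple s) i by apply/tnthP; exact: zs.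
  have Dx : D i x by rewrite /D/= -zi.
  have Dy : D i y.
    by move/ffunP : xy => /(_ i); rewrite !ffunE asboolT// => /esym/asboolP.
  rewrite (le_lt_trans (metric_triangle x (tnth (in_tuple s) i) y))//.
  rewrite [mdist x _]metric_sym; have := Dx; have := Dy; rewrite /D/=; lra.
split.
  exists (fun k => if unpickle k is Some a then l @^-1` [set a] else set0).
    by move=> k; case: unpickle.
  move=> x; apply/seteqP; split => y /=.
    by move=> xy k; case: unpickle => //= a; rewrite xy.
  by move=> /(_ (pickle (l x))); rewrite pickleK /= => -[/(_ erefl)].
have := partition_entropy_joined mu mf ml Pl 1.
rewrite (_ : joined fb P 1 = P) => [->|]; first exact: ltry.
apply/funext => x; apply/seteqP; split => y /=; first by move=> /(_ 0%N); exact.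
by move=> Pxy [|].
Qed.

Lemma ae_esup_atom_le (P : borel X -> set (borel X)) :
  finite_entropy_partition mu P -> \forall x \ae muhat,
    (limn_esup (fun n => decay_rate mu (inverse_atom f P n x) n) <= c%:E)%E.
Proof.
move=> fP; have H : \forall x \ae muhat, forall k, \forall n \near \oo,
    expR (- ((c + k.+1%:R^-1) * n%:R)) <= prob mu (inverse_atom f P n x).
  apply: ae_foralln => k; apply: (inverse_atom_ge cX cf lf Smu Emu HJ Hm mg g0 gK Jg hfin) => //.
apply: ae_imply H => x H; apply/lee_addgt0Pr => e e0.
apply: (@le_trans _ _ (c + (Num.bound e^-1).+1%:R^-1)%:E).
  apply: (limn_esup_decay_le _ (H _)) => n.
  by apply: measurable_inverse_atom; case: fP.
by rewrite -EFinD lee_fin lerD2l ltW// inv_bound_lt.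
Qed.

(** Inverse balls contain the inverse atoms of fine enough partitions. Taking countably many
    partitions and errors leaves a single null set valid for all radii. *)
Lemma ae_esup_ball_le : \forall x \ae muhat, forall e, 0 < e ->
  (limn_esup (fun n => decay_rate mu (inverse_ball f n x e) n) <= c%:E)%E.
Proof.
have /choice[P HP] : forall k : nat, exists P : borel X -> set (borel X),
    finite_entropy_partition mu P /\ forall x y, P x y -> mdist (x : X) y < k.+1%:R^-1.
  by move=> k; apply: small_partition; rewrite invr_gt0.
have H : \forall x \ae muhat, forall k j, \forall n \near \oo,
    expR (- ((c + k.+1%:R^-1) * n%:R)) <= prob mu (inverse_atom f (P j) n x).
  apply: ae_foralln => k; apply: ae_foralln => j.
  apply: (inverse_atom_ge cX cf lf Smu Emu HJ Hm mg g0 gK Jg hfin) => //.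
  by case: (HP j).
have inv_small (e : R) : 0 < e -> exists k : nat, k.+1%:R^-1 < e.
  by move=> /inv_bound_lt; exists (Num.bound e^-1).
apply: ae_imply H => x H e e0; apply/lee_addgt0Pr => d d0.
have [k kd] := inv_small _ d0; have [j je] := inv_small _ e0.
apply: (@le_trans _ _ (c + k.+1%:R^-1)%:E); last first.
  by rewrite -EFinD lee_fin lerD2l ltW.
apply: limn_esup_decay_le; first by move=> n; exact: measurable_inverse_ball.
apply: filterS (H k j) => n /le_trans; apply.
apply: prob_le; [|exact: measurable_inverse_ball|].
  by apply: measurable_inverse_atom; case: (HP j) => -[].
move=> y [z [Iz <- Pz]]; exists z; split => // i ni.
by apply: lt_trans je; apply: (HP j).2; exact: Pz.
Qed.

(** Inverse balls shrink with their radius, so the bound at radius [r] serves all smaller ones on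
    the same set of full measure. *)
Lemma ae_einf_ball_ge (d : R) : 0 < d -> exists2 r : R, 0 < r &
  \forall x \ae muhat, forall e, e < r ->
    ((c - d)%:E <= limn_einf (fun n => decay_rate mu (inverse_ball f n x e) n))%E.
Proof.
move=> d0; have [r r0 H] := @inverse_ball_le _ _ cX _ cf lf _ _ _ Smu Emu HJ Hm
  _ _ mg g0 gK Jg hfin zJ _ d0.
exists r => //; apply: ae_imply H => x H e er.
apply: limn_einf_decay_ge; first by move=> n; exact: measurable_inverse_ball.
apply: filterS H => n; apply: le_trans; apply: prob_le.
- exact: measurable_inverse_ball.
- exact: measurable_inverse_ball.
- move=> y [z [Iz <- Bz]]; exists z; split => // i ni.
  by apply: lt_trans er; exact: Bz.
Qed.

Lemma ae_einf_ball_ge_all : \forall x \ae muhat, forall d, 0 < d ->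
  exists2 r : R, 0 < r & forall e, e < r ->
    ((c - d)%:E <= limn_einf (fun n => decay_rate mu (inverse_ball f n x e) n))%E.
Proof.
have H : \forall x \ae muhat, forall k : nat, exists2 r : R, 0 < r & forall e, e < r ->
    ((c - k.+1%:R^-1)%:E <= limn_einf (fun n => decay_rate mu (inverse_ball f n x e) n))%E.
  apply: ae_foralln => k.
  have [|r r0 H] := @ae_einf_ball_ge k.+1%:R^-1; first by rewrite invr_gt0.
  by apply: ae_imply H => x H; exists r.
apply: ae_imply H => x H d d0; have [r r0 Hr] := H (Num.bound d^-1).
exists r => // e /Hr; apply: le_trans.
by rewrite lee_fin lerD2l lerN2 ltW// inv_bound_lt.
Qed.

Lemma ae_local_inverse_entropy : \forall x \ae muhat,
  local_inverse_entropy_inf f mu x = c%:E /\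
  local_inverse_entropy_sup f mu x = c%:E.
Proof.
apply: ae_imply (ae_and ae_esup_ball_le ae_einf_ball_ge_all) => x [Hs Hi].
split; apply: lim_at_right0.
- by move=> e e0; apply: le_trans (Hs e e0); exact: limn_einf_sup.
- by move=> d /Hi[r r0 rH]; exists r => // e _; exact: rH.
- exact: Hs.
- move=> d /Hi[r r0 rH]; exists r => // e _ /rH /le_trans; apply.
  exact: limn_einf_sup.
Qed.

Let aIL := ae_inverse_limit cf Hm.

Lemma inverse_metric_entropyE :
  inverse_metric_entropy_inf f mu muhat = c%:E /\
  inverse_metric_entropy_sup f mu muhat = c%:E.
Proof.
split; apply: (full_integral_eq aIL); apply: ae_imply ae_local_inverse_entropy.
  by move=> x [].
by move=> x [].
Qed.

Let atom_einf_ge0 (P : borel X -> set (borel X)) x : measurable_partition P ->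
  (0 <= limn_einf (fun n => decay_rate mu (inverse_atom f P n x) n))%E.
Proof.
move=> mP; apply: limn_einf_ge; apply: nearW => n.
by apply: decay_rate_ge0; exact: measurable_inverse_atom.
Qed.

Lemma inverse_entropy_sup_along_le (P : borel X -> set (borel X)) :
  finite_entropy_partition mu P ->
  (inverse_entropy_sup_along f mu muhat P <= c%:E)%E.
Proof.
move=> fP; apply: full_integral_le; last exact: ae_esup_atom_le.
by move=> x; apply: le_trans (limn_einf_sup _); apply: atom_einf_ge0; case: fP.
Qed.

Lemma inverse_entropy_inf_sup_along (P : borel X -> set (borel X)) :
  finite_entropy_partition mu P ->
  (inverse_entropy_inf_along f mu muhat P <= inverse_entropy_sup_along f mu muhat P)%E.
Proof.
move=> fP; rewrite /inverse_entropy_inf_along /inverse_entropy_sup_along.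
rewrite integral_mkcond [leRHS]integral_mkcond.
apply: (@ge0_le_integral_off_null _ _ _ muhat set0) => //.
- by move=> x; rewrite patchE; case: ifP => // _; apply: atom_einf_ge0; case: fP.
- move=> x; rewrite patchE; case: ifP => // _.
  by apply: le_trans (limn_einf_sup _); apply: atom_einf_ge0; case: fP.
- by move=> x _; rewrite !patchE; case: ifP => // _; exact: limn_einf_sup.
Qed.

(** For a partition with atoms finer than [r], inverse atoms lie in inverse balls and inherit their
    upper bound. *)
Lemma inverse_entropy_inf_along_ge (d : R) : 0 < d ->
  exists2 P, finite_entropy_partition mu P &
    ((c - d)%:E <= inverse_entropy_inf_along f mu muhat P)%E.
Proof.
move=> d0; have [r r0 H] := @inverse_ball_le _ _ cX _ cf lf _ _ _ Smu Emu HJ Hm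
  _ _ mg g0 gK Jg hfin zJ _ d0.
have [P [fP Pr]] := small_partition r0; have mP : measurable_partition P by case: fP.
exists P => //; apply: (full_integral_ge aIL); first by move=> x; exact: atom_einf_ge0.
apply: ae_imply H => x H.
apply: limn_einf_decay_ge; first by move=> n; exact: measurable_inverse_atom.
apply: filterS H => n; apply: le_trans; apply: prob_le.
- exact: measurable_inverse_atom.
- exact: measurable_inverse_ball.
- move=> y [z [Iz <- Bz]]; exists z; split => // i ni.
  by apply: Pr; exact: Bz.
Qed.

Lemma inverse_partition_entropyE :
  inverse_partition_entropy_inf f mu muhat = c%:E /\
  inverse_partition_entropy_sup f mu muhat = c%:E.
Proof.
have le_c : (inverse_partition_entropy_sup f mu muhat <= c%:E)%E.
  by apply: ge_ereal_sup => _ [P fP <-]; exact: inverse_entropy_sup_along_le.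
have inf_sup : (inverse_partition_entropy_inf f mu muhat <=
    inverse_partition_entropy_sup f mu muhat)%E.
  apply: ge_ereal_sup => _ [P fP <-].
  apply: (le_trans (inverse_entropy_inf_sup_along fP)).
  by apply: ereal_sup_ubound; exists P.
have c_le : (c%:E <= inverse_partition_entropy_inf f mu muhat)%E.
  apply/lee_addgt0Pr => d d0; rewrite -leeBlDr// -EFinB.
  have [P fP /le_trans] := inverse_entropy_inf_along_ge d0; apply.
  by apply: ereal_sup_ubound; exists P.
split; apply/eqP; rewrite eq_le.
  by rewrite c_le (le_trans inf_sup).
by rewrite le_c (le_trans c_le).
Qed.

End assembly.

Local Open Scope ereal_scope.

Theorem theorem1p5 (R : realType) (X : pmetricType R) (f : X -> X)
    (mu : probability (borel X) R) (J : borel X -> R)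
    (k : R.-pker (borel X) ~> (borel X))
    (muhat : probability (borel (pasts X)) R) :
  compact [set: X] ->
  continuous f ->
  locally_injective f ->
  invariant_measure (f : borel X -> borel X) mu ->
  ergodic_measure (f : borel X -> borel X) mu ->
  positively_nonsingular f mu ->
  is_jacobian f mu J ->
  fiber_disintegration f mu k ->
  inverse_limit_measure f mu muhat ->
  zero_boundary mu J ->
  jacobian_bounded mu J ->
  measure_entropy (f : borel X -> borel X) mu < +oo ->
  [/\ has_inverse_metric_entropy f mu muhat,
      has_inverse_partition_entropy f mu muhat,
      inverse_metric_entropy f mu muhat
        = measure_entropy (f : borel X -> borel X) mu - folding_entropy f mu k &
      measure_entropy (f : borel X -> borel X) mu - folding_entropy f mu k
        = inverse_partition_entropy f mu muhat].
Proof.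
move=> cX cf lf Smu Emu _ HJ Hk Hm zJ bJ hfin.
have [g [K [mg g0 gK Jg intg]]] := log_jacobian cX cf lf Smu HJ bJ.
have [mi ms] := inverse_metric_entropyE cX cf lf Smu Emu HJ Hm mg g0 gK Jg hfin zJ.
have [pi ps] := inverse_partition_entropyE cX cf lf Smu Emu HJ Hm mg g0 gK Jg hfin zJ.
have ig : mu.-integrable setT (EFin \o g) := integrable_log_jacobian mu mg g0 gK.
have E : measure_entropy (f : borel X -> borel X) mu - folding_entropy f mu k =
    (fine (measure_entropy (f : borel X -> borel X) mu) -
     fine (\int[mu]_x (g x)%:E))%:E.
  rewrite (folding_entropyE cX cf lf Smu HJ Hk) intg EFinB !fineK//.
    exact: integrable_fin_num ig.
  exact: (measure_entropy_fin_num (continuous_borel cf) Smu Emu).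
split.
- by rewrite /has_inverse_metric_entropy mi ms.
- by rewrite /has_inverse_partition_entropy pi ps.
- by rewrite E.
- by rewrite E.
Qed.
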